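(* Let $X$ be a $k$-connected simplicial complex that is an ENR, such that $(k+1)\,TC(X)>\dim(X)+1$. Then $TC(X)=TC^M(X)$.
   Context: ENR means Euclidean neighborhood retract. $PX=X^{[0,1]}$ is the space of all paths in $X$ and $\pi:PX\to X\times X$ is the fibration $\pi(f)=(f(0),f(1))$. $TC(X)$ is the minimal number $k$ such that $X\times X$ admits an open cover $U_1,\dots,U_k$ such that over each $U_i$ there is a continuous section $s_i:U_i\to PX$ of $\pi$ (so $TC$ of a point is $1$). A section $s$ of $\pi$ over $U\subset X\times X$ is called reserved if $s(x,x)$ is the constant path at $x$ for every $(x,x)\in U$. $TC^M(X)$ (monoidal topological complexity) is the minimal $k$ such that $X\times X$ admits an open cover $U_1,\dots,U_k$ with continuous reserved sections $s_i:U_i\to PX$ of $\pi$. *)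

(* Defs.v *)
From HB Require Import structures.
From mathcomp Require Import all_boot all_order all_algebra finmap.
From mathcomp Require Import all_classical all_reals all_analysis.
Import Order.TTheory GRing.Theory Num.Theory.
Import numFieldNormedType.Exports.

Set Implicit Arguments.
Unset Strict Implicit.
Unset Printing Implicit Defensive.

Local Open Scope classical_set_scope.
Local Open Scope ring_scope.

(* Abstract simplicial complexes with vertices in V; elements of V lying in no
   simplex are allowed and contribute no point to the realization. *)
Record simplicialComplex (V : choiceType) := SimplicialComplex {
  simplex : set {fset V};
  simplex_neq0 : forall s, simplex s -> s != fset0;
  simplex_face : forall s t : {fset V},
    simplex s -> (t `<=` s)%fset -> t != fset0 -> simplex t
}.

(* Points of |K| in barycentric coordinates. *)
Definition is_barycentric (R : realType) (V : choiceType)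
    (K : simplicialComplex V) (x : {fsfun V -> R with 0}) : Prop :=
  [/\ simplex K (finsupp x), forall v, 0 <= x v & \sum_(v <- finsupp x) x v = 1].

Definition realization (R : realType) (V : choiceType)
    (K : simplicialComplex V) : Type :=
  set_type [set x : {fsfun V -> R with 0} | is_barycentric K x].

Section weak_topology.
Variables (R : realType) (V : choiceType) (K : simplicialComplex V).

HB.instance Definition _ := Choice.on (realization R K).

Definition bary (x : realization R K) : {fsfun V -> R with 0} := \val x.

Definition closed_simplex (s : {fset V}) : set (realization R K) :=
  [set x | (finsupp (bary x) `<=` s)%fset].

(* The weak (coherent) topology: A is open iff its trace on every closed
   simplex is open for the Euclidean topology of that simplex. *)
Definition weak_open (A : set (realization R K)) : Prop :=
  forall s : {fset V}, simplex K s -> forall x, closed_simplex s x -> A x ->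
    exists2 e : R, 0 < e & forall y, closed_simplex s y ->
      (forall v, v \in s -> `|bary x v - bary y v| < e) -> A y.

Let weak_openT : weak_open setT.
Proof. by move=> s Ks x sx _; exists 1. Qed.

Let weak_openI : setI_closed weak_open.
Proof.
move=> A B oA oB s Ks x sx [Ax Bx].
have [e e0 eA] := oA s Ks x sx Ax; have [f f0 fB] := oB s Ks x sx Bx.
exists (Num.min e f); first by rewrite lt_min e0.
move=> y sy xy; split; [apply: eA|apply: fB] => // v vs.
- by have := xy v vs; rewrite lt_min => /andP[].
- by have := xy v vs; rewrite lt_min => /andP[].
Qed.

Let weak_open_bigU (I : Type) (f : I -> set (realization R K)) :
  (forall i, weak_open (f i)) -> weak_open (\bigcup_i f i).
Proof.
move=> of_ s Ks x sx [i _ fix_]; have [e e0 ef] := of_ i s Ks x sx fix_.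
by exists e => // y sy xy; exists i => //; exact: ef.
Qed.

HB.instance Definition _ :=
  isOpenTopological.Build (realization R K)
    weak_openT weak_openI weak_open_bigU.

End weak_topology.

(* [complex_dim K = sup {#|s| - 1}], which is +oo if the dimension is unbounded (and
   -oo for the empty complex). *)
Definition complex_dim (R : realType) (V : choiceType) (K : simplicialComplex V) :
  \bar R := ereal_sup [set (#|` s|%:R - 1)%:E | s in simplex K].

Definition topological_embedding (X Y : topologicalType) (i : X -> Y) : Prop :=
  injective i /\
  forall A : set X, open A <-> exists2 B : set Y, open B & A = i @^-1` B.

(* X is homeomorphic to a retract of an open subset U of some R^n; the values
   of the retraction r outside U are irrelevant. *)
Definition ENR (R : realType) (X : topologicalType) : Prop :=
  exists (n : nat) (i : X -> 'rV[R]_n) (U : set 'rV[R]_n)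
         (r : 'rV[R]_n -> 'rV[R]_n),
    [/\ topological_embedding i, open U, range i `<=` U,
        {within U, continuous r} &
        r @` U `<=` range i /\ forall x, r (i x) = i x].

Section homotopy_groups.
Variables (R : realType) (X : topologicalType).

Definition cube (n : nat) : set 'rV[R]_n :=
  [set t | forall j, 0 <= t ord0 j <= 1].

Definition cube_boundary (n : nat) : set 'rV[R]_n :=
  [set t | cube t /\ exists j, t ord0 j = 0 \/ t ord0 j = 1].

(* Maps (I^n, dI^n) -> (X, x0), represented by total functions on R^n whose
   values outside the cube are irrelevant. *)
Definition spheroid (n : nat) (x0 : X) (f : 'rV[R]_n -> X) : Prop :=
  {within @cube n, continuous f} /\
  forall t, cube_boundary t -> f t = x0.

Definition spheroid_homotopic (n : nat) (x0 : X) (f g : 'rV[R]_n -> X) :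
    Prop :=
  exists H : R * 'rV[R]_n -> X,
    [/\ {within `[0, 1] `*` @cube n, continuous H},
        forall t, cube t -> H (0, t) = f t,
        forall t, cube t -> H (1, t) = g t &
        forall (a : R) t, a \in `[0, 1] -> cube_boundary t -> H (a, t) = x0].

(* [pi_n(X, x0)] has only one element; for n = 0 this says that every point is
   joined to x0 by a path. *)
Definition pi_trivial (n : nat) (x0 : X) : Prop :=
  forall f g : 'rV[R]_n -> X,
    spheroid x0 f -> spheroid x0 g -> spheroid_homotopic x0 f g.

Definition k_connected (k : nat) : Prop :=
  [set: X] !=set0 /\
  forall n, (n <= k)%N -> forall x0 : X, pi_trivial n x0.

End homotopy_groups.

Definition unit_interval (R : realType) : topologicalType :=
  set_type (`[0, 1]%classic : set R).

Fact unit_interval0_subproof (R : realType) :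
  (0 : R) \in (`[0, 1]%classic : set R).
Proof. by apply/mem_set; rewrite /= in_itv/= lexx ler01. Qed.

Fact unit_interval1_subproof (R : realType) :
  (1 : R) \in (`[0, 1]%classic : set R).
Proof. by apply/mem_set; rewrite /= in_itv/= lexx ler01. Qed.

Definition I0 (R : realType) : unit_interval R :=
  exist _ 0 (unit_interval0_subproof R).

Definition I1 (R : realType) : unit_interval R :=
  exist _ 1 (unit_interval1_subproof R).

Definition pathSpace (R : realType) (X : topologicalType) : Type :=
  continuousType (unit_interval R) X.

HB.instance Definition _ (R : realType) (X : topologicalType) :=
  Choice.on (pathSpace R X).

HB.instance Definition _ (R : realType) (X : topologicalType) :=
  Topological.copy (pathSpace R X)
    (initial_topology
      (fun p : pathSpace R X => (p : {compact-open, unit_interval R -> X}))).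

Section topological_complexity.
Variables (R : realType) (X : topologicalType).

Definition endpoints (p : pathSpace R X) : X * X := (p (I0 R), p (I1 R)).

(* Sections over U, represented by total functions whose values outside U are
   irrelevant. *)
Definition continuous_section (U : set (X * X)) (s : X * X -> pathSpace R X) :
    Prop :=
  {within U, continuous s} /\ forall p, U p -> endpoints (s p) = p.

Definition reserved (U : set (X * X)) (s : X * X -> pathSpace R X) : Prop :=
  forall x, U (x, x) -> forall t : unit_interval R, s (x, x) t = x.

Definition TC_cover (k : nat) : Prop :=
  exists U : 'I_k -> set (X * X),
    [/\ forall i, open (U i), \bigcup_i U i = setT &
        forall i, exists s, continuous_section (U i) s].

Definition TCM_cover (k : nat) : Prop :=
  exists U : 'I_k -> set (X * X),
    [/\ forall i, open (U i), \bigcup_i U i = setT &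
        forall i, exists2 s, continuous_section (U i) s & reserved (U i) s].

(* The infimum is a minimum if some finite cover exists, and +oo otherwise. *)
Definition TC : \bar R := ereal_inf [set k%:R%:E | k in TC_cover].

Definition TCM : \bar R := ereal_inf [set k%:R%:E | k in TCM_cover].

End topological_complexity.

(* Main.v *)
Require Import Defs.
From mathcomp Require Import all_boot all_order all_algebra finmap.
From mathcomp Require Import all_classical all_reals all_analysis.
From mathcomp Require Import ring lra.
Import Order.TTheory GRing.Theory Num.Theory.
Import numFieldNormedType.Exports.

Set Implicit Arguments.
Unset Strict Implicit.
Unset Printing Implicit Defensive.

Local Open Scope classical_set_scope.
Local Open Scope ring_scope.

(** Write [n] for the topological complexity. Restricting the [n] given local
    sections to the diagonal yields an open cover of [X] by [n] sets, over each
    of which there is a continuous family of loops [x |-> s (x, x)] based at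
    the moving point [x]; this is a section of the fibrewise [n]-fold join of
    the fibration of free loops over [X]. The fibre is the join of [n] copies of
    the loop space of a [k]-connected space, hence is
    [(n * (k + 1) - 2)]-connected, and the hypothesis says that the dimension of
    [X] does not exceed this number. So the section is homotopic to that given
    by constant loops on all of [X] ([complex_filling]). Near the diagonal
    points are joined by short segments, because [X] is a neighborhood retract,
    and so the homotopy can be inserted between the diagonal and the complement
    of a neighborhood: up to reparametrization the new sections are the old ones
    away from the diagonal, and they are constant on it ([reserved_paths]).

    The connectivity of the join is not used as such. A section of the join is
    kept as a [loop_cover]: [n] open sets covering the base, with loops over each
    of them, which may be given independently of each other on overlaps. The
    homotopy is built over one prism (a simplex times the unit interval) at a
    time ([skeleton_extension], [simplex_filling]), where the claim is that a
    loop cover on the boundary of a convex body of dimension [m < n * (k + 1)]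
    extends to the body ([gauge_filling], [inner_filling]). There one takes a
    fine cover of the body by tiles in [n * (k + 1)] colours, tiles of one colour
    being disjoint ([grid_bump_cover]), and gives [k + 1] of the colours to each
    of the [n] sets. The tiles of one group have a nerve of dimension at most
    [k], and loops over a complex of dimension [k] can be constructed face by
    face, because the prism over a face has dimension at most [k + 1] and maps
    from its boundary to [X] extend ([sphere_fill], [nerve_loops]). Near the
    boundary of the body the tiles are so small that their hulls lie in the sets
    where loops are given, and there the new loops are pulled back from the
    given ones along averages that slide from the point itself to the nerve.

    A loop over a point [p] is turned into a loop over a nearby point by
    conjugation with the image of a segment. Such conjugations, and the time
    they take, are the reason for the piecewise formulas below. *)

(** * Continuity on a subset *)

Section continuity_on.
Implicit Types (T U W : topologicalType).

(** This is continuity for the subspace topology; stated with filters of the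
    ambient space, it allows one function to be restricted and glued without
    changing its type. *)
Definition cts_on T U (A : set T) (f : T -> U) : Prop :=
  forall x, A x -> f y @[y --> within A (nbhs x)] --> f x.

(** [V] need not lie in [A]: what is open in [A] is the trace of [V]. *)
Definition relopen T (A V : set T) : Prop :=
  forall x, A x -> V x -> \forall y \near x, A y -> V y.

Lemma cts_on_within T U (A : set T) (f : T -> U) :
  cts_on A f <-> {within A, continuous f}.
Proof. by rewrite subspace_continuousP. Qed.

Lemma cts_on_sub T U (A B : set T) (f : T -> U) :
  A `<=` B -> cts_on B f -> cts_on A f.
Proof.
move=> AB cf x Ax W /(cf _ (AB _ Ax)); rewrite /= !nbhs_simpl /within /=.
by apply: filterS => y fy /AB.
Qed.

Lemma cts_on_eq T U (A : set T) (f g : T -> U) :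
  (forall x, A x -> f x = g x) -> cts_on A f -> cts_on A g.
Proof.
move=> fg cf x Ax W; rewrite -fg// => /(cf _ Ax).
rewrite /= !nbhs_simpl /within /=.
by apply: filterS => y fy Ay; rewrite /= -fg//; exact: fy.
Qed.

Lemma continuous_cts_on T U (A : set T) (f : T -> U) :
  continuous f -> cts_on A f.
Proof.
by move=> cf x _; apply: cvg_trans (cf x); apply: cvg_app; exact: cvg_within.
Qed.

Lemma cts_on_comp T U W (A : set T) (B : set U) (f : T -> U) (g : U -> W) :
  cts_on A f -> cts_on B g -> (forall x, A x -> B (f x)) ->
  cts_on A (fun x => g (f x)).
Proof.
move=> cf cg AB x Ax O /(cg _ (AB _ Ax)); rewrite /= !nbhs_simpl.
rewrite {1}/within /= => /(cf _ Ax); rewrite /= !nbhs_simpl /within /=.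
by apply: filterS => y + Ay => /(_ Ay); apply; exact: AB.
Qed.

Lemma cts_on_pair T U W (A : set T) (f : T -> U) (g : T -> W) :
  cts_on A f -> cts_on A g -> cts_on A (fun x => (f x, g x)).
Proof. by move=> cf cg x Ax; apply: cvg_pair; [exact: cf|exact: cg]. Qed.

Lemma cts_on_id T (A : set T) : cts_on A id.
Proof. by apply: continuous_cts_on => x. Qed.

Lemma cts_on_cst T U (A : set T) (c : U) : cts_on A (fun=> c).
Proof. by apply: continuous_cts_on => x; exact: cvg_cst. Qed.

Lemma cts_on_fst T U W (A : set T) (f : T -> U * W) :
  cts_on A f -> cts_on A (fun x => (f x).1).
Proof.
move=> cf; apply: (cts_on_comp (B := setT) cf) => //.
by apply: continuous_cts_on => -[a b]; exact: cvg_fst.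
Qed.

Lemma cts_on_snd T U W (A : set T) (f : T -> U * W) :
  cts_on A f -> cts_on A (fun x => (f x).2).
Proof.
move=> cf; apply: (cts_on_comp (B := setT) cf) => //.
by apply: continuous_cts_on => -[a b]; exact: cvg_snd.
Qed.

Lemma cts_on_finite_paste T U (I : finType) (S : set T) (A : I -> set T)
    (f : T -> U) :
  (forall x, S x -> exists i, A i x) -> (forall i, relopen S (~` A i)) ->
  (forall i, cts_on (S `&` A i) f) -> cts_on S f.
Proof.
move=> cov oA cf x Sx O fO; rewrite /= !nbhs_simpl /within /=.
have H i : \forall y \near x, S y -> A i y -> O (f y).
  have [Ax|nAx] := pselect (A i x).
    have := cf i x (conj Sx Ax) O fO; rewrite /= !nbhs_simpl /within /=.
    by apply: filterS => y fy Sy Ay; exact: fy.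
  by apply: filterS (oA i x Sx nAx) => y nAy Sy Ay; have := nAy Sy Ay.
have : \forall y \near x, forall i, S y -> A i y -> O (f y).
  exact: filter_forall.
by apply: filterS => y H1 Sy; have [i Ai] := cov y Sy; exact: (H1 i).
Qed.

Lemma cts_on_paste T U (S A B : set T) (f : T -> U) :
  (forall x, S x -> A x \/ B x) -> relopen S (~` A) -> relopen S (~` B) ->
  cts_on (S `&` A) f -> cts_on (S `&` B) f -> cts_on S f.
Proof.
move=> cov oA oB cA cB.
apply: (@cts_on_finite_paste _ _ bool S (fun b => if b then A else B)).
- by move=> x /cov[]; [exists true|exists false].
- by case.
- by case.
Qed.

Lemma relopenI T (S A B : set T) :
  relopen S A -> relopen S B -> relopen S (A `&` B).
Proof.
move=> oA oB x Sx [Ax Bx]; apply: filterS2 (oA x Sx Ax) (oB x Sx Bx).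
by move=> y HA HB Sy; split; [exact: HA|exact: HB].
Qed.

Lemma relopenU T (S A B : set T) :
  relopen S A -> relopen S B -> relopen S (A `|` B).
Proof.
move=> oA oB x Sx [Ax|Bx].
  by apply: filterS (oA x Sx Ax) => y HA Sy; left; exact: HA.
by apply: filterS (oB x Sx Bx) => y HB Sy; right; exact: HB.
Qed.

Lemma relopen_preimage T U (A : set T) (B V : set U) (f : T -> U) :
  cts_on A f -> (forall x, A x -> B (f x)) -> relopen B V ->
  relopen A (f @^-1` V).
Proof.
move=> cf AB oV x Ax Vfx.
have := cf x Ax _ (oV _ (AB _ Ax) Vfx); rewrite /= !nbhs_simpl /within /=.
by apply: filterS => y H Ay; apply: H => //; exact: AB.
Qed.

Lemma relopen_total T (A V : set T) : (forall x, A x -> V x) -> relopen A V.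
Proof. by move=> AV x _ _; apply: filterS filterT => y _; exact: AV. Qed.

Lemma relopen_forall T (I : finType) (A : set T) (V : I -> set T) :
  (forall i, relopen A (V i)) -> relopen A [set x | forall i, V i x].
Proof.
move=> oV x Ax Vx; have H i := oV i x Ax (Vx i).
have : \forall y \near x, forall i, A y -> V i y by exact: filter_forall.
by apply: filterS => y {}H Ay i; exact: H.
Qed.

Lemma relopen_local T (A V : set T) :
  (forall x, A x -> V x ->
     exists W : set T, [/\ relopen A W, W x & forall y, A y -> W y -> V y]) ->
  relopen A V.
Proof.
move=> H x Ax Vx; have [W [oW Wx WV]] := H x Ax Vx.
by apply: filterS (oW x Ax Wx) => y Wy Ay; apply: WV => //; exact: Wy.
Qed.

Lemma relopen_sub T (A B V : set T) : A `<=` B -> relopen B V -> relopen A V.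
Proof.
move=> AB oV x Ax Vx; apply: filterS (oV x (AB _ Ax) Vx) => y H /AB; exact: H.
Qed.

Lemma open_relopen T (A V : set T) : open V -> relopen A V.
Proof.
move=> oV x _ Vx; have : nbhs x V by exact: open_nbhs_nbhs.
by apply: filterS.
Qed.

Lemma open_near T (B P : set T) x :
  open B -> B x -> B `<=` P -> \forall y \near x, P y.
Proof. by move=> oB Bx BP; apply: filterS BP _; exact: open_nbhs_nbhs. Qed.

Lemma relopen_setT T (V : set T) : relopen setT V -> open V.
Proof.
move=> H; rewrite openE => x Vx; rewrite /interior.
by apply: filterS (H x I Vx) => y; apply.
Qed.

Lemma relopen_finite_paste T (I : finType) (S : set T)
    (A : I -> set T) (W : set T) :
  (forall x, S x -> exists i, A i x) -> (forall i, relopen S (~` A i)) ->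
  (forall i, relopen (S `&` A i) W) -> relopen S W.
Proof.
move=> cov oA oW x Sx Wx.
have H i : \forall y \near x, S y -> A i y -> W y.
  have [Ax|nAx] := pselect (A i x).
    by apply: filterS (oW i x (conj Sx Ax) Wx) => y Wy Sy Ay; exact: Wy.
  by apply: filterS (oA i x Sx nAx) => y nAy Sy Ay; have := nAy Sy Ay.
have {}H : \forall y \near x, forall i, S y -> A i y -> W y by exact: filter_forall.
by apply: filterS H => y H Sy; have [i Ai] := cov y Sy; exact: (H i).
Qed.

Lemma relopen_trans T (A U V : set T) :
  relopen A U -> relopen (A `&` U) V -> relopen A (U `&` V).
Proof.
move=> oU oV x Ax [Ux Vx]; apply: filterS2 (oU x Ax Ux) (oV x (conj Ax Ux) Vx).
by move=> y Uy Vy Ay; split; [exact: Uy|apply: Vy; split=> //; exact: Uy].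
Qed.

Lemma cts_on_open T U (A : set T) (f : T -> U) :
  (forall O, open O -> relopen A (f @^-1` O)) -> cts_on A f.
Proof.
move=> H x Ax B; rewrite nbhsE => -[G [oG Gx] GB].
rewrite /= !nbhs_simpl /within /=.
by apply: filterS (H G oG x Ax Gx) => y Hy Ay; apply: GB; exact: Hy.
Qed.

Lemma cts_on_preimage T U (A : set T) (f : T -> U) (O : set U) :
  open O -> cts_on A f -> relopen A (f @^-1` O).
Proof.
move=> oO cf; apply: (relopen_preimage (B := setT) cf) => //.
exact: open_relopen.
Qed.

Lemma cts_on_setT T U (f : T -> U) :
  cts_on setT f -> continuous f.
Proof. by move=> cf x; have := cf x I; rewrite withinET. Qed.

Section real_valued.
Context {R : realType}.

Lemma cts_onD T (A : set T) (f g : T -> R) :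
  cts_on A f -> cts_on A g -> cts_on A (fun x => f x + g x).
Proof. by move=> cf cg x Ax; apply: cvgD; [exact: cf|exact: cg]. Qed.

Lemma cts_onN T (A : set T) (f : T -> R) :
  cts_on A f -> cts_on A (fun x => - f x).
Proof. by move=> cf x Ax; apply: cvgN; exact: cf. Qed.

Lemma cts_onB T (A : set T) (f g : T -> R) :
  cts_on A f -> cts_on A g -> cts_on A (fun x => f x - g x).
Proof. by move=> cf cg; apply: cts_onD => //; exact: cts_onN. Qed.

Lemma cts_onDv T n (A : set T) (f g : T -> 'rV[R]_n) :
  cts_on A f -> cts_on A g -> cts_on A (fun x => f x + g x).
Proof. by move=> cf cg x Ax; apply: cvgD; [exact: cf|exact: cg]. Qed.

Lemma cts_onNv T n (A : set T) (f : T -> 'rV[R]_n) :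
  cts_on A f -> cts_on A (fun x => - f x).
Proof. by move=> cf x Ax; apply: cvgN; exact: cf. Qed.

Lemma cts_onBv T n (A : set T) (f g : T -> 'rV[R]_n) :
  cts_on A f -> cts_on A g -> cts_on A (fun x => f x - g x).
Proof. by move=> cf cg; apply: cts_onDv => //; exact: cts_onNv. Qed.

Lemma cts_onM T (A : set T) (f g : T -> R) :
  cts_on A f -> cts_on A g -> cts_on A (fun x => f x * g x).
Proof. by move=> cf cg x Ax; apply: cvgM; [exact: cf|exact: cg]. Qed.

Lemma cts_onZ T n (A : set T) (f : T -> R) (g : T -> 'rV[R]_n) :
  cts_on A f -> cts_on A g -> cts_on A (fun x => f x *: g x).
Proof. by move=> cf cg x Ax; apply: cvgZ; [exact: cf|exact: cg]. Qed.

Lemma cts_onV T (A : set T) (f : T -> R) :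
  cts_on A f -> (forall x, A x -> f x != 0) -> cts_on A (fun x => (f x)^-1).
Proof. by move=> cf f0 x Ax; apply: cvgV; [exact: f0|exact: cf]. Qed.

Lemma cts_on_norm T (A : set T) (f : T -> R) :
  cts_on A f -> cts_on A (fun x => `|f x|).
Proof. by move=> cf x Ax; apply: cvg_norm; exact: cf. Qed.

Lemma cts_on_normv T n (A : set T) (f : T -> 'rV[R]_n) :
  cts_on A f -> cts_on A (fun x => `|f x|).
Proof. by move=> cf x Ax; apply: cvg_norm; exact: cf. Qed.

Lemma cts_on_max T (A : set T) (f g : T -> R) :
  cts_on A f -> cts_on A g -> cts_on A (fun x => Num.max (f x) (g x)).
Proof.
move=> cf cg; apply: (cts_on_eq (f := fun x => 2^-1 * (f x + g x + `|f x - g x|))).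
  by move=> x _; rewrite maxr_absE mulrC.
apply: cts_onM; first exact: cts_on_cst.
apply: cts_onD; first exact: cts_onD.
by apply: cts_on_norm; exact: cts_onB.
Qed.

Lemma cts_on_min T (A : set T) (f g : T -> R) :
  cts_on A f -> cts_on A g -> cts_on A (fun x => Num.min (f x) (g x)).
Proof.
move=> cf cg; apply: (cts_on_eq (f := fun x => - Num.max (- f x) (- g x))).
  by move=> x _; rewrite oppr_max !opprK.
by apply: cts_onN; apply: cts_on_max; exact: cts_onN.
Qed.

Lemma cts_on_sum T (I : Type) (r : seq I) (A : set T)
    (f : I -> T -> R) :
  (forall i, cts_on A (f i)) -> cts_on A (fun x => \sum_(i <- r) f i x).
Proof.
move=> cf; elim: r => [|i r IH].
  by apply: (cts_on_eq (f := fun=> 0 : R)) => [x _|]; [rewrite big_nil|exact: cts_on_cst].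
apply: (cts_on_eq (f := fun x => f i x + \sum_(i <- r) f i x)).
  by move=> x _; rewrite big_cons.
exact: cts_onD.
Qed.

Lemma cts_on_sumv T n (I : Type) (r : seq I) (A : set T)
    (f : I -> T -> 'rV[R]_n) :
  (forall i, cts_on A (f i)) -> cts_on A (fun x => \sum_(i <- r) f i x).
Proof.
move=> cf; elim: r => [|i r IH].
  by apply: (cts_on_eq (f := fun=> 0 : 'rV[R]_n)) => [x _|]; [rewrite big_nil|exact: cts_on_cst].
apply: (cts_on_eq (f := fun x => f i x + \sum_(i <- r) f i x)).
  by move=> x _; rewrite big_cons.
exact: cts_onDv.
Qed.

Lemma cts_on_prod T (I : Type) (r : seq I) (A : set T) (f : I -> T -> R) :
  (forall i, cts_on A (f i)) -> cts_on A (fun x => \prod_(i <- r) f i x).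
Proof.
move=> cf; elim: r => [|i r IH].
  by apply: (cts_on_eq (f := fun=> 1 : R)) => [x _|]; [rewrite big_nil|exact: cts_on_cst].
apply: (cts_on_eq (f := fun x => f i x * \prod_(i <- r) f i x)).
  by move=> x _; rewrite big_cons.
exact: cts_onM.
Qed.

Lemma cts_on_coord T (n : nat) (A : set T) (f : T -> 'rV[R]_n) (i : 'I_n) :
  cts_on A f -> cts_on A (fun x => f x ord0 i).
Proof.
move=> cf; apply: (cts_on_comp (B := setT) (g := fun v : 'rV[R]_n => v ord0 i) cf) => //.
by apply: continuous_cts_on; exact: coord_continuous.
Qed.

Lemma cts_on_dist T (A : set T) (f : T -> R) :
  (forall x, A x -> forall e, 0 < e ->
     \forall y \near x, A y -> `|f x - f y| < e) -> cts_on A f.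
Proof. by move=> H x Ax; apply/cvgrPdist_lt => e e0; exact: H. Qed.

Lemma cts_on_row T (n : nat) (A : set T) (f : T -> 'rV[R]_n) :
  (forall i, cts_on A (fun x => f x ord0 i)) -> cts_on A f.
Proof.
move=> cf x Ax; apply/cvgrPdist_lt => e e0.
have H i : \forall y \near within A (nbhs x), `|f x ord0 i - f y ord0 i| < e.
  by have /cvgrPdist_lt/(_ e e0) := cf i x Ax.
have : \forall y \near within A (nbhs x), forall i, `|f x ord0 i - f y ord0 i| < e.
  exact: filter_forall.
apply: filterS => y Hy; rewrite /Num.norm /= mx_normrE.
apply: bigmax_lt => // -[a b] _ /=; rewrite !mxE (ord1 a); exact: Hy.
Qed.

Lemma cts_on_rowmx T (n : nat) (A : set T) (f : 'I_n -> T -> R) :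
  (forall i, cts_on A (f i)) -> cts_on A (fun x => \row_i f i x : 'rV[R]_n).
Proof.
move=> cf; apply: cts_on_row => i.
by apply: (cts_on_eq (f := f i)) => // x _; rewrite mxE.
Qed.

Lemma relopen_lt T (A : set T) (f g : T -> R) :
  cts_on A f -> cts_on A g -> relopen A [set x | f x < g x].
Proof.
move=> cf cg x Ax fg.
have H1 : \forall y \near x, A y -> f y < (f x + g x) / 2.
  have H : f x < (f x + g x) / 2 by move: fg => /=; lra.
  exact: (cvgr_lt (f x) (cf x Ax) _ H).
have H2 : \forall y \near x, A y -> (f x + g x) / 2 < g y.
  have H : (f x + g x) / 2 < g x by move: fg => /=; lra.
  exact: (cvgr_gt (g x) (cg x Ax) _ H).
apply: filterS2 H1 H2 => y H1 H2 Ay /=.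
by apply: lt_trans (H1 Ay) (H2 Ay).
Qed.

Lemma relopen_le_setC T (A : set T) (f g : T -> R) :
  cts_on A f -> cts_on A g -> relopen A (~` [set x | f x <= g x]).
Proof.
move=> cf cg; have -> : ~` [set x | f x <= g x] = [set x | g x < f x].
  by apply/seteqP; split => x /=; [move/negP; rewrite -ltNge|rewrite ltNge => /negP].
exact: relopen_lt.
Qed.

Lemma relopen_eq_setC T (A : set T)
    (f g : T -> R) :
  cts_on A f -> cts_on A g -> relopen A (~` [set x | f x = g x]).
Proof.
move=> cf cg.
have -> : ~` [set x | f x = g x] = [set x | f x < g x] `|` [set x | g x < f x].
  apply/seteqP; split => x /=.
    by move/eqP; rewrite neq_lt => /orP.
  by case=> + E; rewrite E ltxx.
by apply: relopenU; exact: relopen_lt.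
Qed.

Lemma cts_on_if T U (A : set T) (a b : T -> R) (f g : T -> U) :
  cts_on A a -> cts_on A b ->
  cts_on (A `&` [set x | a x <= b x]) f -> cts_on (A `&` [set x | b x <= a x]) g ->
  (forall x, A x -> a x = b x -> f x = g x) ->
  cts_on A (fun x => if a x <= b x then f x else g x).
Proof.
move=> ca cb cf cg fg.
apply: (cts_on_paste (A := [set x | a x <= b x]) (B := [set x | b x <= a x])).
- by move=> x _ /=; apply/orP; exact: le_total.
- exact: relopen_le_setC.
- exact: relopen_le_setC.
- by apply: cts_on_eq cf => x [_ /= ->].
- apply: cts_on_eq cg => x [Ax /= ba]; case: ifP => // ab.
  by apply/esym/fg => //; apply/le_anti/andP.
Qed.

Definition cyl T (A : set T) : set (T * R)%type :=
  [set p | A p.1 /\ 0 <= p.2 <= 1].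

End real_valued.
End continuity_on.

Section clamp.
Context {R : realType}.
Implicit Types (a b x : R).

Definition clamp a b x : R := Num.max a (Num.min b x).

Lemma clamp_itv a b x : a <= b -> a <= clamp a b x <= b.
Proof.
move=> ab; rewrite /clamp le_max lexx /= ge_max ab /=.
by rewrite ge_min lexx.
Qed.

Lemma clamp_id a b x : a <= x <= b -> clamp a b x = x.
Proof. by move=> /andP[ax xb]; rewrite /clamp (min_idPr xb) (max_idPr ax). Qed.

Lemma clamp_lo a b x : x <= a -> a <= b -> clamp a b x = a.
Proof.
move=> xa ab; rewrite /clamp (min_idPr (le_trans xa ab)); exact/max_idPl.
Qed.

Lemma clamp_hi a b x : b <= x -> a <= b -> clamp a b x = b.
Proof. by move=> bx ab; rewrite /clamp (min_idPl bx); exact/max_idPr. Qed.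

Lemma cts_on_clamp (T : topologicalType) (A : set T) a b (f : T -> R) :
  cts_on A f -> cts_on A (fun y => clamp a b (f y)).
Proof.
move=> cf; apply: cts_on_max; first exact: cts_on_cst.
by apply: cts_on_min => //; exact: cts_on_cst.
Qed.

End clamp.

Arguments cts_on_id {T A}.
Arguments cts_on_cst {T U A} c.

(* The syntactic patterns keep unification from unfolding the arithmetic
   operations while searching for a matching rule. *)
Ltac by_codomain f on_row on_scalar :=
  let t := type of f in
  lazymatch t with
  | forall _, ?c =>
    let c' := eval hnf in c in
    lazymatch c' with
    | matrix _ _ _ => on_row ()
    | _ => on_scalar ()
    end
  end.
Ltac cts_step :=
  lazymatch goal with
  | |- cts_on _ (fun x => x) => apply cts_on_id
  | |- cts_on _ id => apply cts_on_id
  | |- cts_on _ (@Num.norm ?K ?V) =>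
      by_codomain (fun x : V => x)
        ltac:(fun _ => apply (cts_on_normv cts_on_id))
        ltac:(fun _ => apply (cts_on_norm cts_on_id))
  | |- cts_on _ fst => apply (cts_on_fst cts_on_id)
  | |- cts_on _ snd => apply (cts_on_snd cts_on_id)
  | |- cts_on _ (fun _ => ?c) => apply cts_on_cst
  | |- cts_on _ (fun x => (_, _)) => apply cts_on_pair
  | |- cts_on _ (fun x => fst (@?f x)) => apply (@cts_on_fst _ _ _ _ f)
  | |- cts_on _ (fun x => snd (@?f x)) => apply (@cts_on_snd _ _ _ _ f)
  | |- cts_on _ (fun x => (@?f x - _)%R) =>
      by_codomain f ltac:(fun _ => apply cts_onBv) ltac:(fun _ => apply cts_onB)
  | |- cts_on _ (fun x => (@?f x + _)%R) =>
      by_codomain f ltac:(fun _ => apply cts_onDv) ltac:(fun _ => apply cts_onD)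
  | |- cts_on _ (fun x => (- @?f x)%R) =>
      by_codomain f ltac:(fun _ => apply cts_onNv) ltac:(fun _ => apply cts_onN)
  | |- cts_on _ (fun x => (_ * _)%R) => apply cts_onM
  | |- cts_on _ (fun x => (_ *: _)%R) => apply cts_onZ
  | |- cts_on _ (fun x => `|@?f x|%R) =>
      by_codomain f
        ltac:(fun _ => apply (@cts_on_normv _ _ _ _ f))
        ltac:(fun _ => apply (@cts_on_norm _ _ _ f))
  | |- cts_on _ (fun x => Num.max _ _) => apply cts_on_max
  | |- cts_on _ (fun x => Num.min _ _) => apply cts_on_min
  | |- cts_on _ (fun x => \sum_(i <- _) _) =>
      first [apply cts_on_sum; intro | apply cts_on_sumv; intro]
  | |- cts_on _ (fun x => fun_of_matrix _ _ _) => apply cts_on_coord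
  | |- cts_on _ (fun x => clamp _ _ _) => apply cts_on_clamp
  | |- @cts_on ?T ?U ?A (?h ?c) => change (@cts_on T U A (fun x => h c x)); cts_step
  end; cbv beta.
Ltac cts :=
  repeat first
    [ match goal with H : cts_on ?A ?f |- cts_on ?A ?f => exact H end
    | cts_step
    | assumption ].

(** * Filling spheres *)

Section sphere_filling.
Context {R : realType} (r : nat).
Local Notation pt := ('rV[R]_r * R)%type.

Definition boxnorm (u : pt) : R := Num.max `|u.1| `|u.2|.

Definition box_ball : set pt := [set u | boxnorm u <= 1].
Definition box_sphere : set pt := [set u | boxnorm u = 1].

(* [rot s] slides the sphere over itself, from the identity at [s = 0] to a map
   that collapses [J], the union of all faces but the top one, to [base]. On the
   top face it is a dilation followed by [q], which wraps the ball of radius 4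
   around the sphere. *)
Let J : set pt := [set u | 1 <= `|u.1| \/ u.2 <= -1].

Let q (w : 'rV[R]_r) : pt :=
  ((Num.min 1 (4 - `|w|) / Num.max 1 `|w|) *: w, clamp (-1) 1 (2 - `|w|)).

Let rJ (s : R) (u : pt) : pt :=
  (clamp 0 1 (2 + u.2 - 3 * s) *: u.1, clamp (-1) 1 (u.2 - 3 * s)).

Let rot (s : R) (u : pt) : pt :=
  if 1 <= u.2 then q ((1 + 3 * s) *: u.1) else rJ s u.

Let base : pt := (0, -1).

Let sphereP (u : pt) :
  `|u.1| <= 1 -> `|u.2| <= 1 -> `|u.1| = 1 \/ `|u.2| = 1 -> box_sphere u.
Proof.
rewrite /box_sphere /boxnorm /= => u1 u2 [->|->]; first exact/max_idPl.
exact/max_idPr.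
Qed.

Let sphereE (u : pt) : box_sphere u ->
  [/\ `|u.1| <= 1, -1 <= u.2, u.2 <= 1 & [\/ `|u.1| = 1, u.2 = 1 | u.2 = -1]].
Proof.
rewrite /box_sphere /boxnorm /= => u1.
have a1 : `|u.1| <= 1 by rewrite -u1 le_max lexx.
have a2 : `|u.2| <= 1 by rewrite -u1 le_max lexx orbT.
split=> //; [by move: a2; rewrite ler_norml => /andP[]|
             by move: a2; rewrite ler_norml => /andP[]|].
move: u1; rewrite maxEle; case: ifP => _ E; last by constructor 1.
by case: (ger0P u.2) E => _ E; [constructor 2|constructor 3; lra].
Qed.

Let qE1 w : `|w| <= 1 -> q w = (w, 1).
Proof.
move=> w1; rewrite /q (max_idPl w1) (min_idPl _); last by lra.
by rewrite divr1 scale1r clamp_hi//; lra.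
Qed.

Let qE2 w : 1 <= `|w| -> `|w| <= 3 -> q w = (`|w|^-1 *: w, 2 - `|w|).
Proof.
move=> w1 w3; rewrite /q (max_idPr w1) (min_idPl _); last by lra.
by rewrite mul1r clamp_id//; lra.
Qed.

Let qE3 w : 3 <= `|w| -> `|w| <= 4 -> q w = (((4 - `|w|) / `|w|) *: w, -1).
Proof.
move=> w3 w4; rewrite /q (max_idPr _); last by lra.
by rewrite (min_idPr _); [rewrite clamp_lo//; lra|lra].
Qed.

Let q_sphere w : `|w| <= 4 -> box_sphere (q w).
Proof.
move=> w4; have [w1|w1] := leP `|w| 1.
  by rewrite qE1//; apply: sphereP => //=; rewrite ?normr1//; right.
have w0 : `|w| != 0 by rewrite gt_eqF//; lra.
have [w3|w3] := leP `|w| 3.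
  rewrite qE2//; last by lra.
  have E : `|(`|w|^-1 *: w)| = 1.
    by rewrite normrZ gtr0_norm ?invr_gt0 ?mulVf//; lra.
  by apply: sphereP => /=; rewrite ?E//; [rewrite ler_norml; lra|left].
rewrite qE3//; last by lra.
have E : `|((4 - `|w|) / `|w|) *: w| = 4 - `|w|.
  rewrite normrZ ger0_norm; last by apply: divr_ge0; lra.
  by rewrite divfK.
by apply: sphereP => /=; rewrite ?E ?normrN1 //; [lra|right].
Qed.

Let qbase w : `|w| = 4 -> q w = base.
Proof. by move=> w4; rewrite qE3 ?w4 ?subrr ?mul0r ?scale0r//; lra. Qed.

Let cts_q A : cts_on A q.
Proof.
rewrite /q; cts; apply: cts_onV; first by cts.
by move=> w _; rewrite gt_eqF// lt_max ltr01.
Qed.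

Let rJ_sphere s u : 0 <= s <= 1 -> box_sphere u -> J u -> box_sphere (rJ s u).
Proof.
move=> s01 /sphereE[u1 h1 h2 _] Ju.
have /andP[c0 c1] := clamp_itv (2 + u.2 - 3 * s) (@ler01 R).
have /andP[d0 d1] : -1 <= clamp (-1) 1 (u.2 - 3 * s) <= 1.
  by apply: clamp_itv; lra.
apply: sphereP; rewrite /= ?normrZ ?(ger0_norm c0).
- exact: mulr_ile1.
- by rewrite ler_norml d0 d1.
case: (leP (-1) (u.2 - 3 * s)) => h; last first.
  by right; rewrite clamp_lo ?normrN1//; lra.
case: Ju => [v1|hm1].
  by left; rewrite clamp_hi ?mul1r//; [apply/le_anti/andP|lra].
by right; rewrite clamp_lo ?normrN1//; lra.
Qed.

Let rot_sphere s u : 0 <= s <= 1 -> box_sphere u -> box_sphere (rot s u).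
Proof.
move=> s01 Su; rewrite /rot; case: (leP 1 u.2) => h.
  apply: q_sphere; rewrite normrZ ger0_norm; last by lra.
  have [u1 _ _ _] := sphereE Su.
  have -> : 4 = 4 * 1 :> R by rewrite mulr1.
  by apply: ler_pM => //; lra.
apply: rJ_sphere => //; have [_ _ _ []] := sphereE Su.
- by move=> E; left; rewrite /= E.
- by move=> E; move: h; rewrite E ltxx.
- by move=> E; right; rewrite /= E.
Qed.

Let rim s u : 0 <= s <= 1 -> box_sphere u -> 1 <= u.2 -> J u ->
  q ((1 + 3 * s) *: u.1) = rJ s u.
Proof.
move=> s01 /sphereE[v1 h1 h2 _] h3 Ju.
have hE : u.2 = 1 by apply/le_anti/andP.
have vE : `|u.1| = 1 by case: Ju => [?|]; [apply/le_anti/andP|lra].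
have nE : `|(1 + 3 * s) *: u.1| = 1 + 3 * s.
  by rewrite normrZ vE mulr1 ger0_norm//; lra.
rewrite /rJ hE; have [s3|s3] := leP s (2 / 3).
  rewrite qE2 ?nE; [|lra|lra].
  rewrite scalerA mulVf ?gt_eqF//; last by lra.
  rewrite clamp_hi; [|lra|exact: ler01].
  rewrite clamp_id; last by lra.
  by congr (_, _); lra.
rewrite qE3 ?nE; [|lra|lra].
rewrite scalerA divfK ?gt_eqF//; last by lra.
rewrite clamp_id; last by lra.
rewrite clamp_lo; [|lra|lra].
by congr (_ *: _, _); lra.
Qed.

Let rot0 u : box_sphere u -> rot 0 u = u.
Proof.
move=> Su; have [v1 h1 h2 H] := sphereE Su; rewrite /rot; case: (leP 1 u.2) => h.
  rewrite mulr0 addr0 scale1r qE1//.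
  by rewrite [RHS]surjective_pairing; congr (_, _); lra.
rewrite /rJ mulr0 !subr0 clamp_hi//; last by lra.
rewrite clamp_id; last by lra.
by rewrite scale1r -surjective_pairing.
Qed.

Let rot1 u : box_sphere u -> J u -> rot 1 u = base.
Proof.
move=> Su Ju; have [v1 h1 h2 H] := sphereE Su.
have -> : rot 1 u = rJ 1 u.
  by rewrite /rot; case: (leP 1 u.2) => h //; apply: rim => //; lra.
by rewrite /rJ clamp_lo ?clamp_lo ?scale0r//; lra.
Qed.

Let cts_rot : cts_on [set us : pt * R | box_sphere us.1 /\ 0 <= us.2 <= 1]
  (fun us => rot us.2 us.1).
Proof.
set S := (X in cts_on X _).
have cJ A : cts_on A (fun us : pt * R => rJ us.2 us.1) by rewrite /rJ; cts.
have cQ A : cts_on A (fun us : pt * R => q ((1 + 3 * us.2) *: us.1.1)).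
  by apply: (cts_on_comp (B := setT)) => //; cts.
pose B : set (pt * R)%type := [set us : (pt * R)%type | 1 <= `|us.1.1|] `|` [set us : (pt * R)%type | us.1.2 <= -1].
pose A : set (pt * R)%type := [set us | 1 <= us.1.2].
apply: (@cts_on_paste _ _ S A B).
- move=> us [/sphereE[v1 h1 h2 H] _]; case: H => E.
  + by right; left; rewrite /= E.
  + by left; rewrite /A /= E.
  + by right; right; rewrite /= E.
- by apply: relopen_le_setC; cts.
- have oB1 : relopen S (~` [set us : (pt * R)%type | 1 <= `|us.1.1|]) by apply: relopen_le_setC; cts.
  have oB2 : relopen S (~` [set us : (pt * R)%type | us.1.2 <= -1]) by apply: relopen_le_setC; cts.
  by have := relopenI oB1 oB2; rewrite -setCU.
- apply: (cts_on_eq _ (cQ _)).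
  by move=> us [_ h]; rewrite /rot h.
- apply: (cts_on_eq _ (cJ _)) => us [[Su s01] JJ]; rewrite /rot; case: ifP => // h.
  by rewrite -rim.
Qed.

Let cts_boxnorm A : cts_on A boxnorm.
Proof. by rewrite /boxnorm; cts. Qed.

Let boxnorm_ge0 u : 0 <= boxnorm u.
Proof. by rewrite /boxnorm le_max normr_ge0. Qed.

Let boxnormZ (c : R) u : 0 <= c -> boxnorm (c *: u.1, c * u.2) = c * boxnorm u.
Proof.
by move=> c0; rewrite /boxnorm /= normrZ normrM ger0_norm// maxr_pMr.
Qed.

Variables (X : topologicalType) (k : nat).
Hypothesis Xk : k_connected R X k.
Hypothesis rk : (r <= k)%N.

(** A map on the boundary of the box is first slid along itself until it is
    constant off the top face; the top face is then a spheroid, and its null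
    homotopy fills what remains of the box. *)
Lemma sphere_fill (f : pt -> X) : cts_on box_sphere f ->
  exists2 F : pt -> X, cts_on box_ball F & forall u, box_sphere u -> F u = f u.
Proof.
move=> cf; pose b0 := f base.
pose g (w : 'rV[R]_r) := f (q (4 *: (2 *: w - const_mx 1))).
have normg (w : 'rV[R]_r) : cube w -> `|4 *: (2 *: w - const_mx 1)| <= 4.
  move=> cw; rewrite normrZ ger0_norm// -[leRHS]mulr1 ler_wpM2l//.
  rewrite /Num.norm /= mx_normrE; apply: bigmax_le => // -[a c] _ /=.
  rewrite !mxE (ord1 a) ler_norml; have := cw c; lra.
have sg : spheroid b0 g.
  split.
    apply/cts_on_within.
    apply: (cts_on_comp (f := fun w : 'rV[R]_r => q (4 *: (2 *: w - const_mx 1))) _ cf).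
      apply: (cts_on_comp _ (@cts_q setT)) => //.
      by cts.
    by move=> w cw; exact: (q_sphere (normg _ cw)).
  move=> w [cw [j wj]]; rewrite /g qbase//; apply/le_anti; rewrite normg//=.
  rewrite normrZ ger0_norm// -[leLHS]mulr1 ler_wpM2l//.
  rewrite /Num.norm /= mx_normrE; apply: le_trans (le_bigmax _ _ (ord0, j)) => /=.
  by rewrite !mxE; case: wj => ->; rewrite ?mulr0 ?sub0r ?normrN1 ?mulr1//;
     rewrite ler_normr; lra.
have sc : spheroid b0 (fun _ : 'rV[R]_r => b0).
  by split=> //; apply/cts_on_within; exact: cts_on_cst.
have [H [cH H0 H1 Hb]] := Xk.2 r rk b0 g _ sg sc.
have {}cH := (cts_on_within _ _).2 cH.
pose F' (u : pt) := H ((1 - u.2) / 2, 2^-1 *: (u.1 + const_mx 1)).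
have boxcube (u : pt) : box_ball u -> @cube R r (2^-1 *: (u.1 + const_mx 1)).
  rewrite /box_ball /boxnorm /= ge_max => /andP[+ _] j; rewrite !mxE => u1.
  have : `|u.1 ord0 j| <= 1.
    apply: le_trans u1; rewrite {2}/Num.norm /= mx_normrE.
    exact: (le_bigmax _ (fun ij => `|u.1 ij.1 ij.2|) (ord0, j)).
  by rewrite ler_norml; lra.
have cF' : cts_on box_ball F'.
  apply: (cts_on_comp (f := fun u : pt => ((1 - u.2) / 2, 2^-1 *: (u.1 + const_mx 1))) _ cH).
    by cts.
  move=> u bu; split => /=; last exact: boxcube.
  move: bu; rewrite /box_ball /boxnorm /= ge_max => /andP[_].
  by rewrite ler_norml in_itv /=; lra.
have F'S (u : pt) : box_sphere u -> F' u = f (rot 1 u).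
  move=> Su; have bu : box_ball u by rewrite /box_ball /= (Su : boxnorm u = 1).
  have [v1 h1 h2 HH] := sphereE Su.
  have i01 : (1 - u.2) / 2 \in `[0, 1]%R by rewrite in_itv /=; lra.
  case: (pselect (J u)) => [Ju|nJ].
    rewrite rot1// /F'; case: Ju => [v1'|hm].
      apply: Hb => //; split; first exact: boxcube.
      have vE : mx_norm u.1 = 1 by apply/le_anti/andP.
      have [|[a j] /= E] := @mx_norm_neq0 _ _ _ u.1; first by rewrite vE oner_neq0.
      rewrite (ord1 a) vE in E; exists j; rewrite !mxE.
      by case: (ger0P (u.1 ord0 j)) E => _ E; [right|left]; lra.
    have -> : (1 - u.2) / 2 = 1 by lra.
    by rewrite H1//; exact: boxcube.
  have uh : u.2 = 1.
    by case: HH => // E; exfalso; apply: nJ; [left|right]; rewrite E.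
  rewrite /F' uh subrr mul0r H0; last exact: boxcube.
  rewrite /g /rot uh lexx; congr (f (q _)).
  rewrite scalerA divff// scale1r addrK; congr (_ *: _); lra.
pose F (u : pt) := if 1 <= 2 * boxnorm u
  then f (rot (2 - 2 * boxnorm u) ((boxnorm u)^-1 *: u.1, (boxnorm u)^-1 * u.2))
  else F' (2 *: u.1, 2 * u.2).
exists F; last first.
  move=> u Su; have uE : boxnorm u = 1 by [].
  rewrite /F uE mulr1 ler1n /= subrr invr1 scale1r mul1r -surjective_pairing.
  by rewrite rot0.
have scaleS (u : pt) : boxnorm u != 0 ->
    box_sphere ((boxnorm u)^-1 *: u.1, (boxnorm u)^-1 * u.2).
  move=> u0; rewrite /box_sphere /= boxnormZ ?invr_ge0//; exact: mulVf.
apply: cts_on_if.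
- exact: cts_on_cst.
- by cts.
- apply: (cts_on_comp (B := box_sphere)) => //.
    apply: (cts_on_comp (g := fun us : pt * R => rot us.2 us.1)
      (f := fun u : pt => (((boxnorm u)^-1 *: u.1, (boxnorm u)^-1 * u.2), 2 - 2 * boxnorm u)) _ cts_rot).
      have cb := @cts_boxnorm (box_ball `&` [set u | 1 <= 2 * boxnorm u]).
      have cbV : cts_on (box_ball `&` [set u | 1 <= 2 * boxnorm u])
          (fun u => (boxnorm u)^-1).
        by apply: cts_onV => // u [_ /= h]; rewrite gt_eqF//; lra.
      by cts.
    move=> u [u1 /= h]; have {}u1 : boxnorm u <= 1 by [].
    split=> /=; last by lra.
    by apply: scaleS; rewrite gt_eqF//; lra.
  move=> u [u1 /= h]; have {}u1 : boxnorm u <= 1 by [].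
  apply: rot_sphere; first by lra.
  by apply: scaleS; rewrite gt_eqF//; lra.
- apply: (cts_on_comp (B := box_ball)) => //; first by cts.
  by move=> u [_ /= h]; rewrite /box_ball /= boxnormZ.
- move=> u bu h; have uE : boxnorm u = 2^-1 by lra.
  have -> : 2 - 2 * boxnorm u = 1 by lra.
  rewrite -F'S; last by apply: scaleS; rewrite uE invr_eq0.
  by rewrite uE invrK.
Qed.

End sphere_filling.

Arguments box_ball {R r}.
Arguments box_sphere {R r}.

(** * Extension over skeleta *)

Section skeleton.
Variables (P Y Cell : Type) (dim : Cell -> nat) (carrier : P -> Cell).
Variables (body : Cell -> set P) (ok : Cell -> (P -> Y) -> Prop).
Hypothesis carrier_dim : forall c y, body c y ->
  carrier y = c \/ (dim (carrier y) < dim c)%N.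
Hypothesis ok_local : forall c f g,
  (forall y, body c y -> f y = g y) -> ok c f -> ok c g.
Hypothesis ok_extend : forall c f,
  (forall c', (dim c' < dim c)%N -> ok c' f) ->
  exists2 g, ok c g & forall y, body c y -> carrier y <> c -> g y = f y.

(** All cells of one dimension can be treated at once, because they only meet
    in points carried by cells of lower dimension. *)
Lemma skeleton_extension (f0 : P -> Y) (N : nat) :
  exists f, forall c, (dim c < N)%N -> ok c f.
Proof.
elim: N => [|N [f IH]]; first by exists f0.
have H c : exists g, dim c = N -> ok c g /\
    forall y, body c y -> carrier y <> c -> g y = f y.
  have [E|nE] := pselect (dim c = N); last by exists f.
  by have [|g okg gf] := @ok_extend c f; [rewrite E|exists g].
have [G HG] := choice H.
exists (fun y => if dim (carrier y) == N then G (carrier y) y else f y) => c.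
rewrite ltnS leq_eqVlt => /orP[/eqP cN|cN].
  have [okG Gf] := HG c cN.
  apply: ok_local okG => y cy; have [->|cl] := carrier_dim cy.
    by rewrite cN eqxx.
  rewrite -cN (ltn_eqF cl); apply: Gf => // E.
  by move: cl; rewrite E ltnn.
apply: ok_local (IH c cN) => y cy.
by have [->|cl] := carrier_dim cy; rewrite ltn_eqF//; apply: ltn_trans cl cN.
Qed.

End skeleton.

Section cube_faces.
Context {R : realType} (N : nat).
Local Notation cell := {ffun 'I_N -> option bool}.
Implicit Types (c : cell) (y : 'rV[R]_N).

(** A face of the unit cube: [Some b] pins a coordinate to [b], [None] leaves
    it free. *)
Definition face_body c : set 'rV[R]_N :=
  [set y | forall i, if c i is Some b then y ord0 i = b%:R
                     else 0 <= y ord0 i <= 1].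

Definition face_dim c : nat := #|[pred i | c i == None]|.

Definition face_carrier y : cell :=
  [ffun i => if y ord0 i == 0 then Some false
             else if y ord0 i == 1 then Some true else None].

Definition is_face (c' c : cell) : Prop :=
  forall i b, c i = Some b -> c' i = Some b.

Lemma face_carrierP c y : face_body c y -> is_face (face_carrier y) c.
Proof.
move=> cy i b ci; have := cy i; rewrite ci ffunE => ->.
by case: b ci => _; rewrite ?eqxx ?oner_eq0.
Qed.

Lemma face_carrier_body c y : face_body c y -> face_body (face_carrier y) y.
Proof.
move=> cy i; rewrite ffunE; case: eqP => // _; case: eqP => // _.
have := cy i; case: (c i) => // b ->.
by case: b; rewrite ?lexx ler01.
Qed.

Lemma is_face_body c' c y : is_face c' c -> face_body c' y -> face_body c y.
Proof.
move=> fc cy i; have := cy i; have := fc i; case: (c i) => [b /(_ b erefl) ->//|_].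
by case: (c' i) => // b ->; case: b; rewrite ?lexx ler01.
Qed.

Lemma is_face_dim c' c : is_face c' c -> c' <> c -> (face_dim c' < face_dim c)%N.
Proof.
move=> fc ne; apply/proper_card/properP; split.
  apply/fintype.subsetP => i; rewrite !inE => /eqP ci; apply/eqP.
  by case E : (c i) => [b|//]; rewrite (fc _ _ E) in ci.
have : exists i, c' i != c i.
  apply/existsP; rewrite -negb_forall; apply/negP => /forallP E.
  by apply: ne; apply/ffunP => i; apply/eqP.
move=> [i ci]; case E : (c i) ci => [b|] ci; first by rewrite (fc _ _ E) eqxx in ci.
by exists i; rewrite !inE ?E.
Qed.

Lemma face_carrier_dim c y : face_body c y ->
  face_carrier y = c \/ (face_dim (face_carrier y) < face_dim c)%N.
Proof.
move=> cy; have [->|ne] := pselect (face_carrier y = c); first by left.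
by right; apply: is_face_dim => //; exact: face_carrierP.
Qed.

Lemma relopen_face_setC c (S : set ('rV[R]_N * R)) :
  relopen S (~` [set p | face_body c p.1]).
Proof.
move=> [y t] Sy /= ncy.
have [i ni] : exists i, ~ (if c i is Some b then y ord0 i = b%:R
                     else 0 <= y ord0 i <= 1) by apply/existsNP.
have ci : cts_on S (fun p : 'rV[R]_N * R => p.1 ord0 i) by cts.
have sub (B : set ('rV[R]_N * R)) : relopen S B -> B (y, t) ->
    B `<=` ~` [set p | face_body c p.1] -> \forall p \near (y, t), S p -> ~ face_body c p.1.
  by move=> oB By BS; apply: filterS (oB _ Sy By) => p H Sp; apply: BS; exact: H.
case E : (c i) ni => [b|] ni.
  apply: (sub _ (relopen_eq_setC ci (cts_on_cst (b%:R : R)))) => //.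
  by move=> p /= np cp; apply: np; have := cp i; rewrite E.
have : y ord0 i < 0 \/ 1 < y ord0 i.
  by move/negP: ni; rewrite negb_and -!ltNge => /orP.
case=> h.
  apply: (sub _ (relopen_lt ci (cts_on_cst (0 : R)))) => //.
  by move=> p /= np cp; have := cp i; rewrite E leNgt np.
apply: (sub _ (relopen_lt (cts_on_cst (1 : R)) ci)) => //.
by move=> p /= np cp; have := cp i; rewrite E => /andP[_]; rewrite leNgt np.
Qed.

Variables (X : topologicalType) (k : nat).
Hypothesis Xk : k_connected R X k.

(** The boundary of the prism over a face is a sphere of the dimension of the
    face, which is why connectivity in degree [k] is enough for faces of
    dimension [k]. *)
Lemma face_fill c (f : 'rV[R]_N * R -> X) :
  (face_dim c <= k)%N ->
  cts_on [set p : ('rV[R]_N * R)%type | [/\ face_body c p.1, 0 <= p.2 <= 1 &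
    [\/ face_carrier p.1 <> c, p.2 = 0 | p.2 = 1]]] f ->
  exists2 F : 'rV[R]_N * R -> X,
    cts_on [set p : ('rV[R]_N * R)%type | face_body c p.1 /\ 0 <= p.2 <= 1] F &
    forall y t, face_body c y -> 0 <= t <= 1 ->
      [\/ face_carrier y <> c, t = 0 | t = 1] -> F (y, t) = f (y, t).
Proof.
rewrite /face_dim; set fr := [pred i | c i == None]; set r := #|fr| => rk cf.
pose e (j : 'I_r) : 'I_N := enum_val j.
have ce j : c (e j) = None by have := enum_valP j; rewrite inE => /eqP.
have ej i : c i = None -> exists j, e j = i.
  move=> ci; have fi : i \in fr by rewrite inE ci.
  by exists (enum_rank_in fi i); rewrite /e enum_rankK_in.
pose a (u : 'rV[R]_r * R) : 'rV[R]_N * R :=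
  (\row_i ((c i == Some true)%:R +
           \sum_(j < r) (e j == i)%:R * ((u.1 ord0 j + 1) / 2)), (u.2 + 1) / 2).
pose b (p : 'rV[R]_N * R) : 'rV[R]_r * R :=
  (\row_j (2 * p.1 ord0 (e j) - 1), 2 * p.2 - 1).
have aE u j : (a u).1 ord0 (e j) = (u.1 ord0 j + 1) / 2.
  rewrite !mxE ce add0r (bigD1 j)//= eqxx mul1r big1 ?addr0// => j' jj'.
  case: eqP => [/enum_val_inj E|_]; last by rewrite mul0r.
  by rewrite E eqxx in jj'.
have aS u i d : c i = Some d -> (a u).1 ord0 i = d%:R.
  move=> ci; rewrite !mxE ci big1 ?addr0; first by case: d {ci}.
  by move=> j _; case: eqP => [E|_]; [move: (ce j); rewrite E ci|rewrite mul0r].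
have ca A : cts_on A a.
  rewrite /a; apply: cts_on_pair; last by cts.
  by apply: cts_on_rowmx => i; cts.
have cb A : cts_on A b.
  rewrite /b; apply: cts_on_pair; last by cts.
  by apply: cts_on_rowmx => i; cts.
have aball u : box_ball u -> face_body c (a u).1 /\ 0 <= (a u).2 <= 1.
  rewrite /box_ball /boxnorm /= ge_max => /andP[u1 u2]; split; last first.
    by move: u2; rewrite ler_norml; lra.
  move=> i; case E : (c i) => [d|]; first exact: aS.
  have [j ji] := ej i E; rewrite -ji aE.
  have : `|u.1 ord0 j| <= 1.
    apply: le_trans u1; rewrite {2}/Num.norm /= mx_normrE.
    exact: (le_bigmax _ (fun ij => `|u.1 ij.1 ij.2|) (ord0, j)).
  by rewrite ler_norml; lra.
have bball y t : face_body c y -> 0 <= t <= 1 -> box_ball (b (y, t)).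
  move=> cy t01; rewrite /box_ball /boxnorm /= ge_max; apply/andP; split.
    rewrite /Num.norm /= mx_normrE; apply: bigmax_le => // -[x j] _ /=.
    by rewrite !mxE ler_norml; have := cy (e j); rewrite ce; lra.
  by rewrite ler_norml; lra.
have ab y t : face_body c y -> a (b (y, t)) = (y, t).
  move=> cy; rewrite [LHS]surjective_pairing; congr (_, _).
    apply/rowP => i; case E : (c i) => [d|].
      by rewrite (aS _ _ _ E); have := cy i; rewrite E => ->.
    by have [j ji] := ej i E; rewrite -ji aE /= mxE; field.
  by rewrite /=; field.
have [F' cF' F'f] : exists2 F' : 'rV[R]_r * R -> X, cts_on box_ball F' &
    forall u, box_sphere u -> F' u = f (a u).
  apply: (sphere_fill Xk rk).
  apply: cts_on_comp (ca _) cf _ => u Su.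
  have bu : box_ball u by rewrite /box_ball /= (Su : boxnorm u = 1).
  have [ay at_] := aball u bu; split=> //.
  move: Su; rewrite /box_sphere /boxnorm /=; rewrite maxEle; case: ifP => _ E.
    by case: (ger0P u.2) E => _ E; [constructor 3|constructor 2]; lra.
  constructor 1 => Ec.
  have [|[x j] /= Ej] := @mx_norm_neq0 _ _ _ u.1.
    by rewrite (E : mx_norm u.1 = 1) oner_neq0.
  have {}Ej : `|u.1 ord0 j| = 1 by rewrite -[RHS](E : mx_norm u.1 = 1) Ej (ord1 x).
  have := ce j; rewrite -{1}Ec ffunE aE.
  case: (ger0P (u.1 ord0 j)) Ej => _ Ej.
    have -> : (u.1 ord0 j + 1) / 2 = 1 by lra.
    by rewrite oner_eq0 eqxx.
  have -> : (u.1 ord0 j + 1) / 2 = 0 by lra.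
  by rewrite eqxx.
exists (fun p => F' (b p)).
  apply: (cts_on_comp (f := b) _ cF') => //.
  by move=> -[y t] [cy t01]; exact: bball.
move=> y t cy t01 bt; rewrite F'f ?ab//.
have := bball y t cy t01; rewrite /box_ball /= => b1.
apply/le_anti/andP; split=> //; rewrite /boxnorm /= le_max.
case: bt => [ne|->|->]; last 2 first.
- by rewrite mulr0 sub0r normrN1 lexx orbT.
- by rewrite mulr1 addrK normr1 lexx orbT.
have [i ci] : exists i, face_carrier y i != c i.
  apply/existsP; rewrite -negb_forall; apply/negP => /forallP E.
  by apply: ne; apply/ffunP => i; apply/eqP.
have [ci0|[d cid]] : c i = None \/ exists d, c i = Some d.
- by case: (c i) => [d|]; [right; exists d|left].
- have [j ji] := ej i ci0.
  apply/orP; left; rewrite {1}/Num.norm /= mx_normrE.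
  apply: le_trans (le_bigmax _ (fun ij : 'I_1 * 'I_r =>
    `|(\row_j (2 * y ord0 (e j) - 1)) ij.1 ij.2|) (ord0, j)).
  rewrite mxE -/(e j) ji; move: ci; rewrite ci0 ffunE.
  case: (y ord0 i =P 0) => [->|_]; first by rewrite mulr0 sub0r normrN1.
  by case: (y ord0 i =P 1) => [->|//]; rewrite mulr1 addrK normr1.
- move: ci; rewrite cid ffunE; have := cy i; rewrite cid => ->.
  by case: d {cid}; rewrite ?eqxx ?oner_eq0.
Qed.

Definition prism c : set ('rV[R]_N * R)%type := cyl (face_body c).

Definition cplx_prism (cplx : cell -> Prop) : set ('rV[R]_N * R)%type :=
  cyl [set y | exists2 c, cplx c & face_body c y].

Lemma cts_on_face_union (cplx : cell -> Prop) (f : 'rV[R]_N * R -> X) :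
  (forall c, cplx c -> cts_on (prism c) f) ->
  cts_on (cplx_prism cplx) f.
Proof.
move=> cf; set S := (X in cts_on X _).
apply: (@cts_on_finite_paste _ _ _ S (fun c => [set p | cplx c /\ face_body c p.1])).
- by move=> p [[c cc cp] _]; exists c.
- move=> c; have [cc|ncc] := pselect (cplx c).
    have -> : [set p : 'rV[R]_N * R | cplx c /\ face_body c p.1] =
              [set p | face_body c p.1].
      by apply/seteqP; split => p /=; [case|].
    exact: relopen_face_setC.
  by apply: relopen_total => p _ [].
- move=> c p Sp; have cc : cplx c by case: Sp => _ [].
  have sub : S `&` [set p | cplx c /\ face_body c p.1] `<=` prism c.
    by move=> q [[_ q01] [_ qc]].
  exact: (cts_on_sub sub (cf c cc)).
Qed.

Variables (cplx good : cell -> Prop) (z : 'rV[R]_N -> X)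
  (f0 : 'rV[R]_N * R -> X).
Hypothesis cplx_face : forall c c', cplx c -> is_face c' c -> cplx c'.
Hypothesis good_face : forall c c', good c -> is_face c' c -> good c'.
Hypothesis cplx_dim : forall c, cplx c -> (face_dim c <= k)%N.
Hypothesis cts_z : forall c, cplx c -> cts_on (face_body c) z.
Hypothesis cts_f0 : forall c, cplx c -> good c -> cts_on (prism c) f0.
Hypothesis loop_f0 : forall c y, cplx c -> good c -> face_body c y ->
  f0 (y, 0) = z y /\ f0 (y, 1) = z y.

Let ok c (f : 'rV[R]_N -> R -> X) : Prop := cplx c ->
  [/\ cts_on (prism c) (fun p => f p.1 p.2),
      forall y, face_body c y -> f y 0 = z y /\ f y 1 = z y &
      good c -> forall y t, face_body c y -> 0 <= t <= 1 -> f y t = f0 (y, t)].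

Let ok_local c f g : (forall y, face_body c y -> f y = g y) -> ok c f -> ok c g.
Proof.
move=> fg okf cc; have [cf lf ff] := okf cc; split.
- by apply: (cts_on_eq _ cf) => p [cp _]; rewrite fg.
- by move=> y cy; rewrite -fg//; exact: lf.
- by move=> gc y t cy t01; rewrite -fg//; exact: ff.
Qed.

(* On the boundary of the face the values of [f] are kept for all parameters,
   also those outside the unit interval, so that both maps agree there as
   functions of the parameter. *)
Let ok_of c f (F : 'rV[R]_N * R -> X) : cplx c ->
  (forall c', (face_dim c' < face_dim c)%N -> ok c' f) ->
  cts_on (prism c) F ->
  (forall y t, face_body c y -> 0 <= t <= 1 -> face_carrier y <> c ->
     F (y, t) = f y t) ->
  (forall y, face_body c y -> F (y, 0) = z y /\ F (y, 1) = z y) ->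
  (good c -> forall y t, face_body c y -> 0 <= t <= 1 -> F (y, t) = f0 (y, t)) ->
  exists2 g, ok c g &
    forall y, face_body c y -> face_carrier y <> c -> g y = f y.
Proof.
move=> cc okf cF Ff lF Fgood.
exists (fun y t => if face_carrier y == c then F (y, t) else f y t).
  have E y t : face_body c y -> 0 <= t <= 1 ->
      F (y, t) = if face_carrier y == c then F (y, t) else f y t.
    by move=> cy t01; case: eqP => // ne; exact: Ff.
  move=> _; split.
  - by apply: (cts_on_eq _ cF) => -[y t] [cy t01]; exact: E.
  - by move=> y cy; rewrite -!E//; rewrite ?lexx ?ler01//; exact: lF.
  - by move=> gc y t cy t01; rewrite -E//; exact: Fgood.
by move=> y cy /eqP/negPf ->.
Qed.

(** Loops are found one skeleton at a time: over a face the loops on its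
    boundary, together with the base points [z] at both ends of the parameter
    interval, form a map on the boundary of a prism, to which [face_fill]
    applies. *)
Lemma extend_loops_over_faces : exists f : 'rV[R]_N * R -> X,
  [/\ cts_on (cplx_prism cplx) f,
      forall c y, cplx c -> face_body c y -> f (y, 0) = z y /\ f (y, 1) = z y &
      forall c y t, cplx c -> good c -> face_body c y -> 0 <= t <= 1 ->
        f (y, t) = f0 (y, t)].
Proof.
suff ext c f : (forall c', (face_dim c' < face_dim c)%N -> ok c' f) ->
    exists2 g, ok c g & forall y, face_body c y -> face_carrier y <> c -> g y = f y.
  have [f okf] := skeleton_extension face_carrier_dim ok_local ext
    (fun y t => f0 (y, t)) N.+1.
  have {}okf c : ok c f.
    by apply: okf; rewrite ltnS -[leqRHS](card_ord N); exact: max_card.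
  exists (fun p => f p.1 p.2); split.
  - by apply: cts_on_face_union => c /okf[].
  - by move=> c y /okf[_ + _] cy; apply.
  - by move=> c y t /okf[_ _ +] gc cy t01; apply.
move=> okf; have [cc|ncc] := pselect (cplx c); last by exists f.
have face_ok y : face_body c y -> face_carrier y <> c ->
    [/\ cplx (face_carrier y), ok (face_carrier y) f & face_body (face_carrier y) y].
  move=> cy ne; split; last exact: face_carrier_body cy.
    exact: cplx_face cc (face_carrierP cy).
  by apply: okf; have [] := face_carrier_dim cy.
have [gc|ngc] := pselect (good c).
  apply: (@ok_of c f f0) => //.
  - exact: cts_f0.
  - move=> y t cy t01 ne; have [cc' okc' cy'] := face_ok y cy ne.
    have [_ _ ->] := okc' cc' => //.
    exact: good_face gc (face_carrierP cy).
  - by move=> y cy; exact: loop_f0 cc gc cy.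
pose h (p : 'rV[R]_N * R) := if face_carrier p.1 == c then z p.1 else f p.1 p.2.
have hends y t : face_body c y -> t = 0 \/ t = 1 -> h (y, t) = z y.
  rewrite /h /= => cy t01; case: eqP => // ne.
  have [cc' okc' cy'] := face_ok y cy ne.
  have [_ /(_ y cy')[l0 l1] _] := okc' cc'.
  by case: t01 => ->.
have ch : cts_on [set p : ('rV[R]_N * R)%type | [/\ face_body c p.1, 0 <= p.2 <= 1 &
    [\/ face_carrier p.1 <> c, p.2 = 0 | p.2 = 1]]] h.
  set S := (X in cts_on X _).
  pose A (o : option ('I_N * bool)) : set ('rV[R]_N * R) :=
    if o is Some (i, b) then [set p : ('rV[R]_N * R)%type | c i = None /\ p.1 ord0 i = b%:R]
    else [set p : ('rV[R]_N * R)%type | p.2 = 0] `|` [set p | p.2 = 1].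
  have c2 : cts_on S (fun p => p.2) by cts.
  apply: (@cts_on_finite_paste _ _ _ S A).
  - move=> [y t] [/= cy t01 [ne|t0|t1]]; last 2 first.
    + by exists None; left.
    + by exists None; right.
    have [i ci] : exists i, face_carrier y i != c i.
      apply/existsP; rewrite -negb_forall; apply/negP => /forallP E.
      by apply: ne; apply/ffunP => i; apply/eqP.
    have ci0 : c i = None.
      case E : (c i) ci => [b|//].
      by rewrite (face_carrierP cy E) eqxx.
    move: ci; rewrite ci0 ffunE.
    case: (y ord0 i =P 0) => [y0|_]; first by exists (Some (i, false)).
    by case: (y ord0 i =P 1) => [y1|//]; exists (Some (i, true)).
  - move=> [[i b]|]; last first.
      rewrite /A setCU; apply: relopenI; apply: relopen_eq_setC => //;
      exact: cts_on_cst.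
    have [ci|nci] := pselect (c i = None); last first.
      by apply: relopen_total => p _ [].
    have -> : A (Some (i, b)) = [set p : ('rV[R]_N * R)%type | p.1 ord0 i = b%:R].
      by apply/seteqP; split => p /=; [case|].
    by apply: relopen_eq_setC; [cts|exact: cts_on_cst].
  - move=> [[i b]|]; last first.
      have cz : cts_on (S `&` A None) (fun p => z p.1).
        by apply: (cts_on_comp _ (cts_z cc)); [cts|move=> p [[]]].
      by apply: (cts_on_eq _ cz) => -[y t] [[cy _ _] t01]; rewrite hends.
    have [ci|nci] := pselect (c i = None); last by move=> p [_ []].
    pose c' : cell := [ffun j => if j == i then Some b else c j].
    have fc : is_face c' c.
      by move=> j d cj; rewrite ffunE; case: eqP => // ji; rewrite ji ci in cj.
    have c'ne : c' <> c by move=> E; have := ci; rewrite -E ffunE eqxx.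
    have [cf _ _] := okf c' (is_face_dim fc c'ne) (cplx_face cc fc).
    have sub : S `&` A (Some (i, b)) `<=` prism c'.
      move=> [y t] [[/= cy t01 _] [_ yi]]; split => //= j.
      rewrite ffunE; case: eqP => [->//|_]; exact: cy.
    apply: (cts_on_eq _ (cts_on_sub sub cf)) => -[y t] [_ [_ /= yi]].
    rewrite /h; case: eqP => // E; exfalso.
    have := ci; rewrite -E ffunE /= yi.
    by case: (b); rewrite ?eqxx ?oner_eq0.
have [F cF Fh] := face_fill (cplx_dim cc) ch.
apply: (@ok_of c f F) => //.
- move=> y t cy t01 ne; rewrite Fh//; last by constructor 1.
  by rewrite /h /=; case: eqP.
- move=> y cy; split; rewrite Fh ?lexx ?ler01//.
  + by apply: hends => //; left.
  + by constructor 2.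
  + by apply: hends => //; right.
  + by constructor 3.
Qed.

End cube_faces.

(** * Loops over the nerve of a coloured cover *)

Definition convex_set (R : realType) (m : nat) (Q : set 'rV[R]_m) : Prop :=
  forall x y t, Q x -> Q y -> 0 <= t <= 1 -> Q (t *: x + (1 - t) *: y).

Lemma convex_set_combination (R : realType) (m : nat) (Q : set 'rV[R]_m)
    (I : Type) (r : seq I) (w : I -> R) (q : I -> 'rV[R]_m) (a : R) x :
  convex_set Q -> 0 <= a -> (0 < a -> Q x) ->
  (forall i, 0 <= w i) -> (forall i, 0 < w i -> Q (q i)) ->
  0 < a + \sum_(i <- r) w i ->
  Q ((a + \sum_(i <- r) w i)^-1 *: (a *: x + \sum_(i <- r) w i *: q i)).
Proof.
move=> cQ + + w0 wQ; elim: r a x => [|i r IH] a x a0 aQ.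
  rewrite !big_nil !addr0 => a1.
  by rewrite scalerA mulVf ?gt_eqF// scale1r; exact: aQ.
rewrite !big_cons !addrA => s0.
have [ai0|] := ltP 0 (a + w i); last first.
  move=> ai; have aE : a = 0 by have := w0 i; lra.
  have wE : w i = 0 by have := w0 i; lra.
  have := IH a x a0 aQ; rewrite wE addr0 scale0r addr0; apply.
  by move: s0; rewrite wE addr0.
have := IH (a + w i) ((a + w i)^-1 *: (a *: x + w i *: q i)).
rewrite scalerA divff ?gt_eqF// scale1r; apply => //; first exact: ltW.
move=> _; have [a1|a1] := ltP 0 a; last first.
  have aE : a = 0 by lra.
  have wi0 : 0 < w i by move: ai0; rewrite aE add0r.
  by rewrite aE add0r scale0r add0r scalerA mulVf ?gt_eqF// scale1r; exact: wQ.
have [w1|w1] := ltP 0 (w i); last first.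
  have wE : w i = 0 by have := w0 i; lra.
  by rewrite wE addr0 scale0r addr0 scalerA mulVf ?gt_eqF// scale1r; exact: aQ.
have -> : (a + w i)^-1 *: (a *: x + w i *: q i) =
    (a / (a + w i)) *: x + (1 - a / (a + w i)) *: q i.
  rewrite scalerDr !scalerA mulrC; congr (_ + _ *: _).
  by field; rewrite gt_eqF.
apply: cQ; [exact: aQ|exact: wQ|].
apply/andP; split; first by apply: divr_ge0 => //; exact: ltW.
by rewrite ler_pdivrMr// mul1r lerDl ltW.
Qed.

Section nerve.
Context {R : realType} (X : topologicalType) (k m N : nat).
Hypothesis Xk : k_connected R X k.
Variables (Q D : set 'rV[R]_m) (xi : 'rV[R]_m -> X) (l : 'rV[R]_m * R -> X).
Hypothesis cvxQ : convex_set Q.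
Hypothesis cts_xi : cts_on Q xi.
Hypothesis cts_l : cts_on (cyl (Q `&` D)) l.
Hypothesis loop_l : forall p, Q p -> D p -> l (p, 0) = xi p /\ l (p, 1) = xi p.

Variables (al : 'rV[R]_m -> R) (be : 'I_N -> 'rV[R]_m -> R).
Variables (q : 'I_N -> 'rV[R]_m) (col : 'I_N -> 'I_k.+1).
Hypothesis cts_al : cts_on Q al.
Hypothesis cts_be : forall i, cts_on Q (be i).
Hypothesis al_ge0 : forall p, 0 <= al p.
Hypothesis be_ge0 : forall i p, 0 <= be i p.
Hypothesis q_in : forall i p, Q p -> 0 < be i p -> Q (q i).
Hypothesis col_inj : forall i j p, Q p -> 0 < be i p -> 0 < be j p ->
  col i = col j -> i = j.

Let avg (a : R) (x : 'rV[R]_m) (w : 'I_N -> R) : 'rV[R]_m :=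
  (a + \sum_i w i)^-1 *: (a *: x + \sum_i w i *: q i).

Hypothesis avoid : forall p, Q p -> 0 < al p ->
  forall a w, 0 <= a -> (forall i, 0 <= w i) ->
    (forall i, 0 < w i -> 0 < be i p) -> 0 < a + \sum_i w i ->
    D (avg a p w).

Local Notation cell := {ffun 'I_N -> option bool}.
Implicit Types (c : cell) (y : 'rV[R]_N).

(* The nerve is realized in the unit cube by weights of which at least one is
   equal to 1: its faces pin some weight to 1 and give weight 0 to all but
   differently coloured tiles. Over good faces the given loops are available at
   all averages. *)
Let psi (y : 'rV[R]_N) : 'rV[R]_m := avg 0 0 (fun i => y ord0 i).

Let cplx (c : cell) : Prop :=
  [/\ exists i, c i = Some true,
      forall i j, c i <> Some false -> c j <> Some false -> col i = col j -> i = j &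
      forall i, c i <> Some false -> Q (q i)].

Let good (c : cell) : Prop := forall y, face_body c y -> D (psi y).

Let cplx_face c c' : cplx c -> is_face c' c -> cplx c'.
Proof.
move=> [[i ci] cinj cQ] fc.
have sup j : c' j <> Some false -> c j <> Some false.
  by move=> c'j cj; apply: c'j; exact: fc.
split; first by exists i; exact: fc.
- by move=> a b /sup ca /sup cb; exact: cinj.
- by move=> a /sup; exact: cQ.
Qed.

Let good_face c c' : good c -> is_face c' c -> good c'.
Proof. by move=> gc fc y cy; apply: gc; exact: is_face_body fc cy. Qed.

Let card_coloured (P : pred 'I_N) :
  (forall i j, P i -> P j -> col i = col j -> i = j) -> (#|P| <= k.+1)%N.
Proof.
move=> inj; have /card_in_image <- : {in P &, injective col}.
  by move=> i j Pi Pj; exact: inj.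
by rewrite -[leqRHS](card_ord k.+1); exact: max_card.
Qed.

Let cplx_dim (c : cell) : cplx c -> (face_dim c <= k)%N.
Proof.
move=> [[i ci] cinj _].
have := @card_coloured [pred j : 'I_N | c j != Some false].
rewrite (cardD1 i) inE ci /= add1n ltnS => H.
have /H : forall j j', c j != Some false -> c j' != Some false ->
    col j = col j' -> j = j'.
  by move=> j j' /eqP cj /eqP cj'; exact: cinj.
apply: leq_trans; apply/subset_leq_card/fintype.subsetP => j.
rewrite !inE => /eqP cj; rewrite cj andbT.
by apply/eqP => E; rewrite E ci in cj.
Qed.

Let body_ge0 c y i : face_body c y -> 0 <= y ord0 i.
Proof.
by move=> /(_ i); case: (c i) => [b ->|/andP[]]//; rewrite ler0n.
Qed.

Let body_sum c y : cplx c -> face_body c y -> 0 < 0 + \sum_i y ord0 i.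
Proof.
move=> [[i ci] _ _] cy; rewrite add0r (bigD1 i)//=.
have := cy i; rewrite ci => ->; apply: ltr_wpDr; last exact: ltr01.
by apply: sumr_ge0 => j _; exact: body_ge0 cy.
Qed.

Let psi_in c y : cplx c -> face_body c y -> Q (psi y).
Proof.
move=> cc cy; apply: convex_set_combination => //.
- by rewrite ltxx.
- by move=> i; exact: body_ge0 cy.
- move=> i yi; have [_ _] := cc; apply => ci.
  by have := cy i; rewrite ci => E; rewrite E ltxx in yi.
- exact: body_sum cc cy.
Qed.

Let cts_avg (T : topologicalType) (A : set T) (a : T -> R) (x : T -> 'rV[R]_m)
    (w : 'I_N -> T -> R) :
  cts_on A a -> cts_on A x -> (forall i, cts_on A (w i)) ->
  (forall v, A v -> 0 < a v + \sum_i w i v) ->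
  cts_on A (fun v => avg (a v) (x v) (fun i => w i v)).
Proof.
move=> ca cx cw w0; rewrite /avg.
have cs : cts_on A (fun v => \sum_i w i v) by exact: cts_on_sum.
have csv : cts_on A (fun v => \sum_i w i v *: q i).
  by apply: cts_on_sumv => i; have := cw i => ?; cts.
have cV : cts_on A (fun v => (a v + \sum_i w i v)^-1).
  by apply: cts_onV; [cts|move=> v /w0 H; rewrite gt_eqF].
by cts.
Qed.

Let cts_psi c : cplx c -> cts_on (face_body c) psi.
Proof.
move=> cc; apply: (cts_avg (a := fun=> 0) (x := fun=> 0)).
- exact: cts_on_cst.
- exact: cts_on_cst.
- by move=> i; cts.
- by move=> y cy; exact: body_sum cc cy.
Qed.

Let psiZ (c : R) y : c != 0 -> psi (c *: y) = psi y.
Proof.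
move=> c0; rewrite /psi /avg !add0r !scale0r !add0r.
under eq_bigr do rewrite mxE.
under [in X in _ *: X]eq_bigr do rewrite mxE -scalerA.
by rewrite -mulr_sumr -scaler_sumr invfM scalerA mulrAC mulVf// mul1r.
Qed.

Let be_sum p : R := \sum_i be i p.
(* Weights are truncated at their sum: the factor [k.+1] ensures that some of
   them reaches it, without a maximum having to be taken. *)
Let bw i p : R := Num.min (be_sum p) (k.+1%:R * be i p).
Let coord p : 'rV[R]_N := \row_i ((be_sum p)^-1 * bw i p).
Let pull p : 'rV[R]_m := avg (al p) p (fun i => bw i p).

Definition nerve_support : set 'rV[R]_m :=
  [set p | 0 < al p \/ exists i, 0 < be i p].

Let be_sum_ge0 p : 0 <= be_sum p.
Proof. by apply: sumr_ge0 => i _. Qed.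

Let be_sum_gt0 p i : 0 < be i p -> 0 < be_sum p.
Proof.
move=> bi; rewrite /be_sum (bigD1 i)//=; apply: ltr_wpDr => //.
exact: sumr_ge0.
Qed.

Let be_sum_ex p : 0 < be_sum p -> exists i, 0 < be i p.
Proof.
move=> s0; apply: contrapT => /forallNP H; move: s0.
rewrite /be_sum big1 ?ltxx// => i _; apply/le_anti; rewrite be_ge0 andbT.
by have /negP := H i; rewrite -leNgt.
Qed.

Let bw_ge0 i p : 0 <= bw i p.
Proof. by rewrite /bw le_min be_sum_ge0 mulr_ge0. Qed.

Let bw_gt0 i p : (0 < bw i p) = (0 < be i p).
Proof.
rewrite /bw lt_min pmulr_rgt0// andb_idl// => bi; exact: be_sum_gt0 bi.
Qed.

Let coord_gt0 i p : 0 < be_sum p -> (0 < coord p ord0 i) = (0 < be i p).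
Proof. by move=> s0; rewrite mxE pmulr_rgt0 ?invr_gt0// bw_gt0. Qed.

Let coord_body p : 0 < be_sum p -> face_body (face_carrier (coord p)) (coord p).
Proof.
move=> s0; apply: (@face_carrier_body _ _ [ffun=> None]) => i; rewrite ffunE mxE.
apply/andP; split; first by rewrite mulr_ge0// invr_ge0.
by rewrite mulrC ler_pdivrMr// mul1r /bw ge_min lexx.
Qed.

Let coord_carrier p i : 0 < be_sum p -> face_carrier (coord p) i <> Some false ->
  0 < be i p.
Proof.
move=> s0; rewrite ffunE; case: eqP => // ne _.
rewrite -coord_gt0// lt_neqAle eq_sym; apply/andP; split; first exact/eqP.
by rewrite mxE mulr_ge0// invr_ge0.
Qed.

(* At most [k.+1] weights are positive, so the largest of them is at least
   the average and is normalized to 1. *)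
Let coord_one p : Q p -> 0 < be_sum p -> exists i, coord p ord0 i = 1.
Proof.
move=> Qp s0; have [i [bi si]] : exists i, 0 < be i p /\ be_sum p <= k.+1%:R * be i p.
  apply: contrapT => /forallNP H.
  have {}H i : 0 < be i p -> k.+1%:R * be i p < be_sum p.
    by move=> bi; rewrite ltNge; apply/negP => si; apply: (H i).
  have [i0 bi0] := be_sum_ex s0.
  have : k.+1%:R * be_sum p < k.+1%:R * be_sum p; last by rewrite ltxx.
  have {1}-> : be_sum p = \sum_(i | 0 < be i p) be i p.
    rewrite /be_sum [LHS](bigID (fun i => 0 < be i p))/= [X in _ + X]big1 ?addr0//.
    by move=> i /negPf; rewrite lt0r be_ge0 andbT => /negbT; rewrite negbK => /eqP.
  rewrite mulr_sumr.
  apply: (@lt_le_trans _ _ (\sum_(i | 0 < be i p) be_sum p)).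
    by apply: ltr_sum => //; apply/hasP; exists i0.
  rewrite sumr_const -[be_sum p *+ _]mulr_natl ler_pM2r// ler_nat.
  apply: card_coloured => i j bi bj; exact: col_inj Qp bi bj.
exists i; rewrite mxE /bw (min_idPl si) mulVf// gt_eqF//.
Qed.

Let coord_cplx p : Q p -> 0 < be_sum p -> cplx (face_carrier (coord p)).
Proof.
move=> Qp s0; split.
- have [i ci] := coord_one Qp s0; exists i.
  by rewrite ffunE ci oner_eq0 eqxx.
- move=> i j /(coord_carrier s0) bi /(coord_carrier s0) bj.
  exact: col_inj Qp bi bj.
- by move=> i /(coord_carrier s0); exact: q_in.
Qed.

(* The points at which the face of the nerve is good and the given loops can be
   taken; unlike the condition [0 < al p], this one is closed. *)
Let hull_good p : Prop := forall w, (forall i, 0 <= w i) ->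
  (forall i, 0 < w i -> 0 < be i p) -> 0 < 0 + \sum_i w i -> D (avg 0 0 w).

Let hull_good_carrier p : Q p -> 0 < be_sum p -> hull_good p ->
  good (face_carrier (coord p)).
Proof.
move=> Qp s0 gp y cy; apply: gp.
- by move=> i; exact: body_ge0 cy.
- move=> i yi; apply: coord_carrier => // ci.
  by have := cy i; rewrite ci => E; rewrite E ltxx in yi.
- exact: body_sum (coord_cplx Qp s0) cy.
Qed.

Let avg0 x x' w : avg 0 x w = avg 0 x' w.
Proof. by rewrite /avg !scale0r. Qed.

Let hull_good_al p : Q p -> 0 < al p -> hull_good p.
Proof.
by move=> Qp ap w w0 wb ws; rewrite (avg0 _ p); exact: avoid.
Qed.

Let pull_coord p : al p = 0 -> 0 < be_sum p -> pull p = psi (coord p).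
Proof.
move=> ap s0; rewrite /pull ap (avg0 _ 0).
have -> : coord p = (be_sum p)^-1 *: (\row_i bw i p).
  by apply/rowP => i; rewrite !mxE.
rewrite psiZ; last by rewrite invr_eq0 gt_eqF.
by rewrite /psi /avg; congr (_^-1 *: _); congr (_ + _); apply: eq_bigr => i _;
   rewrite mxE.
Qed.

Let sup_sum p : nerve_support p -> 0 < al p + \sum_i bw i p.
Proof.
have b0 : 0 <= \sum_i bw i p by exact: sumr_ge0.
move=> [ap|[i bi]]; first exact: ltr_wpDr.
apply: ltr_wpDl => //; rewrite (bigD1 i)//=; apply: ltr_wpDr.
  exact: sumr_ge0.
by rewrite bw_gt0.
Qed.

Let pull_in p : Q p -> nerve_support p -> Q (pull p).
Proof.
move=> Qp sp; apply: convex_set_combination => //; last exact: sup_sum.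
by move=> i; rewrite bw_gt0; exact: q_in.
Qed.

Let sup_al0 p : nerve_support p -> al p = 0 -> 0 < be_sum p.
Proof. by move=> [+ ap|[i bi] _]; [rewrite ap ltxx|exact: be_sum_gt0 bi]. Qed.

Let pull_good p : Q p -> nerve_support p -> hull_good p -> D (pull p).
Proof.
move=> Qp sp gp; have [ap|] := ltP 0 (al p).
  by apply: avoid => //; [move=> i; rewrite bw_gt0|exact: sup_sum].
move=> ap; have {}ap : al p = 0 by apply/le_anti; rewrite ap al_ge0.
have s0 := sup_al0 sp ap; rewrite pull_coord//.
exact: (hull_good_carrier Qp s0 gp (coord_body s0)).
Qed.

Let cts_be_sum A : A `<=` Q -> cts_on A be_sum.
Proof.
by move=> AQ; apply: cts_on_sum => i; exact: (cts_on_sub AQ (@cts_be i)).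
Qed.

Let cts_bw A i : A `<=` Q -> cts_on A (bw i).
Proof.
move=> AQ; have cs := cts_be_sum AQ; have cb := cts_on_sub AQ (@cts_be i).
by rewrite /bw; cts.
Qed.

Let cts_coord A : A `<=` Q -> (forall p, A p -> 0 < be_sum p) -> cts_on A coord.
Proof.
move=> AQ s0; apply: cts_on_rowmx => i; apply: cts_onM; last exact: cts_bw.
by apply: cts_onV; [exact: cts_be_sum|move=> p /s0 H; rewrite gt_eqF].
Qed.

Let cts_pull A : A `<=` Q `&` nerve_support -> cts_on A pull.
Proof.
move=> AQ; have AQ' : A `<=` Q by move=> p /AQ[].
apply: (@cts_avg _ A al id bw).
- exact: cts_on_sub AQ' cts_al.
- exact: cts_on_id.
- by move=> i; exact: cts_bw.
- by move=> p /AQ[_]; exact: sup_sum.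
Qed.

Let hull_good_closed S : S `<=` Q -> relopen S (~` hull_good).
Proof.
move=> SQ; apply: relopen_local => p Sp.
move=> /existsNP[w /not_implyP[w0 /not_implyP[wb /not_implyP[ws nD]]]].
exists [set p' | forall i, (0 < w i) ==> (0 < be i p')]; split.
- apply: (@relopen_forall _ _ S (fun i => [set p' | (0 < w i) ==> (0 < be i p')])) => i.
  have [wi|wi] := ltP 0 (w i); last exact: relopen_total.
  have cb := cts_on_sub SQ (@cts_be i).
  exact: (relopen_lt (cts_on_cst 0) cb).
- by move=> i; apply/implyP; exact: wb.
- by move=> p' _ H gp'; apply: nD; apply: gp' => // i; apply/implyP.
Qed.

(** As at most one tile of each colour contains a given point, the nerve has
    dimension at most [k], and loops spread over it from the good faces. A point
    [p] then borrows the loop of the average [pull p] of itself, with weight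
    [al p], and the centers of its tiles, conjugated by the segment from [p] to
    this average. Where all tile weights vanish the average is [p]. *)
Lemma nerve_loops : exists l' : 'rV[R]_m * R -> X,
  [/\ cts_on (cyl (Q `&` nerve_support)) l',
      forall p, Q p -> nerve_support p -> l' (p, 0) = xi p /\ l' (p, 1) = xi p &
      forall p t, Q p -> 0 < al p -> (forall i, be i p = 0) -> 0 <= t <= 1 ->
        l' (p, t) = l (p, clamp 0 1 (2 * t - 2^-1))].
Proof.
have cz c : cplx c -> cts_on (face_body c) (fun y => xi (psi y)).
  move=> cc; apply: (cts_on_comp (cts_psi cc) cts_xi) => y cy.
  exact: psi_in cc cy.
have cf0 c : cplx c -> good c -> cts_on (prism c) (fun p => l (psi p.1, p.2)).
  move=> cc gc; apply: (cts_on_comp (f := fun p => (psi p.1, p.2)) _ cts_l).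
    apply: cts_on_pair; last by cts.
    by apply: (cts_on_comp _ (cts_psi cc)); [cts|move=> p []].
  move=> [y t] [/= cy t01]; split => //=; split; [exact: psi_in cc cy|exact: gc].
have lf0 c y : cplx c -> good c -> face_body c y ->
    l (psi y, 0) = xi (psi y) /\ l (psi y, 1) = xi (psi y).
  by move=> cc gc cy; apply: loop_l; [exact: psi_in cc cy|exact: gc].
have [f [cf lf ff]] := extend_loops_over_faces Xk cplx_face good_face cplx_dim
  cz cf0 lf0.
set V := Q `&` nerve_support.
pose mid (p : 'rV[R]_m * R) : X :=
  if al p.1 == 0 then f (coord p.1, p.2) else l (pull p.1, p.2).
have mid_good p t : V p -> hull_good p -> 0 <= t <= 1 -> mid (p, t) = l (pull p, t).
  move=> [Qp sp] gp t01; rewrite /mid /=; case: eqP => // ap.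
  have s0 := sup_al0 sp ap; rewrite pull_coord//.
  apply: ff (coord_cplx Qp s0) _ (coord_body s0) t01.
  exact: hull_good_carrier.
have mid_ends p : V p -> mid (p, 0) = xi (pull p) /\ mid (p, 1) = xi (pull p).
  move=> [Qp sp]; have [ap|/eqP ap] := eqVneq (al p) 0.
    have s0 := sup_al0 sp ap; rewrite /mid /= ap eqxx pull_coord//.
    exact: lf (coord_cplx Qp s0) (coord_body s0).
  have ap0 : 0 < al p by rewrite lt_neqAle al_ge0 eq_sym andbT; apply/eqP.
  have gp := hull_good_al Qp ap0.
  rewrite !mid_good ?lexx ?ler01//; apply: loop_l; first exact: pull_in.
  exact: pull_good.
have VQ : V `<=` Q by move=> p [].
have cmid : cts_on (cyl V) mid.
  apply: (@cts_on_paste _ _ (cyl V) [set p | al p.1 = 0] [set p | hull_good p.1]).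
  - move=> [p t] [/= [Qp sp] _]; have [ap|/eqP ap] := eqVneq (al p) 0; first by left.
    by right; apply: hull_good_al => //; rewrite lt_neqAle al_ge0 eq_sym andbT; apply/eqP.
  - apply: relopen_eq_setC; last exact: cts_on_cst.
    by apply: (cts_on_comp _ cts_al); [cts|move=> p [[]]].
  - apply: (relopen_preimage (f := fst) (B := V)) (hull_good_closed VQ) => //.
      by cts.
    by move=> p [].
  - have s0 (p : 'rV[R]_m * R) : (cyl V `&` [set p | al p.1 = 0]) p ->
        0 < be_sum p.1.
      by move=> [[[_ sp] _] ap]; exact: sup_al0.
    apply: (cts_on_eq (f := fun p => f (coord p.1, p.2))).
      by move=> p [_ /= ap]; rewrite /mid ap eqxx.
    apply: (cts_on_comp (f := fun p => (coord p.1, p.2)) _ cf).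
      apply: cts_on_pair; last by cts.
      apply: (cts_on_comp _ (cts_coord (A := Q `&` [set p | 0 < be_sum p]) _ _)).
      + by cts.
      + by move=> p [].
      + by move=> p [].
      + by move=> p Sp; split; [case: Sp => [[/VQ]]|exact: s0].
    move=> [p t] Sp; have := s0 _ Sp; case: Sp => [[[Qp sp] t01] ap] s0'.
    split => //=; exists (face_carrier (coord p)).
      exact: coord_cplx.
    exact: coord_body.
  - apply: (cts_on_eq (f := fun p => l (pull p.1, p.2))).
      by move=> [p t] [[Vp t01] gp]; rewrite mid_good.
    apply: (cts_on_comp (f := fun p => (pull p.1, p.2)) _ cts_l).
      apply: cts_on_pair; last by cts.
      by apply: (cts_on_comp _ (cts_pull (A := V) _)) => //; [cts|move=> p [[]]].
    move=> [p t] [[[Qp sp] t01] gp]; split => //=; split; first exact: pull_in.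
    exact: pull_good.
pose walk (s : R) p := xi (p + s *: (pull p - p)).
have walk_in s p : V p -> 0 <= s <= 1 -> Q (p + s *: (pull p - p)).
  move=> [Qp sp] s01.
  have -> : p + s *: (pull p - p) = s *: pull p + (1 - s) *: p.
    by apply/rowP => i; rewrite !mxE; ring.
  by apply: cvxQ => //; exact: pull_in.
have cwalk (A : set ('rV[R]_m * R)) (s : 'rV[R]_m * R -> R) :
    A `<=` cyl V -> cts_on A s -> (forall p, A p -> 0 <= s p <= 1) ->
    cts_on A (fun p => walk (s p) p.1).
  move=> AV cs s01.
  apply: (cts_on_comp (f := fun p : 'rV[R]_m * R => p.1 + s p *: (pull p.1 - p.1)) _ cts_xi).
    have cp : cts_on A (fun p => pull p.1).
      apply: (cts_on_comp _ (cts_pull (A := V) _)) => //; first by cts.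
      by move=> p /AV[].
    by cts.
  by move=> p Ap; apply: walk_in; [have [] := AV p Ap|exact: s01].
exists (fun p => if p.2 <= 4^-1 then walk (4 * p.2) p.1 else
  if p.2 <= 3 / 4 then mid (p.1, 2 * p.2 - 2^-1) else walk (4 - 4 * p.2) p.1).
split.
- apply: cts_on_if.
  + by cts.
  + exact: cts_on_cst.
  + apply: cwalk; [by move=> p []|by cts|].
    by move=> p [[_ p01]] /= p4; lra.
  + apply: cts_on_if.
    * by cts.
    * exact: cts_on_cst.
    * apply: (cts_on_comp (f := fun p : 'rV[R]_m * R => (p.1, 2 * p.2 - 2^-1)) _ cmid).
        by cts.
      by move=> p [[[Vp p01] /= p4] /= p34]; split => //=; lra.
    * apply: cwalk; [by move=> p [[]]|by cts|].
      by move=> p [[[_ p01] _]] /= p4; lra.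
    * move=> p [[Vp p01] _] p34; rewrite p34.
      have -> : 2 * (3 / 4) - 2^-1 = 1 :> R by lra.
      have -> : 4 - 4 * (3 / 4) = 1 :> R by lra.
      by rewrite (mid_ends _ Vp).2 /walk scale1r addrCA subrr addr0.
  + move=> p [Vp p01] p4; rewrite p4.
    have -> : 4^-1 <= 3 / 4 :> R by lra.
    have -> : 2 * 4^-1 - 2^-1 = 0 :> R by lra.
    have -> : 4 * 4^-1 = 1 :> R by lra.
    by rewrite (mid_ends _ Vp).1 /walk scale1r addrCA subrr addr0.
- move=> p Qp sp /=.
  have -> : (0 <= 4^-1 :> R) by lra.
  have -> : (1 <= 4^-1 :> R) = false by lra.
  have -> : (1 <= 3 / 4 :> R) = false by lra.
  by rewrite /walk !(mulr0, mulr1) subrr !scale0r addr0.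
- move=> p t Qp ap b0 t01 /=.
  have bs : be_sum p = 0 by rewrite /be_sum big1.
  have bw0 i : bw i p = 0 by rewrite /bw bs b0 mulr0 minxx.
  have sp : nerve_support p by left.
  have pE : pull p = p.
    rewrite /pull /avg (eq_bigr (fun=> 0)) => [|i _]; last exact: bw0.
    rewrite big1// addr0 [X in _ + X]big1 ?addr0; last first.
      by move=> i _; rewrite bw0 scale0r.
    by rewrite scalerA mulVf ?scale1r// gt_eqF.
  have Dp : D p by rewrite -pE; apply: pull_good => //; exact: hull_good_al.
  rewrite /walk pE subrr !scaler0 addr0.
  have [l0 l1] := loop_l Qp Dp.
  case: (leP t 4^-1) => t4; first by rewrite clamp_lo ?l0//; lra.
  case: (leP t (3 / 4)) => t34; last by rewrite clamp_hi ?l1//; lra.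
  rewrite clamp_id; last by lra.
  rewrite mid_good ?pE//; first exact: hull_good_al.
  by lra.
Qed.

End nerve.

(** * Extending loops from the rim of a convex set *)

Lemma lipschitz_cts_on (R : realType) (V : normedModType R) (A : set V) (f : V -> R) (C : R) :
  0 < C -> (forall x y : V, f x <= f y + C * `|x - y|) -> cts_on A f.
Proof.
move=> C0 fl; apply: continuous_cts_on => x; apply/cvgrPdist_lt => e e0.
apply/nbhs_normP; exists (e / C); first exact: divr_gt0.
move=> y /=; rewrite ltr_pdivlMr// mulrC => xy.
rewrite ltr_norml; have := fl x y; have := fl y x; rewrite (distrC y x); lra.
Qed.

Section capped_distance.
Context {R : realType} (m : nat).
Implicit Types (B : set 'rV[R]_m) (x y : 'rV[R]_m).

(** The distance to [B] cut off at 1, so that it is positive rather than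
    undefined when [B] is empty. *)
Definition cdist B x : R := inf ([set `|x - z| | z in B] `|` [set 1]).

Let cdist_lb B x : lbound ([set `|x - z| | z in B] `|` [set 1]) 0.
Proof. by move=> _ [[z _ <-]|->]. Qed.

Let cdist_ex B x : ([set `|x - z| | z in B] `|` [set 1]) !=set0.
Proof. by exists 1; right. Qed.

Lemma cdist_ge0 B x : 0 <= cdist B x.
Proof. by apply: lb_le_inf; [exact: cdist_ex|exact: cdist_lb]. Qed.

Lemma cdist_le B x z : B z -> cdist B x <= `|x - z|.
Proof.
move=> Bz; apply: ge_inf; first by exists 0; exact: cdist_lb.
by left; exists z.
Qed.

Lemma cdist_self B x : B x -> cdist B x = 0.
Proof.
move=> Bx; apply/le_anti; rewrite cdist_ge0 andbT.
by apply: le_trans (cdist_le x Bx) _; rewrite subrr normr0.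
Qed.

Lemma cdist_lipschitz B x y : cdist B x <= cdist B y + `|x - y|.
Proof.
rewrite -lerBlDr; apply: lb_le_inf; first exact: cdist_ex.
move=> _ [[z Bz <-]|->]; rewrite lerBlDr.
  apply: le_trans (cdist_le x Bz) _.
  by have := ler_normD (y - z) (x - y); rewrite addrC subrKA.
apply: (@le_trans _ _ 1); last by rewrite lerDl.
by apply: ge_inf; [exists 0; exact: cdist_lb|right].
Qed.

Lemma cts_on_cdist A B : cts_on A (cdist B).
Proof.
apply: (@lipschitz_cts_on _ 'rV[R]_m _ _ 1) => // x y; rewrite mul1r.
exact: cdist_lipschitz.
Qed.

Lemma cdist_gt0 B x : (\forall y \near x, ~ B y) -> 0 < cdist B x.
Proof.
move=> /nbhs_normP[e /= e0 eB].
apply: (@lt_le_trans _ _ (Num.min e 1)); first by rewrite lt_min e0 ltr01.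
apply: lb_le_inf; first exact: cdist_ex.
move=> _ [[z Bz <-]|->]; last by rewrite ge_min lexx orbT.
rewrite ge_min leNgt; apply/orP; left; apply/negP => xz.
exact: (eB z xz Bz).
Qed.

Lemma cdist_relopen_gt0 Q B x : B `<=` Q -> relopen Q (~` B) -> Q x -> ~ B x ->
  0 < cdist B x.
Proof.
move=> BQ oB Qx nBx; apply: cdist_gt0.
apply: filterS (oB x Qx nBx) => y H By; exact: (H (BQ _ By) By).
Qed.

Lemma convex_set_ball (Q : set 'rV[R]_m) x (e : R) : convex_set Q ->
  convex_set (Q `&` [set y | `|x - y| <= e]).
Proof.
move=> cQ a b t [Qa /= xa] [Qb /= xb] t01; split; first exact: cQ.
rewrite /=; have -> : x - (t *: a + (1 - t) *: b) =
    t *: (x - a) + (1 - t) *: (x - b).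
  by apply/rowP => i; rewrite !mxE; ring.
apply: le_trans (ler_normD _ _) _; rewrite !normrZ.
rewrite ger0_norm ?(ger0_norm (_ : 0 <= 1 - t)); [|lra|lra].
have := ler_wpM2l (_ : 0 <= t) xa; have := ler_wpM2l (_ : 0 <= 1 - t) xb.
by move=> /(_ ltac:(lra)) H1 /(_ ltac:(lra)) H2; lra.
Qed.

End capped_distance.

Section coloured_grid.
Context {R : realType} (m n k : nat).
Hypothesis mnk : (m < n * k.+1)%N.
Variables (Q : set 'rV[R]_m) (C : R) (nu Z : nat).
Hypothesis Q_bounded : forall p i, Q p -> `|p ord0 i| <= C.
Hypothesis Z_large : 2 * C * nu%:R + 1 < Z%:R.
Hypothesis nu_gt0 : (0 < nu)%N.

Let M : nat := (n * k.+1)%N.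

(* The tiles of colour [c] are the open cubes of the lattice of mesh [1 / nu],
   shifted by the fraction [c / M] of the mesh; [tent] vanishes on the walls. *)

Let tent (u : R) : R := Num.max 0 (Num.min u (1 - u)).

Let tent_gt0 u : (0 < tent u) = (0 < u < 1).
Proof. by rewrite /tent lt_max ltxx /= lt_min subr_gt0. Qed.

Let level (c : nat) (i : 'I_m) (p : 'rV[R]_m) : R :=
  nu%:R * (p ord0 i + C) + 1 - c%:R / M%:R.

Definition grid_bump (c : nat) (z : {ffun 'I_m -> 'I_Z}) (p : 'rV[R]_m) : R :=
  \prod_(i < m) tent (level c i p - (z i)%:R).

Lemma grid_bump_ge0 c z p : 0 <= grid_bump c z p.
Proof. by apply: prodr_ge0 => i _; rewrite le_max lexx. Qed.

Lemma cts_on_grid_bump A c z : cts_on A (grid_bump c z).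
Proof. by apply: cts_on_prod => i; rewrite /tent /level; cts. Qed.

Let bump_itv c z p i : 0 < grid_bump c z p ->
  0 < level c i p - (z i)%:R < 1.
Proof.
move=> h; rewrite -tent_gt0 lt0r le_max lexx andbT.
have /prodf_neq0 := lt0r_neq0 h; exact.
Qed.

Lemma grid_bump_inj c z z' p :
  0 < grid_bump c z p -> 0 < grid_bump c z' p -> z = z'.
Proof.
move=> h h'; apply/ffunP => i; apply: val_inj => /=.
have := bump_itv i h; have := bump_itv i h'.
move: (level c i p) => L H1 H2.
have a1 : (z i)%:R < (z' i)%:R + 1 :> R by lra.
have a2 : (z' i)%:R < (z i)%:R + 1 :> R by lra.
move: a1 a2; rewrite !natr1 !ltr_nat !ltnS => b1 b2.
by apply/eqP; rewrite eqn_leq b1 b2.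
Qed.

Lemma grid_bump_dist c z p p' :
  0 < grid_bump c z p -> 0 < grid_bump c z p' -> `|p - p'| <= nu%:R^-1.
Proof.
move=> h h'; rewrite /Num.norm /= mx_normrE.
apply: bigmax_le; first by rewrite invr_ge0.
move=> [a i] _ /=; rewrite !mxE (ord1 a).
have := bump_itv i h; have := bump_itv i h'; rewrite /level => H1 H2.
have nu0 : 0 < nu%:R :> R by rewrite ltr0n.
rewrite -(@ler_pM2l _ nu%:R)// divff ?gt_eqF// -(ger0_norm (ltW nu0)) -normrM.
by rewrite ler_norml; lra.
Qed.

(** Each coordinate lies on at most one of the [M] shifted lattices, so it can
    spoil at most one colour, and there are more colours than coordinates. *)
Lemma grid_bump_cover p : Q p -> exists c z, (c < M)%N /\ 0 < grid_bump c z p.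
Proof.
move=> Qp; have nu0 : 0 < nu%:R :> R by rewrite ltr0n.
have M0 : 0 < M%:R :> R by rewrite ltr0n; apply: leq_ltn_trans mnk.
have lev_ge0 (c : 'I_M) i : 0 <= level c i p.
  rewrite /level; have : c%:R / M%:R <= 1 :> R.
    by rewrite ler_pdivrMr// mul1r ler_nat ltnW.
  have := Q_bounded i Qp; rewrite ler_norml => /andP[H _] H2.
  have : 0 <= nu%:R * (p ord0 i + C) by apply: mulr_ge0 => //; lra.
  lra.
have lev_lt (c : 'I_M) i : level c i p < Z%:R.
  apply: le_lt_trans Z_large; rewrite /level.
  have : 0 <= c%:R / M%:R :> R by apply: divr_ge0.
  have := Q_bounded i Qp; rewrite ler_norml => /andP[_ H] H2.
  have : nu%:R * (p ord0 i + C) <= nu%:R * (2 * C) by rewrite ler_wpM2l//; lra.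
  lra.
pose fl (c : 'I_M) i := Num.truncn (level c i p).
have flP (c : 'I_M) i : (fl c i)%:R <= level c i p < (fl c i).+1%:R.
  exact: truncn_itv.
have [c Hc] : exists c : 'I_M, forall i, level c i p <> (fl c i)%:R.
  apply: contrapT => /forallNP H.
  have {}H (c : 'I_M) : exists i, level c i p = (fl c i)%:R.
    by have /existsNP[i /contrapT] := H c; exists i.
  have [g Hg] := choice H.
  have ginj : injective g.
    move=> c c' cc'; have := Hg c; have := Hg c'; rewrite -cc' /level.
    set L := nu%:R * _; move: (fl c' _) (fl c _) => a b Ha Hb.
    have : (a * M + c')%:R = (b * M + c)%:R :> R.
      rewrite !natrD (natrM R a M) (natrM R b M) -Ha -Hb; field; rewrite gt_eqF//.
    move/eqP; rewrite eqr_nat => /eqP E.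
    apply: val_inj => /=; have : ((a * M + c') %% M = (b * M + c) %% M)%N by rewrite E.
    by rewrite !modnMDl !modn_small.
  have := leq_card g ginj; rewrite !card_ord leqNgt.
  by rewrite /M mnk.
have flZ i : (fl c i < Z)%N.
  rewrite -(ltr_nat R); apply: le_lt_trans (lev_lt c i).
  by have /andP[] := flP c i.
exists c, [ffun i => Ordinal (flZ i)]; split => //.
apply: prodr_gt0 => i _; rewrite tent_gt0 ffunE /=.
have /andP[f1 f2] := flP c i; move: f2; rewrite -natr1 => f2.
have : level c i p != (fl c i)%:R by apply/eqP.
rewrite neq_lt => /orP[f3|f3]; lra.
Qed.

End coloured_grid.

(** Up to the barycentric weights, a section over [Q] of the fibrewise join of
    [n] copies of the free loop fibration, pulled back along [xi]. *)
Definition loop_cover (R : realType) (X P : topologicalType) (n : nat)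
    (xi : P -> X) (Q : set P) (V : 'I_n -> set P) (l : 'I_n -> P * R -> X) :
    Prop :=
  [/\ forall j, relopen Q (V j),
      forall j, cts_on (cyl (Q `&` V j)) (l j),
      forall j p, Q p -> V j p -> l j (p, 0) = xi p /\ l j (p, 1) = xi p &
      forall p, Q p -> exists j, V j p].

Section inner_filling.
Context {R : realType} (X : topologicalType) (k m n : nat).
Hypothesis Xk : k_connected R X k.
Hypothesis mnk : (m < n * k.+1)%N.
Variables (Q E : set 'rV[R]_m) (xi : 'rV[R]_m -> X) (C : R).
Hypothesis cvxQ : convex_set Q.
Hypothesis Q_bounded : forall p i, Q p -> `|p ord0 i| <= C.
Hypothesis cts_xi : cts_on Q xi.
Hypothesis EQ : E `<=` Q.
Hypothesis Ecompact : compact E.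
Variables (D : 'I_n -> set 'rV[R]_m) (l : 'I_n -> 'rV[R]_m * R -> X).
Hypothesis oD : forall j, relopen Q (D j).
Hypothesis cts_l : forall j, cts_on (cyl (Q `&` D j)) (l j).
Hypothesis loop_l : forall j p, Q p -> D j p ->
  l j (p, 0) = xi p /\ l j (p, 1) = xi p.
Hypothesis covE : forall p, E p -> exists j, D j p.

Let Nn j : set 'rV[R]_m := Q `&` ~` D j.

Let n_gt0 : (0 < n)%N.
Proof. by move: mnk; case: n. Qed.

Let Nn_gt0 j p : Q p -> D j p -> 0 < cdist (Nn j) p.
Proof.
move=> Qp Dp; apply: (@cdist_relopen_gt0 _ _ Q) => //; first by move=> ? [].
  have -> : ~` Nn j = ~` Q `|` D j by rewrite /Nn setCI setCK.
  by apply: relopenU; [move=> x Qx nQ|exact: oD].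
by case.
Qed.

Let delta_ex : exists2 d : R, 0 < d & forall p, E p -> exists j, d < cdist (Nn j) p.
Proof.
have [->|/set0P E0] := eqVneq E set0; first by exists 1.
pose S p : R := \sum_j cdist (Nn j) p.
have cS : {within E, continuous S}.
  by apply/cts_on_within/cts_on_sum => j; exact: cts_on_cdist.
have [p0 /set_mem Ep0 Hp0] := compact_EVT_min E0 Ecompact cS.
have S0 : 0 < S p0.
  have [j Dj] := covE Ep0; rewrite /S (bigD1 j)//=; apply: ltr_wpDr.
    by apply: sumr_ge0 => i _; exact: cdist_ge0.
  by apply: Nn_gt0 => //; exact: EQ.
have n0 : 0 < n%:R :> R by rewrite ltr0n.
exists (S p0 / (2 * n%:R)); first by apply: divr_gt0 => //; apply: mulr_gt0.
move=> p Ep; apply: contrapT => /forallNP H.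
have : S p <= S p0 / 2.
  have -> : S p0 / 2 = \sum_(j < n) (S p0 / (2 * n%:R)).
    by rewrite sumr_const card_ord -[RHS]mulr_natr; field; rewrite gt_eqF.
  by apply: ler_sum => j _; rewrite leNgt; apply/negP; exact: H.
have := Hp0 p (mem_set Ep); lra.
Qed.

(** Index [j] receives [k.+1] colours of tiles. The weights of the tiles fade
    out towards [E], where the weight [al j] of the given loops takes over; it is
    positive only where tiles are too small to leave [D j]. The delay in [t] is
    the time that [nerve_loops] spends on its segments, which are constant on
    [E]. *)
Lemma inner_filling : exists V l', loop_cover xi Q V l' /\
  forall j p, E p -> V j p -> D j p /\
    forall t, 0 <= t <= 1 -> l' j (p, t) = l j (p, clamp 0 1 (2 * t - 2^-1)).
Proof.
have [d d0 dE] := delta_ex.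
have [nu nud] : exists nu : nat, (0 < nu)%N /\ nu%:R^-1 < d.
  exists (Num.truncn d^-1).+1; split=> //.
  have d'0 : 0 <= d^-1 by rewrite invr_ge0 ltW.
  have /andP[_ H] := truncn_itv d'0.
  by rewrite -[ltRHS]invrK ltf_pV2// posrE ?invr_gt0 ?ltr0n.
have [nu0 nudlt] := nud.
have [Z HZ] : exists Z : nat, 2 * C * nu%:R + 1 < Z%:R.
  exists (Num.truncn (`|2 * C * nu%:R + 1|)).+1.
  have /andP[_ H] := truncn_itv (normr_ge0 (2 * C * nu%:R + 1)).
  exact: le_lt_trans (ler_norm _) H.
pose T : finType := ('I_k.+1 * {ffun 'I_m -> 'I_Z})%type.
pose tile (j : 'I_n) (s : T) := @grid_bump R m n k C nu Z (j * k.+1 + s.1)%N s.2.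
pose al j p : R := Num.max 0 (cdist (Nn j) p - d).
pose be j (i : 'I_#|T|) p : R := tile j (enum_val i) p * cdist E p.
have be_tile j i p : 0 < be j i p -> 0 < tile j (enum_val i) p.
  move=> H; rewrite lt0r grid_bump_ge0 andbT; apply/eqP => E0.
  by move: H; rewrite /be E0 mul0r ltxx.
have Hq j (s : T) : exists q : 'rV[R]_m, forall p : 'rV[R]_m, Q p -> 0 < tile j s p -> Q q /\ 0 < tile j s q.
  have [[q [Qq tq]]|no] := pselect (exists p, Q p /\ 0 < tile j s p).
    by exists q.
  by exists 0 => p Qp tp; exfalso; apply: no; exists p.
have {Hq} [q Hq] : exists q : 'I_n -> T -> 'rV[R]_m, forall j s (p : 'rV[R]_m), Q p ->
    0 < tile j s p -> Q (q j s) /\ 0 < tile j s (q j s).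
  have H j : exists q : T -> 'rV[R]_m, forall s (p : 'rV[R]_m), Q p -> 0 < tile j s p ->
      Q (q s) /\ 0 < tile j s (q s) by have [q Hq'] := choice (Hq j); exists q.
  by have [q H'] := choice H; exists q.
have cal j : cts_on Q (al j).
  by have := @cts_on_cdist _ _ Q (Nn j); rewrite /al => ?; cts.
have cbe j i : cts_on Q (be j i).
  apply: cts_onM; last exact: cts_on_cdist.
  exact: cts_on_grid_bump.
have al0 j p : 0 <= al j p by rewrite /al le_max lexx.
have be0 j i p : 0 <= be j i p.
  by apply: mulr_ge0; [exact: grid_bump_ge0|exact: cdist_ge0].
have qin j i p : Q p -> 0 < be j i p -> Q (q j (enum_val i)).
  by move=> Qp /be_tile /(Hq _ _ _ Qp)[].
have colinj j i i' p : Q p -> 0 < be j i p -> 0 < be j i' p ->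
    (enum_val i).1 = (enum_val i').1 -> i = i'.
  move=> Qp /be_tile t1 /be_tile t2 E1; apply: enum_val_inj.
  move: t1 t2 E1; case: (enum_val i) => c z; case: (enum_val i') => c' z' /=.
  by rewrite /tile /= => t1 + E1; rewrite -E1 => t2; rewrite (grid_bump_inj t1 t2).
have avoid j p : Q p -> 0 < al j p -> forall a (w : 'I_#|T| -> R), 0 <= a ->
    (forall i, 0 <= w i) -> (forall i, 0 < w i -> 0 < be j i p) ->
    0 < a + \sum_i w i ->
    D j ((a + \sum_i w i)^-1 *: (a *: p + \sum_i w i *: q j (enum_val i))).
  move=> Qp ap a w a0 w0 wb ws; apply: contrapT => nD.
  have [Qx xp] : (Q `&` [set y | `|p - y| <= nu%:R^-1])
      ((a + \sum_i w i)^-1 *: (a *: p + \sum_i w i *: q j (enum_val i))).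
    apply: convex_set_combination => //; first exact: convex_set_ball.
      by move=> _; split=> //=; rewrite subrr normr0 invr_ge0.
    move=> i /wb /be_tile ti; have [Qqi tqi] := Hq _ _ _ Qp ti.
    by split=> //=; exact: grid_bump_dist ti tqi.
  have /= := @cdist_le _ _ (Nn j) p _ (conj Qx nD).
  by move: ap; rewrite /al lt_max ltxx /= => ap H; move: xp => /= xp; lra.
have H j := nerve_loops Xk cvxQ cts_xi (@cts_l j) (@loop_l j) (cal j) (cbe j)
  (al0 j) (be0 j) (qin j) (colinj j) (avoid j).
have [l' Hl'] := choice H.
exists (fun j => nerve_support (al j) (be j)), l'; split.
- split.
  + move=> j; apply: relopenU.
      by apply: relopen_lt; [exact: cts_on_cst|exact: cal].
    apply: relopen_local => p Qp [i bi]; exists [set p | 0 < be j i p]; split=> //.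
      by apply: relopen_lt; [exact: cts_on_cst|exact: cbe].
    by move=> y _ By; exists i.
  + by move=> j; have [] := Hl' j.
  + by move=> j p Qp sp; have [_ + _] := Hl' j; apply.
  + move=> p Qp; have [Ep|nEp] := pselect (E p).
      have [j dj] := dE p Ep; exists j; left.
      by rewrite /al lt_max subr_gt0 dj orbT.
    have dp : 0 < cdist E p.
      apply: (@cdist_relopen_gt0 _ _ Q) => //.
      apply: open_relopen; apply: closed_openC.
      by apply: compact_closed => //; exact: norm_hausdorff.
    have [c [z [cM cz]]] := grid_bump_cover mnk Q_bounded HZ nu0 Qp.
    have cj : (c %/ k.+1 < n)%N by rewrite ltn_divLR.
    have ck : (c %% k.+1 < k.+1)%N by rewrite ltn_mod.
    exists (Ordinal cj); right; exists (enum_rank (Ordinal ck, z)).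
    by rewrite /be enum_rankK /tile /= -divn_eq; exact: mulr_gt0.
- move=> j p Ep [ap|[i]]; last by rewrite /be cdist_self// mulr0 ltxx.
  have b0 i : be j i p = 0 by rewrite /be cdist_self// mulr0.
  split; last by move=> t t01; have [_ _ ->] := Hl' j => //; exact: EQ.
  apply: contrapT => nD.
  have : cdist (Nn j) p = 0 by apply: cdist_self; split => //; exact: EQ.
  by move=> E0; move: ap; rewrite /al E0 lt_max ltxx /=; lra.
Qed.

End inner_filling.

Section gauge_filling.
Context {R : realType} (X : topologicalType) (k m n : nat).
Hypothesis Xk : k_connected R X k.
Hypothesis mnk : (m < n * k.+1)%N.
Variables (g : 'rV[R]_m -> R) (C : R).
Hypothesis cts_g : forall A, cts_on A g.
Hypothesis C_ge0 : 0 <= C.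
Hypothesis gZ : forall a p, 0 <= a -> g (a *: p) = a * g p.
Hypothesis gD : forall p q, g (p + q) <= g p + g q.
Hypothesis g_bound : forall (p : 'rV[R]_m) i, `|p ord0 i| <= C * g p.

Let Q : set 'rV[R]_m := [set p | g p <= 1].
Let E : set 'rV[R]_m := [set p | g p = 1].

Variables (xi : 'rV[R]_m -> X).
Hypothesis cts_xi : cts_on Q xi.
Variables (V : 'I_n -> set 'rV[R]_m) (l : 'I_n -> 'rV[R]_m * R -> X).
Hypothesis EVl : loop_cover xi E V l.

Let EQ : E `<=` Q. Proof. by move=> p pE; rewrite /Q /= (pE : g p = 1). Qed.

Let cvxQ : convex_set Q.
Proof.
move=> x y t /= Qx Qy t01; rewrite /Q /=; apply: le_trans (gD _ _) _.
rewrite !gZ; [|lra|lra].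
have a1 : t * g x <= t * 1 by apply: ler_wpM2l => //; lra.
have a2 : (1 - t) * g y <= (1 - t) * 1 by apply: ler_wpM2l => //; lra.
lra.
Qed.

Let rho (p : 'rV[R]_m) : 'rV[R]_m := (g p)^-1 *: p.

Let rho_E p : 0 < g p -> E (rho p).
Proof. by move=> g0; rewrite /E /= gZ ?invr_ge0 ?ltW// mulVf// gt_eqF. Qed.

Let cts_rho A : (forall p, A p -> 0 < g p) -> cts_on A rho.
Proof.
move=> g0; rewrite /rho; apply: cts_onZ; last exact: cts_on_id.
by apply: cts_onV => // p /g0 H; rewrite gt_eqF.
Qed.

Let D j : set 'rV[R]_m := [set p | 2^-1 < g p] `&` (rho @^-1` V j).

(* The radial segment from [p] to the boundary is run through in time
   [(1 - g p) / 2], so the delay vanishes on the boundary. *)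
Let lc j (pt : 'rV[R]_m * R) : X :=
  if Num.min pt.2 (1 - pt.2) <= (1 - g pt.1) / 2
  then xi (((g pt.1 + 2 * Num.min pt.2 (1 - pt.2)) / g pt.1) *: pt.1)
  else l j (rho pt.1, (pt.2 - (1 - g pt.1) / 2) / g pt.1).

Let min01 (t : R) : 0 <= t <= 1 ->
  [\/ Num.min t (1 - t) = t /\ t <= 2^-1 |
      Num.min t (1 - t) = 1 - t /\ 2^-1 <= t].
Proof.
by move=> t01; rewrite minEle; case: ifP => [h|/negbT]; [left|rewrite -ltNge => h; right]; split=> //; lra.
Qed.

Let lc0 j p : Q p -> D j p -> lc j (p, 0) = xi p.
Proof.
move=> Qp [/= gp _]; rewrite /lc /= subr0 min_l//.
have -> : 0 <= (1 - g p) / 2 by move: Qp; rewrite /Q /=; lra.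
by rewrite mulr0 addr0 divff ?scale1r// gt_eqF//; lra.
Qed.

Let lc1 j p : Q p -> D j p -> lc j (p, 1) = xi p.
Proof.
move=> Qp [/= gp _]; rewrite /lc /= subrr min_r//.
have -> : 0 <= (1 - g p) / 2 by move: Qp; rewrite /Q /=; lra.
by rewrite mulr0 addr0 divff ?scale1r// gt_eqF//; lra.
Qed.

Let oD j : relopen Q (D j).
Proof.
apply: relopen_trans.
  by apply: relopen_lt => //; exact: cts_on_cst.
have [oV _ _ _] := EVl; apply: (relopen_preimage (B := E)) (oV j).
  by apply: cts_rho => p [_ /=]; lra.
by move=> p [_ /= gp]; apply: rho_E; lra.
Qed.

Let cts_lc j : cts_on (cyl (Q `&` D j)) (lc j).
Proof.
have [_ cl ll _] := EVl.
have g0 (A : set ('rV[R]_m * R)) (p : 'rV[R]_m * R) :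
    (cyl (Q `&` D j) `&` A) p -> 0 < g p.1.
  by move=> [[[_ [/= gp _]] _] _]; lra.
have cg (A : set ('rV[R]_m * R)) : cts_on A (fun p => g p.1).
  by apply: (cts_on_comp _ (cts_g (A := setT))) => //; cts.
have cgV (A : set ('rV[R]_m * R)) : cts_on (cyl (Q `&` D j) `&` A) (fun p => (g p.1)^-1).
  by apply: cts_onV; [exact: (cg _)|move=> p /g0 H; rewrite gt_eqF].
have ct (A : set ('rV[R]_m * R)) : cts_on A (fun p => p.2) by cts.
apply: cts_on_if.
- by cts.
- by have := cg (cyl (Q `&` D j)) => ?; cts.
- set A := (X in cts_on X _).
  apply: (cts_on_comp (f := fun p : 'rV[R]_m * R =>
    ((g p.1 + 2 * Num.min p.2 (1 - p.2)) / g p.1) *: p.1) _ cts_xi).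
    by have := cg A => ?; have := cgV _ : cts_on A _ => ?; cts.
  move=> [p t] Ap; have /= gp := g0 _ _ Ap; case: Ap => -[[Qp Dp] t01] /= h.
  rewrite /Q /= gZ ?divfK ?gt_eqF//; first by lra.
  apply: divr_ge0; last exact: ltW.
  by have [[-> _]|[-> _]] := min01 t01; move: t01 => /=; lra.
- set A := (X in cts_on X _).
  apply: (cts_on_comp (f := fun p : 'rV[R]_m * R =>
    (rho p.1, (p.2 - (1 - g p.1) / 2) / g p.1)) _ (cl j)).
    apply: cts_on_pair; last by have := cg A => ?; have := cgV _ : cts_on A _ => ?; cts.
    by apply: (cts_on_comp _ (cts_rho (A := [set p | 0 < g p]) _)) => //;
      [cts|move=> p /g0].
  move=> [p t] Ap; have /= gp := g0 _ _ Ap; case: Ap => -[[Qp [_ Vp]] t01] /= h.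
  split => /=; first by split=> //; exact: rho_E.
  have {}Qp : g p <= 1 by [].
  have [h1 h2] : (1 - g p) / 2 <= t /\ (1 - g p) / 2 <= 1 - t.
    by move: h; rewrite le_min => /andP.
  apply/andP; split; first by apply: divr_ge0; lra.
  by rewrite ler_pdivrMr// mul1r; lra.
- move=> [p t] Ap /= h.
  have /= gp : 0 < g p by have := g0 setT (p, t); apply.
  case: Ap => -[Qp [_ Vp]] /= t01.
  have [l0 l1] := ll j _ (rho_E gp) Vp.
  rewrite h; have -> : (g p + 2 * ((1 - g p) / 2)) / g p = (g p)^-1.
    by rewrite -[RHS]mul1r; congr (_ / _); lra.
  have [[E1 _]|[E1 _]] := min01 t01; rewrite E1 in h.
    by rewrite -h subrr mul0r l0.
  have -> : (t - (1 - g p) / 2) / g p = 1.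
    have -> : t - (1 - g p) / 2 = g p by lra.
    by rewrite divff// gt_eqF.
  by rewrite l1.
Qed.

(** The given loops, conjugated by radial segments, extend to a collar of the
    boundary; [inner_filling] replaces them inside the level [3 / 4] of the
    gauge, and between the levels [3 / 4] and 1 its delay is undone. *)
Lemma gauge_filling : exists V' l', loop_cover xi Q V' l' /\
  forall j p, E p -> (V' j p <-> V j p) /\
    (V j p -> forall t, 0 <= t <= 1 -> l' j (p, t) = l j (p, t)).
Proof.
have [oV cl ll cov] := EVl.
pose E' : set 'rV[R]_m := [set p | g p = 3 / 4].
have E'Q : E' `<=` Q by move=> p; rewrite /Q /= => pE; have -> : g p = 3 / 4 := pE; lra.
have cptE' : compact E'.
  apply: bounded_closed_compact.
    exists (C * (3 / 4)); split; first exact: num_real.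
    move=> M CM p pE; apply: le_trans (ltW CM).
    rewrite /Num.norm /= mx_normrE; apply: bigmax_le.
      by apply: mulr_ge0 => //; lra.
    by move=> [a i] _ /=; rewrite (ord1 a); have := g_bound p i; rewrite pE.
  rewrite -[E']setCK; apply: open_closedC; apply: relopen_setT.
  by apply: relopen_eq_setC => //; exact: cts_on_cst.
have Q_bounded p i : Q p -> `|p ord0 i| <= C.
  move=> Qp; apply: le_trans (g_bound p i) _.
  by rewrite -[leRHS]mulr1; apply: ler_wpM2l.
have covE' p : E' p -> exists j, D j p.
  rewrite /E' /= => gp; have g0 : 0 < g p by rewrite gp; lra.
  have [j Vj] := cov _ (rho_E g0); exists j; split => //=.
  by rewrite gp; lra.
have lloop j p : Q p -> D j p -> lc j (p, 0) = xi p /\ lc j (p, 1) = xi p.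
  by move=> Qp Dp; rewrite lc0 ?lc1.
have [V1 [l1 [[oV1 cl1 ll1 cov1] E1]]] := inner_filling Xk mnk cvxQ Q_bounded
  cts_xi E'Q cptE' oD cts_lc lloop covE'.
pose lag (p : 'rV[R]_m * R) : R := clamp 0 1 ((p.2 - (1 - g p.1)) / (2 * g p.1 - 1)).
pose V' j : set 'rV[R]_m := [set p | if g p <= 3 / 4 then V1 j p else V j (rho p)].
pose l' j (p : 'rV[R]_m * R) : X :=
  if g p.1 <= 3 / 4 then l1 j p else lc j (p.1, lag p).
have V'D j p : Q p -> V' j p -> 3 / 4 <= g p -> D j p.
  rewrite /V' /= => Qp; case: leP => [g1 V1p g2|g1 Vp _].
    by have [] := E1 j p _ V1p; first exact/le_anti/andP.
  by split=> //=; lra.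
exists V', l'; split; first split.
- move=> j; apply: relopen_local => p Qp V'p.
  case: (ltgtP (g p) (3 / 4)) => gp.
  + exists ([set y | g y < 3 / 4] `&` V1 j); split.
    * by apply: relopenI => //; apply: relopen_lt => //; exact: cts_on_cst.
    * by split=> //; move: V'p; rewrite /V' /= (ltW gp).
    * by move=> y _ [/= gy V1y]; rewrite /V' /= (ltW gy).
  + exists ([set y | 3 / 4 < g y] `&` D j); split.
    * by apply: relopenI => //; apply: relopen_lt => //; exact: cts_on_cst.
    * by split=> //; apply: V'D => //; exact: ltW.
    * by move=> y _ [/= gy [_ Vy]]; rewrite /V' /= leNgt gy.
  + exists (V1 j `&` D j); split.
    * exact: relopenI.
    * split; last by apply: V'D => //; rewrite gp.
      by move: V'p; rewrite /V' /= gp lexx.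
    * by move=> y _ [V1y [_ Vy]]; rewrite /V' /=; case: ifP.
- move=> j.
  have cg (A : set ('rV[R]_m * R)) : cts_on A (fun p => g p.1).
    by apply: (cts_on_comp _ (cts_g (A := setT))) => //; cts.
  apply: cts_on_if => //; first exact: cts_on_cst.
  + apply: (cts_on_sub _ (cl1 j)) => -[p t] [[[Qp V'p] t01] /= gp].
    by split=> //; split=> //; move: V'p; rewrite /V' /= gp.
  + set A := (X in cts_on X _).
    apply: (cts_on_comp (f := fun p : 'rV[R]_m * R => (p.1, lag p)) _ (cts_lc (j := j))).
      have cgA := cg A.
      have cV : cts_on A (fun p => (2 * g p.1 - 1)^-1).
        apply: cts_onV; first by cts.
        by move=> p [_ /= gp]; rewrite gt_eqF//; lra.
      by rewrite /lag; cts.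
    move=> [p t] [[[Qp V'p] t01] /= gp]; split; last exact: clamp_itv.
    by split=> //; exact: V'D.
  + move=> [p t] [[Qp V'p] /= t01] /= gp.
    have E'p : E' p by [].
    have V1p : V1 j p by move: V'p; rewrite /V' /= gp lexx.
    have [_ ->//] := E1 j p E'p V1p.
    rewrite /lag /= gp; congr (lc _ (_, clamp _ _ _)).
    by field.
- move=> j p Qp V'p; rewrite /l' /=; case: leP => gp.
    by apply: ll1 => //; move: V'p; rewrite /V' /= gp.
  have Dp : D j p by apply: V'D => //; exact: ltW.
  have g1 : 0 < 2 * g p - 1 by lra.
  rewrite /lag /= clamp_lo ?clamp_hi ?lc0 ?lc1//.
    by rewrite ler_pdivlMr// mul1r; move: Qp; rewrite /Q /=; lra.
  by rewrite ler_pdivrMr// mul0r; move: Qp; rewrite /Q /=; lra.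
- move=> p Qp; case: (leP (g p) (3 / 4)) => gp.
    by have [j V1j] := cov1 p Qp; exists j; rewrite /V' /= gp.
  have g0 : 0 < g p by lra.
  have [j Vj] := cov _ (rho_E g0); exists j.
  by rewrite /V' /= leNgt gp.
- move=> j p; rewrite /E /= => gp.
  have rp : rho p = p by rewrite /rho gp invr1 scale1r.
  have gp34 : (g p <= 3 / 4) = false by apply/negbTE; rewrite -ltNge gp; lra.
  rewrite /V' /l' /= gp34 rp; split => // Vp t t01.
  have [l0 l1'] := ll j p gp Vp.
  have -> : lag (p, t) = t.
    rewrite /lag /= gp clamp_id; first by field.
    by have -> : (t - (1 - 1)) / (2 * 1 - 1) = t by field.
  rewrite /lc /= gp subrr mul0r rp !divr1.
  have [[-> _]|[-> _]] := min01 t01.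
    case: ifP => [t0|_]; last by rewrite subr0.
    have -> : t = 0 by lra.
    by rewrite mulr0 addr0 scale1r l0.
  case: ifP => [t0|_]; last by rewrite subr0.
  have -> : t = 1 by lra.
  by rewrite subrr mulr0 addr0 scale1r l1'.
Qed.

End gauge_filling.

(** * Extending loops over a prism on a simplex *)

Section simplex_gauge.
Context {R : realType} (m : nat).
Hypothesis m_gt0 : (0 < m)%N.
Implicit Types (u : 'rV[R]_m).

(* A simplex of dimension [m - 1] times an interval is put into [m] coordinates by
   letting the interval run along the diagonal: the mean is its coordinate, and
   the deviations from the mean are barycentric coordinates up to a constant. *)
Definition mean u : R := (\sum_i u ord0 i) / m%:R.

(** The Minkowski functional of the prism over a simplex, centered. *)
Definition simplex_gauge u : R :=
  \big[Num.max/2 * `|mean u|]_(i < m) (m%:R * (mean u - u ord0 i)).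

Let m0 : 0 < m%:R :> R. Proof. by rewrite ltr0n. Qed.

Lemma meanZ a u : mean (a *: u) = a * mean u.
Proof.
by rewrite /mean; under eq_bigr do rewrite mxE; rewrite -mulr_sumr mulrA.
Qed.

Lemma meanD u v : mean (u + v) = mean u + mean v.
Proof.
by rewrite /mean; under eq_bigr do rewrite mxE; rewrite big_split mulrDl.
Qed.

Lemma simplex_gaugeP u c : reflect
  (2 * `|mean u| <= c /\ forall i, m%:R * (mean u - u ord0 i) <= c)
  (simplex_gauge u <= c).
Proof.
apply: (iffP (bigmax_leP _ _ _ _)) => -[H1 H2]; split=> // i; exact: H2.
Qed.

Lemma simplex_gauge_ge0 u : 0 <= simplex_gauge u.
Proof.
have /simplex_gaugeP[H _] := lexx (simplex_gauge u).
by apply: le_trans H; rewrite mulr_ge0.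
Qed.

Lemma simplex_gaugeD u v :
  simplex_gauge (u + v) <= simplex_gauge u + simplex_gauge v.
Proof.
have /simplex_gaugeP[a1 a2] := lexx (simplex_gauge u).
have /simplex_gaugeP[b1 b2] := lexx (simplex_gauge v).
apply/simplex_gaugeP; rewrite meanD; split.
  by have := ler_normD (mean u) (mean v); lra.
by move=> i; rewrite mxE; have := a2 i; have := b2 i; lra.
Qed.

Lemma simplex_gaugeZ a u : 0 <= a -> simplex_gauge (a *: u) = a * simplex_gauge u.
Proof.
have le b v : 0 <= b -> simplex_gauge (b *: v) <= b * simplex_gauge v.
  move=> b0; have /simplex_gaugeP[a1 a2] := lexx (simplex_gauge v).
  apply/simplex_gaugeP; rewrite meanZ normrM ger0_norm//; split.
    by rewrite mulrCA ler_wpM2l.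
  by move=> i; rewrite mxE -mulrBr mulrCA ler_wpM2l.
rewrite le_eqVlt => /orP[/eqP <-|a0].
  by apply/le_anti; rewrite le// mul0r simplex_gauge_ge0.
apply/le_anti; rewrite (le _ _ (ltW a0)) /=.
have ai0 : 0 <= a^-1 by rewrite invr_ge0 ltW.
have := le a^-1 (a *: u) ai0.
by rewrite scalerA mulVf ?gt_eqF// scale1r mulrC ler_pdivlMr// mulrC.
Qed.

Let mean_sum u : \sum_i (mean u - u ord0 i) = 0.
Proof.
rewrite big_split /= sumr_const card_ord sumrN -[_ *+ m]mulr_natr /mean.
by rewrite divfK ?gt_eqF// subrr.
Qed.

Lemma simplex_gauge_bound u i : `|u ord0 i| <= 2 * simplex_gauge u.
Proof.
have g0 := simplex_gauge_ge0 u.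
have /simplex_gaugeP[a1 a2] := lexx (simplex_gauge u).
set g := simplex_gauge u in g0 a1 a2 *.
have m1 : 1 <= m%:R :> R by rewrite ler1n.
have a3 j : mean u - u ord0 j <= g / m%:R.
  by rewrite ler_pdivlMr// mulrC; exact: a2.
have gm : g / m%:R <= g by rewrite ler_pdivrMr// ler_peMr.
have up : u ord0 i - mean u <= g.
  have := mean_sum u; rewrite (bigD1 i)//= => S0.
  have : \sum_(j < m | j != i) (mean u - u ord0 j) <= \sum_(j < m | j != i) (g / m%:R).
    by apply: ler_sum => j _.
  have : \sum_(j < m | j != i) (g / m%:R) <= \sum_(j < m) (g / m%:R).
    by rewrite [leRHS](bigD1 i)//= lerDr divr_ge0// ltW.
  have -> : \sum_(j < m) (g / m%:R) = g.
    by rewrite sumr_const card_ord -[_ *+ m]mulr_natr divfK ?gt_eqF.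
  by lra.
have := a3 i; move: a1; rewrite ler_norml.
have : - `|mean u| <= mean u <= `|mean u| by rewrite -ler_norml.
lra.
Qed.

Lemma cts_on_simplex_gauge A : cts_on A simplex_gauge.
Proof.
have mu u : `|mean u| <= `|u|.
  rewrite /mean normrM [X in _ * X]ger0_norm; last by rewrite invr_ge0 ltW.
  rewrite ler_pdivrMr//.
  apply: le_trans (ler_norm_sum _ _ _) _.
  apply: (@le_trans _ _ (\sum_(i < m) `|u|)).
    apply: ler_sum => i _; rewrite {2}/Num.norm /= mx_normrE.
    exact: (le_bigmax _ (fun ij => `|u ij.1 ij.2|) (ord0, i)).
  by rewrite sumr_const card_ord -[leLHS]mulr_natr.
have gu u : simplex_gauge u <= (2 + 2 * m%:R) * `|u|.
  have n0 : 0 <= `|u| by [].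
  have mn0 : 0 <= m%:R * `|u| by rewrite mulr_ge0// ltW.
  apply/simplex_gaugeP; split; first by have := mu u; lra.
  move=> i; have : mean u - u ord0 i <= 2 * `|u|.
    have : `|u ord0 i| <= `|u|.
      rewrite {2}/Num.norm /= mx_normrE.
      exact: (le_bigmax _ (fun ij => `|u ij.1 ij.2|) (ord0, i)).
    by have := mu u; rewrite !ler_norml; lra.
  by move=> /(ler_wpM2l (ltW m0)); lra.
apply: (@lipschitz_cts_on _ 'rV[R]_m _ _ (2 + 2 * m%:R)); first by have := m0; lra.
move=> u v; rewrite -{1}(subrK v u) addrC.
by apply: le_trans (simplex_gaugeD _ _) _; rewrite lerD2l.
Qed.

Lemma cts_on_mean (A : set 'rV[R]_m) : cts_on A mean.
Proof. by rewrite /mean; cts. Qed.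

End simplex_gauge.

Section realization_topology.
Context {R : realType} (V : choiceType) (K : simplicialComplex V).
Local Notation X := (realization R K).
Local Notation closed_simplex := (@closed_simplex R V K).

Lemma nbhs_realization (x : X) (A : set X) (s : {fset V}) :
  simplex K s -> closed_simplex s x -> nbhs x A ->
  exists2 e : R, 0 < e & forall y, closed_simplex s y ->
    (forall v, v \in s -> `|bary x v - bary y v| < e) -> A y.
Proof.
move=> Ks sx; rewrite nbhsE => -[B [oB Bx] BA].
by have [e e0 eB] := oB s Ks x sx Bx; exists e => // y sy xy; apply: BA; exact: eB.
Qed.

Lemma cts_on_bary (A : set X) v : cts_on A (fun x => bary x v).
Proof.
apply: cts_on_dist => x Ax e e0.
apply: (@open_near X [set y | `|bary x v - bary y v| < e]); last by [].
  2: by rewrite /= subrr normr0.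
move=> s Ks y sy /= xy; exists (e - `|bary x v - bary y v|); first by rewrite subr_gt0.
move=> z sz yz; have [vs|vs] := boolP (v \in s).
  have := ler_normD (bary x v - bary y v) (bary y v - bary z v).
  by rewrite subrKA; have := yz v vs; lra.
have out (w : X) : closed_simplex s w -> bary w v = 0.
  move=> sw; apply: fsfun_dflt; apply: contra vs; exact: (fsubsetP sw).
by move: xy; rewrite (out y sy) (out z sz).
Qed.

End realization_topology.

Section simplex_filling.
Context {R : realType} (V : choiceType) (K : simplicialComplex V).
Local Notation X := (realization R K).
Local Notation closed_simplex := (@closed_simplex R V K).
Variable (s : {fset V}).
Hypothesis Ks : simplex K s.
Variable (x0 : X).

Let m : nat := size (enum_fset s).

Let vtx (i : 'I_m) : V := tnth (in_tuple (enum_fset s)) i.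

Let m_gt0 : (0 < m)%N.
Proof.
by have := simplex_neq0 Ks; rewrite -cardfs_gt0.
Qed.

Let vtx_in i : vtx i \in s.
Proof. exact: mem_tnth. Qed.

Let vtx_inj : injective vtx.
Proof. by apply/(tuple_uniqP (in_tuple (enum_fset s))); exact: fset_uniq. Qed.

Let vtx_ex v : v \in s -> exists i, vtx i = v.
Proof.
by move=> vs; have /tnthP[i iv] : v \in in_tuple (enum_fset s) by []; exists i.
Qed.

Let weight (u : 'rV[R]_m) (v : V) : R :=
  \sum_i (vtx i == v)%:R * (m%:R^-1 + (u ord0 i - mean u)).

Let weight_vtx u i : weight u (vtx i) = m%:R^-1 + (u ord0 i - mean u).
Proof.
rewrite /weight (bigD1 i)//= eqxx mul1r big1 ?addr0// => j ji.
by rewrite (inj_eq vtx_inj) (negPf ji) mul0r.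
Qed.

Let fs (u : 'rV[R]_m) : {fsfun V -> R with 0} := [fsfun v in s => weight u v | 0].

Let fsE u v : fs u v = if v \in s then weight u v else 0.
Proof. by rewrite fsfunE. Qed.

Let m0 : 0 < m%:R :> R. Proof. by rewrite ltr0n. Qed.

Let sum_vtx (f : V -> R) : \sum_(v <- enum_fset s) f v = \sum_i f (vtx i).
Proof. by rewrite (big_tnth _ _ (enum_fset s)). Qed.

Let sum_supp (f : {fsfun V -> R with 0}) : (finsupp f `<=` s)%fset ->
  \sum_(v <- finsupp f) f v = \sum_i f (vtx i).
Proof.
move=> fss; rewrite -sum_vtx; apply: big_fset_incl => // v vs.
by move=> /fsfun_dflt.
Qed.

Let sum_weight u : \sum_i weight u (vtx i) = 1.
Proof.
under eq_bigr do rewrite weight_vtx.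
rewrite big_split /= sumr_const card_ord -[_ *+ m]mulr_natr mulVf ?gt_eqF//.
rewrite big_split /= sumr_const card_ord -[_ *+ m]mulr_natr mulNr /mean.
by rewrite divfK ?gt_eqF// subrr addr0.
Qed.

Let fs_supp u : (finsupp (fs u) `<=` s)%fset.
Proof.
apply/fsubsetP => v; rewrite mem_finsupp fsE; case: ifP => //.
by rewrite eqxx.
Qed.

Let fs_bary u : simplex_gauge u <= 1 -> is_barycentric K (fs u).
Proof.
move=> /simplex_gaugeP[_ Hu]; split.
- apply: (simplex_face Ks); first exact: fs_supp.
  apply/eqP => E; have := sum_supp (fs_supp u); rewrite E big_seq_fset0.
  under eq_bigr do rewrite fsE vtx_in.
  by rewrite sum_weight => /eqP; rewrite eq_sym oner_eq0.
- move=> v; rewrite fsE; case: ifP => // vs; have [i <-] := vtx_ex vs.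
  rewrite weight_vtx; have := Hu i.
  have -> : m%:R^-1 + (u ord0 i - mean u) =
    m%:R^-1 * (1 - m%:R * (mean u - u ord0 i)) by field; rewrite gt_eqF.
  by move=> H; apply: mulr_ge0; [rewrite invr_ge0 ltW|rewrite subr_ge0].
- rewrite sum_supp; last exact: fs_supp.
  by under eq_bigr do rewrite fsE vtx_in; exact: sum_weight.
Qed.

Let pt (u : 'rV[R]_m) : X :=
  if pselect (is_barycentric K (fs u)) is left H then exist _ (fs u) (mem_set H)
  else x0.

Let pt_bary u : simplex_gauge u <= 1 -> bary (pt u) = fs u.
Proof. by move=> /fs_bary H; rewrite /pt; case: pselect. Qed.

Let pt_in u : simplex_gauge u <= 1 -> closed_simplex s (pt u).
Proof. by move=> gu; rewrite /closed_simplex /= pt_bary//; exact: fs_supp. Qed.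

Let pt_vtx u i : simplex_gauge u <= 1 ->
  bary (pt u) (vtx i) = m%:R^-1 + (u ord0 i - mean u).
Proof. by move=> gu; rewrite pt_bary// fsE vtx_in weight_vtx. Qed.

Let Q : set 'rV[R]_m := [set u | simplex_gauge u <= 1].

Let cts_pt : cts_on Q pt.
Proof.
move=> u Qu B /(nbhs_realization Ks (pt_in Qu))[e e0 eB].
rewrite /= !nbhs_simpl /within /=.
have cw i : cts_on Q (fun u : 'rV[R]_m => u ord0 i - mean u).
  by have := @cts_on_mean R m Q => ?; cts.
have oW : relopen Q [set y : 'rV[R]_m | forall i : 'I_m,
    (u ord0 i - mean u) - e < y ord0 i - mean y /\
    y ord0 i - mean y < (u ord0 i - mean u) + e].
  apply: (@relopen_forall _ _ Q (fun i => [set y : 'rV[R]_m |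
    (u ord0 i - mean u) - e < y ord0 i - mean y /\
    y ord0 i - mean y < (u ord0 i - mean u) + e])) => i.
  by apply: relopenI; apply: relopen_lt => //; exact: cts_on_cst.
have Wu : forall i : 'I_m, (u ord0 i - mean u) - e < u ord0 i - mean u /\
    u ord0 i - mean u < (u ord0 i - mean u) + e by move=> i; lra.
apply: filterS (oW u Qu Wu) => y Wy Qy; apply: eB; first exact: pt_in.
move=> v vs; have [i <-] := vtx_ex vs; rewrite !pt_vtx// ltr_norml.
by have [] := Wy Qy i; lra.
Qed.

(* [e] and [c] are inverse bijections between the unit ball of the gauge and the
   prism over [s], and match the boundaries. *)
Let e (u : 'rV[R]_m) : X * R := (pt u, 2^-1 + mean u).

Let c (p : X * R) : 'rV[R]_m :=
  \row_i (bary p.1 (vtx i) - m%:R^-1 + (p.2 - 2^-1)).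

Let sum_bary (x : X) : closed_simplex s x -> \sum_i bary x (vtx i) = 1.
Proof.
by move=> sx; rewrite -sum_supp//; have /set_mem[_ _ H] := valP x.
Qed.

Let bary_ge0 (x : X) v : 0 <= bary x v.
Proof.
by have /set_mem[_ H _] := valP x; exact: H.
Qed.

Let mean_c p : closed_simplex s p.1 -> mean (c p) = p.2 - 2^-1.
Proof.
move=> sp; rewrite /mean; under eq_bigr do rewrite mxE.
have sc (a : R) : \sum_(i < m) a = a * m%:R.
  by rewrite sumr_const card_ord mulr_natr.
rewrite big_split /= big_split /= sum_bary// !sc mulNr mulVf ?gt_eqF//.
by rewrite subrr add0r mulfK// gt_eqF.
Qed.

Let c_in p : closed_simplex s p.1 -> 0 <= p.2 <= 1 -> Q (c p).
Proof.
move=> sp p01; apply/simplex_gaugeP; rewrite mean_c//; split.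
  have : `|p.2 - 2^-1| <= 2^-1 by rewrite ler_norml; lra.
  lra.
move=> i; rewrite mxE opprD addrCA subrr addr0 opprB mulrBr mulfV ?gt_eqF//.
by rewrite gerBl mulr_ge0// ltW.
Qed.

Let ce p : closed_simplex s p.1 -> 0 <= p.2 <= 1 -> e (c p) = p.
Proof.
move=> sp p01; have Qp := c_in sp p01; case: p sp p01 Qp => x t /= sx t01 Qp.
rewrite /e mean_c//= addrC subrK; congr (_, _); apply: val_inj => /=.
apply/fsfunP => v; rewrite -/(bary _) -/(bary _).
have [vs|vs] := boolP (v \in s).
  have [i <-] := vtx_ex vs; rewrite pt_vtx// mean_c//= mxE /=.
  by ring.
have out (w : X) : closed_simplex s w -> bary w v = 0.
  move=> sw; apply: fsfun_dflt; apply: contra vs; exact: (fsubsetP sw).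
by rewrite !out//; exact: pt_in.
Qed.

Let e_in u : Q u -> closed_simplex s (e u).1 /\ 0 <= (e u).2 <= 1.
Proof.
move=> Qu; split; first exact: pt_in.
have /simplex_gaugeP[+ _] := Qu; rewrite /e /=.
have : - `|mean u| <= mean u <= `|mean u| by rewrite -ler_norml.
lra.
Qed.

Definition prism_boundary : set (X * R) :=
  [set p | [/\ closed_simplex s p.1, 0 <= p.2 <= 1 &
    [\/ finsupp (bary p.1) <> s, p.2 = 0 | p.2 = 1]]].

Let e_boundary u : simplex_gauge u = 1 -> prism_boundary (e u).
Proof.
move=> gu; have Qu : Q u by rewrite /Q /= gu.
have [su t01] := e_in Qu; split => //.
have : ~ (simplex_gauge u < 1) by rewrite gu ltxx.
move=> nlt.
have [mu|mu] := eqVneq (2 * `|mean u|) 1.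
  case: (ger0P (mean u)) mu => _ mu; [constructor 3|constructor 2];
  by rewrite /e /=; lra.
constructor 1 => E; apply: nlt; apply/bigmax_ltP.
have /simplex_gaugeP[H1 H2] := Qu.
split; first by rewrite lt_neqAle mu.
move=> i _; rewrite lt_neqAle H2 andbT; apply/eqP => H.
have : vtx i \in finsupp (bary (e u).1) by rewrite E.
rewrite mem_finsupp pt_vtx//; apply/negP; rewrite negbK; apply/eqP.
have -> : u ord0 i - mean u = - (m%:R^-1 * (m%:R * (mean u - u ord0 i))).
  by rewrite mulKf ?gt_eqF// opprB.
by rewrite H mulr1 subrr.
Qed.

Let c_boundary p : prism_boundary p -> simplex_gauge (c p) = 1.
Proof.
move=> [sp p01 bp]; apply/le_anti; rewrite (c_in sp p01) /=.
have /simplex_gaugeP[H1 H2] := lexx (simplex_gauge (c p)).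
rewrite mean_c// in H1 H2.
case: bp => [ne|p0|p1]; last 2 first.
- by move: H1; rewrite p0 sub0r normrN ger0_norm//; lra.
- by move: H1; rewrite p1 ger0_norm; lra.
have [v vs nv] : exists2 v, v \in s & v \notin finsupp (bary p.1).
  apply: contrapT => H; apply: ne; apply/eqP; rewrite eqEfsubset sp /=.
  apply/fsubsetP => v vs; apply: contrapT => /negP nv; apply: H; by exists v.
have [i iv] := vtx_ex vs; apply: le_trans (H2 i).
rewrite mxE iv (fsfun_dflt nv) sub0r opprD addrCA subrr addr0 opprK.
by rewrite mulfV// gt_eqF.
Qed.

Variables (k n : nat).
Hypothesis Xk : k_connected R X k.
Hypothesis mnk : (#|` s| < n * k.+1)%N.

(** In the coordinates [e] the prism is a convex body whose dimension is the
    number of vertices of [s]. *)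
Lemma simplex_filling (U : 'I_n -> set (X * R)%type) (l : 'I_n -> X * R * R -> X) :
  loop_cover fst prism_boundary U l ->
  exists U' l', loop_cover fst (cyl (closed_simplex s)) U' l' /\
    forall j p, prism_boundary p -> (U' j p <-> U j p) /\
      (U j p -> forall t, 0 <= t <= 1 -> l' j (p, t) = l j (p, t)).
Proof.
move=> [oU cl ll cov].
have cpt' : cts_on Q (fun u => (e u).1) by exact: cts_pt.
have ce' : cts_on Q e.
  rewrite /e; apply: cts_on_pair; first exact: cts_pt.
  by have := @cts_on_mean R m Q => ?; cts.
pose E : set 'rV[R]_m := [set u | simplex_gauge u = 1].
have EQ : E `<=` Q by move=> u uE; rewrite /Q /= (uE : simplex_gauge u = 1).
have cc (A : set (X * R)%type) : cts_on A c.
  apply: cts_on_rowmx => i.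
  have cb : cts_on A (fun p => bary p.1 (vtx i)).
    by apply: (cts_on_comp (B := setT) _ (@cts_on_bary R V K _ _)) => //; cts.
  by cts.
have data : loop_cover (fun u => (e u).1) E (fun j => e @^-1` U j)
    (fun j ut => l j (e ut.1, ut.2)).
  split.
  - move=> j; apply: relopen_preimage (oU j); first exact: cts_on_sub EQ ce'.
    by move=> u; exact: e_boundary.
  - move=> j; apply: (cts_on_comp (f := fun ut => (e ut.1, ut.2)) _ (cl j)).
      apply: cts_on_pair; last by cts.
      by apply: (cts_on_comp _ ce'); [cts|move=> u [[/EQ]]].
    by move=> [u t] [[/= Eu Uu] t01]; split=> //; split=> //; exact: e_boundary.
  - by move=> j u Eu Uu; apply: ll => //; exact: e_boundary.
  - by move=> u Eu; apply: cov; exact: e_boundary.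
have gb (p : 'rV[R]_m) i : `|p ord0 i| <= 2 * simplex_gauge p.
  exact: simplex_gauge_bound.
have gZ (a : R) (p : 'rV[R]_m) : 0 <= a -> simplex_gauge (a *: p) = a * simplex_gauge p.
  exact: simplex_gaugeZ.
have gD (p q : 'rV[R]_m) : simplex_gauge (p + q) <= simplex_gauge p + simplex_gauge q.
  exact: simplex_gaugeD.
have cg (A : set 'rV[R]_m) : cts_on A (@simplex_gauge R m).
  exact: cts_on_simplex_gauge.
have [U' [l' [[oU' cl' ll' cov'] EU']]] :=
  gauge_filling Xk mnk cg (ler0n R 2) gZ gD gb cpt' data.
exists (fun j => c @^-1` U' j), (fun j pt => l' j (c pt.1, pt.2)); split; first split.
- move=> j; apply: relopen_preimage (oU' j); first exact: cc.
  by move=> p [sp p01]; exact: c_in.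
- move=> j; apply: (cts_on_comp (f := fun pt => (c pt.1, pt.2)) _ (cl' j)).
    apply: cts_on_pair; last by cts.
    by apply: (cts_on_comp (B := setT) _ (@cc setT)) => //; cts.
  by move=> [p t] [[[sp p01] Up] t01]; split=> //; split=> //; exact: c_in.
- move=> j p [sp p01] Up.
  have := ll' j (c p) (c_in sp p01) Up.
  by rewrite ce.
- by move=> p [sp p01]; have [j Uj] := cov' _ (c_in sp p01); exists j.
- move=> j p bp; have [sp p01 _] := bp.
  have [H1 H2] := EU' j (c p) (c_boundary bp).
  by move: H1 H2; rewrite /preimage /= ce.
Qed.

End simplex_filling.

(** * Extending loops over the cylinder on a complex *)

Section loop_cover_operations.
Context {R : realType} (X P : topologicalType) (n : nat).
Implicit Types (xi : P -> X) (Q : set P) (V : 'I_n -> set P)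
  (l : 'I_n -> P * R -> X).

Lemma loop_cover_eq xi Q V V' l l' :
  (forall j p, Q p -> (V j p <-> V' j p)) ->
  (forall j p t, Q p -> V j p -> 0 <= t <= 1 -> l j (p, t) = l' j (p, t)) ->
  loop_cover xi Q V l -> loop_cover xi Q V' l'.
Proof.
move=> VV' ll' [oV cl ll cov]; split.
- move=> j p Qp V'p; have Vp : V j p by apply/VV'.
  by apply: filterS (oV j p Qp Vp) => y Vy Qy; apply/VV' => //; exact: Vy.
- move=> j; have sub : @cyl R P (Q `&` V' j) `<=` cyl (Q `&` V j).
    by move=> [p t] [[Qp V'p] t01]; split=> //; split=> //; apply/VV'.
  apply: (cts_on_eq _ (cts_on_sub sub (cl j))) => -[p t] /sub[[Qp Vp] t01].
  exact: ll'.
- move=> j p Qp V'p; have Vp : V j p by apply/VV'.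
  by rewrite -!ll' ?lexx ?ler01//; exact: ll.
- by move=> p Qp; have [j Vj] := cov p Qp; exists j; apply/VV'.
Qed.

Lemma loop_cover_sub xi Q Q' V l :
  Q' `<=` Q -> loop_cover xi Q V l -> loop_cover xi Q' V l.
Proof.
move=> QQ [oV cl ll cov]; split.
- by move=> j; exact: relopen_sub (oV j).
- move=> j; apply: cts_on_sub (cl j) => p [[Qp Vp] t01].
  by split=> //; split=> //; exact: QQ.
- by move=> j p /QQ; exact: ll.
- by move=> p /QQ; exact: cov.
Qed.

Lemma loop_cover_paste (I : finType) (A : I -> set P) xi Q V l :
  (forall x, Q x -> exists i, A i x) -> (forall i, relopen Q (~` A i)) ->
  (forall i, loop_cover xi (Q `&` A i) V l) -> loop_cover xi Q V l.
Proof.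
move=> cov oA H; split.
- by move=> j; apply: (relopen_finite_paste cov oA) => i; have [] := H i.
- move=> j; apply: (@cts_on_finite_paste _ _ _ _ (fun i => fst @^-1` A i)).
  + by move=> [p t] [[/cov[i Ai] _] _]; exists i.
  + move=> i; have -> : ~` (fst @^-1` A i) = fst @^-1` (~` A i) :> set (P * R).
      by [].
    by apply: relopen_preimage (oA i); [cts|move=> p [[]]].
  + move=> i; have [_ + _ _] := H i => /(_ j); apply: cts_on_sub.
    by move=> p [[[Qp Vp] t01] Ap].
- by move=> j p Qp; have [i Ai] := cov p Qp; have [_ _ + _] := H i; apply.
- by move=> p Qp; have [i Ai] := cov p Qp; have [_ _ _ ] := H i; apply.
Qed.

End loop_cover_operations.

Lemma loop_cover_pullback (R : realType) (X P P' : topologicalType) (n : nat)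
    (xi : P -> X) (Q : set P) (V : 'I_n -> set P) (l : 'I_n -> P * R -> X)
    (Q' : set P') (f : P' -> P) :
  cts_on Q' f -> (forall p, Q' p -> Q (f p)) -> loop_cover xi Q V l ->
  loop_cover (xi \o f) Q' (fun j => f @^-1` V j) (fun j p => l j (f p.1, p.2)).
Proof.
move=> cf QQ [oV cl ll cov]; split.
- by move=> j; exact: relopen_preimage cf QQ (oV j).
- move=> j; apply: (cts_on_comp (f := fun p => (f p.1, p.2)) _ (cl j)).
    apply: cts_on_pair; last by cts.
    by apply: (cts_on_comp _ cf); [cts|move=> p [[]]].
  by move=> p [[Qp Vp] t01]; split=> //; split=> //; exact: QQ.
- by move=> j p Qp Vp; apply: ll => //; exact: QQ.
- by move=> p Qp; have [j Vj] := cov _ (QQ p Qp); exists j.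
Qed.

(** The weak topology survives products with compact factors: by the tube lemma,
    the points over which a whole compact set of parameters lies in [A] form a
    weakly open set. *)
Lemma relopen_realization_prod (R : realType) (V : choiceType)
    (K : simplicialComplex V) (T : normedModType R) (C : set T)
    (A : set (realization R K * T)) :
  compact C ->
  (forall s, simplex K s -> relopen (closed_simplex s `*` C) A) ->
  relopen (setT `*` C) A.
Proof.
move=> cC oA [x c] [_ Cc] Axc.
have Kx (y : realization R K) : simplex K (finsupp (bary y)).
  by have /set_mem[] := valP y.
have sx (y : realization R K) : closed_simplex (finsupp (bary y)) y.
  by rewrite /closed_simplex /=.
have [e e0 eA] : exists2 e : R, 0 < e & forall c', C c' -> `|c - c'| <= e -> A (x, c').
  have [[B1 B2] [/= B1x B2c] BA] := oA _ (Kx x) (x, c) (conj (sx x) Cc) Axc.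
  move: B2c => /nbhs_normP[e /= e0 eB]; exists (e / 2); first exact: divr_gt0.
  move=> c' Cc' cc'; apply: (BA (x, c')) => //=; split=> /=.
    exact: nbhs_singleton.
  by apply: eB => /=; lra.
pose J := C `&` [set c' | `|c - c'| <= e].
have cJ : compact J.
  apply: compact_closedI => //.
  rewrite -[X in closed X]setCK; apply: open_closedC; apply: relopen_setT.
  apply: relopen_le_setC; last exact: cts_on_cst.
  move=> y _; apply: cvg_norm; apply: cvgB; first exact: cvg_cst.
  exact: (@cts_on_id _ setT y I).
pose Om : set (realization R K) := [set y | forall c', J c' -> A (y, c')].
have oOm : open Om.
  move=> s Ks y sy Omy.
  have near_J : nbhs y [set z | J `<=` [set c' | closed_simplex s z -> C c' -> A (z, c')]].
    apply: (proj1 (compact_near_coveringP J) cJ _ (nbhs y)) => c' Jc'.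
    have [[B1 B2] [/= B1y B2c] BA] := oA _ Ks (y, c') (conj sy Jc'.1) (Omy c' Jc').
    exists (B2, B1) => //= -[c'' z] /= [B2c'' B1z] sz Cc''.
    exact: (BA (z, c'')).
  have [e' e'0 He'] := nbhs_realization Ks sy near_J.
  exists e' => // z sz yz c' Jc'; exact: (He' z sz yz c' Jc' sz Jc'.1).
have Omx : Om x by move=> c' [Cc' cc']; exact: eA.
exists (Om, [set c' | `|c - c'| < e]) => /=.
  split; first exact: open_nbhs_nbhs.
  by apply/nbhs_normP; exists e.
by move=> [y c'] /= [Omy cc'] [_ Cc']; apply: Omy; split=> //=; exact: ltW.
Qed.

Section complex_filling.
Context {R : realType} (V : choiceType) (K : simplicialComplex V) (k n : nat).
Local Notation X := (realization R K).
Local Notation closed_simplex := (@closed_simplex R V K).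
Hypothesis Xk : k_connected R X k.
Hypothesis small : forall s, simplex K s -> (#|` s| < n * k.+1)%N.
Variables (U0 : 'I_n -> set X) (l0 : 'I_n -> X * R -> X).
Hypothesis cover0 : loop_cover id setT U0 l0.

(* For a point of the complex: which sets contain it at each height of the
   cylinder, and the loop that they give there. *)
Let Y : Type := 'I_n -> R -> Prop * (R -> X).

Let dom (f : X -> Y) j : set (X * R)%type := [set p | (f p.1 j p.2).1].
Let lps (f : X -> Y) j (q : X * R * R) : X := (f q.1.1 j q.1.2).2 q.2.

Let ends_ok (U : 'I_n -> set (X * R)%type) (l : 'I_n -> X * R * R -> X) x : Prop :=
  forall j, [/\ U j (x, 0) <-> U0 j x,
    U0 j x -> forall t, 0 <= t <= 1 -> l j ((x, 0), t) = l0 j (x, t),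
    U j (x, 1) & forall t, 0 <= t <= 1 -> l j ((x, 1), t) = x].

Let ok (s : {fset V}) (f : X -> Y) : Prop := simplex K s ->
  loop_cover fst (cyl (closed_simplex s)) (dom f) (lps f) /\
  forall x, closed_simplex s x -> ends_ok (dom f) (lps f) x.

Let carrier (x : X) : {fset V} := finsupp (bary x).

Let carrier_dim s x : closed_simplex s x ->
  carrier x = s \/ (#|` carrier x| < #|` s|)%N.
Proof.
rewrite /closed_simplex /carrier /= => sx.
have [E|ne] := eqVneq (finsupp (bary x)) s; first by left.
by right; apply: fproper_ltn_card; rewrite fproperEneq ne.
Qed.

Let carrier_simplex x : simplex K (carrier x).
Proof. by have /set_mem[] := valP x. Qed.

Let carrier_closed x : closed_simplex (carrier x) x.
Proof. by rewrite /closed_simplex /=. Qed.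

Let n_gt0 : (0 < n)%N.
Proof.
have [[x _] _] := Xk; have := small (carrier_simplex x).
by case: (n).
Qed.

Let ok_local s f g : (forall x, closed_simplex s x -> f x = g x) ->
  ok s f -> ok s g.
Proof.
move=> fg okf Ks; have [cf ef] := okf Ks; split.
  apply: loop_cover_eq cf.
  - by move=> j p [sp _]; rewrite /dom /= fg.
  - by move=> j p t [sp _] _ _; rewrite /lps /= fg.
by move=> x sx j; have := ef x sx j; rewrite /dom /lps /= fg.
Qed.

(* The prescribed values at the two ends are put over whatever [f] says there. *)
Let bdom f j : set (X * R)%type :=
  [set p | [\/ p.2 = 0 /\ U0 j p.1, p.2 = 1 |
             [/\ p.2 <> 0, p.2 <> 1 & dom f j p]]].
Let blps f j (q : X * R * R) : X :=
  if q.1.2 == 0 then l0 j (q.1.1, q.2) else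
  if q.1.2 == 1 then q.1.1 else lps f j q.

Let bdom_dom f j x (t : R) : ends_ok (dom f) (lps f) x ->
  (dom f j (x, t) <-> bdom f j (x, t)).
Proof.
move=> ex; have [e0 _ e1 _] := ex j; rewrite /bdom /=.
have [->|/eqP t0] := eqVneq t 0.
  split; first by move/e0 => Ux; constructor 1.
  by case=> [[_ /e0]//|/eqP|[]//]; rewrite eq_sym oner_eq0.
have [->|/eqP t1] := eqVneq t 1; first by split=> // _; constructor 2.
by split=> [ft|[[]|//|[]]]//; constructor 3.
Qed.

Let blps_lps f j x (t u : R) : ends_ok (dom f) (lps f) x -> dom f j (x, t) ->
  0 <= u <= 1 -> lps f j ((x, t), u) = blps f j ((x, t), u).
Proof.
move=> ex + u01; have [e0 e0' e1 e1'] := ex j; rewrite /blps /=.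
have [->|t0] := eqVneq t 0; first by move/e0 => U0x; exact: e0'.
by have [->|//] := eqVneq t 1; move=> _; exact: e1'.
Qed.

Let ok_extend s f : (forall s', (#|` s'| < #|` s|)%N -> ok s' f) ->
  exists2 g, ok s g & forall x, closed_simplex s x -> carrier x <> s -> g x = f x.
Proof.
move=> okf; have [Ks|nKs] := pselect (simplex K s); last by exists f.
have ends_f x : closed_simplex s x -> carrier x <> s -> ends_ok (dom f) (lps f) x.
  move=> sx ne; have [//|lt] := carrier_dim sx.
  by have [_] := okf _ lt (carrier_simplex x); apply.
have bcover : loop_cover fst (prism_boundary s) (bdom f) (blps f).
  pose A (i : bool + s) : set (X * R)%type :=
    match i with
    | inl b => [set p | p.2 = b%:R]
    | inr v => [set p | bary p.1 (val v) = 0]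
    end.
  apply: (@loop_cover_paste R X _ n (bool + s)%type A).
  - move=> [x t] [/= sx t01 [ne|t0|t1]].
    + have [v vs nv] : exists2 v, v \in s & v \notin finsupp (bary x).
        apply: contrapT => H; apply: ne; apply/eqP; rewrite eqEfsubset sx /=.
        by apply/fsubsetP => v vs; apply: contrapT => /negP nv; apply: H; exists v.
      by exists (inr [` vs]%fset); rewrite /A /= (fsfun_dflt nv).
    + by exists (inl false).
    + by exists (inl true).
  - have cb v (S : set (X * R)%type) : cts_on S (fun p => bary p.1 v).
      by apply: (cts_on_comp (B := setT) _ (@cts_on_bary R V K _ _)) => //; cts.
    move=> [b|v]; apply: relopen_eq_setC => //; try exact: cts_on_cst.
    by cts.
  - move=> [[]|v].
    + have [j0] : exists j : 'I_n, True by exists (Ordinal n_gt0).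
      split.
      * by move=> j; apply: relopen_total => y [_ /= yE]; constructor 2.
      * move=> j; apply: (cts_on_eq (f := fun q => q.1.1)); last by cts.
        by move=> q [[[_ /= E] _] _]; rewrite /blps E oner_eq0 eqxx.
      * by move=> j [x t] [_ /= ->] _; rewrite /blps /= oner_eq0 eqxx.
      * by move=> [x t] [_ /= ->]; exists j0; constructor 2.
    + have := @loop_cover_pullback R X X (X * R)%type n id setT U0 l0
        (prism_boundary s `&` A (inl false)) fst.
      move=> /(_ ltac:(by cts) ltac:(by []) cover0); apply: loop_cover_eq.
      * move=> j [x t] [_ /= ->]; rewrite /bdom /=; split; first by constructor 1.
        by case=> [[]//|/eqP|[]//]; rewrite eq_sym oner_eq0.
      * by move=> j [x t] u [_ /= ->] _ _; rewrite /blps /= eqxx.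
    + pose s' := (s `\ val v)%fset.
      have vs : val v \in s := valP v.
      have sub p : (prism_boundary s `&` A (inr v)) p ->
          closed_simplex s' p.1 /\ carrier p.1 <> s.
        move=> [[sp _ _] /= pv]; split.
          rewrite /closed_simplex /= /s' fsubsetD1 sp /= mem_finsupp pv.
          by rewrite eqxx.
        move=> E; have : val v \in carrier p.1 by rewrite E.
          by rewrite mem_finsupp pv eqxx.
      have lt : (#|` s'| < #|` s|)%N.
        by rewrite /s' (cardfsD1 (val v) s) vs.
      have [Ks'|nKs'] := pselect (simplex K s'); last first.
        have no p : ~ (prism_boundary s `&` A (inr v)) p.
          move=> /sub[sp _]; apply: nKs'; apply: (simplex_face Ks).
            exact: fsubsetDl.
          apply: contraNneq (simplex_neq0 (carrier_simplex p.1)) => E.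
          by move: sp; rewrite /closed_simplex /= E fsubset0.
        split.
        * by move=> j p /no.
        * by move=> j [p t] [[/no]].
        * by move=> j p /no.
        * by move=> p /no.
      have [cf ef] := okf s' lt Ks'.
      have sub' : prism_boundary s `&` A (inr v) `<=` cyl (closed_simplex s').
        by move=> p Sp; split; [have [] := sub p Sp|case: Sp => -[]].
      apply: loop_cover_eq (loop_cover_sub sub' cf).
      * move=> j [x t] /sub[/= s'x _]; apply: bdom_dom; exact: ef.
      * by move=> j [x t] u /sub[/= s'x _] fx u01; apply: blps_lps => //; exact: ef.
have [[x0 _] _] := Xk.
have [U' [l' [cU' EU']]] := simplex_filling Ks x0 Xk (small Ks) bcover.
pose g x : Y := if carrier x == s then fun j t => (U' j (x, t), fun u => l' j ((x, t), u))
  else f x.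
have bd x (t : R) : closed_simplex s x -> 0 <= t <= 1 -> carrier x <> s ->
    prism_boundary s (x, t) by move=> sx t01 ne; split=> //; constructor 1.
exists g; last by move=> x sx /eqP/negPf ne; rewrite /g ne.
move=> _; split.
  apply: loop_cover_eq cU'.
  - move=> j [x t] [/= sx t01]; rewrite /dom /g /=; case: eqP => // ne.
    have [H _] := EU' j _ (bd x t sx t01 ne).
    apply: (iff_trans H); apply: iff_sym.
    by have := @bdom_dom f j x t (ends_f x sx ne).
  - move=> j [x t] u [/= sx t01] U'x u01; rewrite /lps /g /=; case: eqP => // ne.
    have [H1 H2] := EU' j _ (bd x t sx t01 ne).
    have bx := (H1.1 U'x); rewrite H2// -blps_lps//; first exact: ends_f.
    by apply/bdom_dom => //; exact: ends_f.
move=> x sx; have [E|ne] := eqVneq (carrier x) s; last first.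
  have := ends_f x sx (elimN eqP ne).
  by rewrite /ends_ok /dom /lps /= /g (negPf ne).
have b0 : prism_boundary s (x, 0) by split=> //=; [rewrite lexx ler01|constructor 2].
have b1 : prism_boundary s (x, 1) by split=> //=; [rewrite lexx ler01|constructor 3].
move=> j; have [H0 L0] := EU' j _ b0; have [H1 L1] := EU' j _ b1.
rewrite /dom /lps /g /= E eqxx /=.
have B1 : bdom f j (x, 1) by constructor 2.
have E0 : bdom f j (x, 0) <-> U0 j x.
  split; last by move=> Ux; constructor 1.
  by case=> [[]//|/eqP|[]//]; rewrite /= eq_sym oner_eq0.
split.
- exact: iff_trans H0 E0.
- by move=> /E0 Bx t t01; rewrite L0// /blps /= eqxx.
- exact: H1.2 B1.
- by move=> t t01; rewrite L1// /blps /= oner_eq0 eqxx.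
Qed.

(** The given loops at height 0 and constant loops at height 1 are joined over
    the cylinder on one skeleton of [K] after the other, by [simplex_filling]. *)
Lemma complex_filling : exists U l,
  loop_cover fst (cyl [set: X]) U l /\ forall x, ends_ok U l x.
Proof.
have [f okf] := skeleton_extension carrier_dim ok_local ok_extend
  (fun x j t => (True, fun u => x)) (n * k.+1).
have {}okf s : simplex K s -> loop_cover fst (cyl (closed_simplex s)) (dom f) (lps f) /\
    forall x, closed_simplex s x -> ends_ok (dom f) (lps f) x.
  by move=> Ks; apply: okf => //; exact: small.
exists (dom f), (lps f); split; last first.
  move=> x; have [_] := okf _ (carrier_simplex x); apply.
  exact: carrier_closed.
have cptI : compact [set t : R | 0 <= t <= 1].
  have -> : [set t : R | 0 <= t <= 1] = `[0, 1]%classic.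
    by apply/seteqP; split => t /=; rewrite in_itv.
  exact: segment_compact.
split.
- move=> j.
  have : relopen ([set: X] `*` [set t : R | 0 <= t <= 1]) (dom f j).
    apply: relopen_realization_prod cptI _ => s Ks.
    have [[oU _ _ _] _] := okf s Ks.
    by apply: relopen_sub (oU j) => -[x t].
  by apply: relopen_sub => -[x t].
- move=> j; apply: cts_on_open => G oG.
  pose C2 : set (R * R)%type := [set t : R | 0 <= t <= 1] `*` [set t : R | 0 <= t <= 1].
  pose W : set (X * (R * R))%type :=
    [set q | dom f j (q.1, q.2.1) /\ G (lps f j ((q.1, q.2.1), q.2.2))].
  have oW : relopen ([set: X] `*` C2) W.
    apply: relopen_realization_prod; first exact: compact_setX.
    move=> s Ks; have [[oU cl _ _] _] := okf s Ks.
    have oD : relopen (closed_simplex s `*` C2) [set q | dom f j (q.1, q.2.1)].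
      apply: (relopen_preimage (f := fun q => (q.1, q.2.1)) _ _ (oU j)); first by cts.
      by move=> [x [t u]] [/= sx [t01 u01]].
    apply: relopen_trans => //.
    apply: (relopen_preimage (f := fun q : X * (R * R) => ((q.1, q.2.1), q.2.2))
      _ _ (cts_on_preimage oG (cl j))); first by cts.
    by move=> [x [t u]] [[/= sx [t01 u01]] Dx].
  have := @relopen_preimage (X * R * R)%type (X * (R * R))%type
    (cyl (cyl [set: X] `&` dom f j)) ([set: X] `*` C2) W
    (fun q => (q.1.1, (q.1.2, q.2))).
  move=> /(_ ltac:(by cts) ltac:(by move=> [[x t] u] [[[_ /= t01] _] /= u01]) oW) oW'.
  apply: relopen_local => -[[x t] u] Sx Gx.
  exists ((fun q : X * R * R => (q.1.1, (q.1.2, q.2))) @^-1` W); split=> //.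
    by split=> //; case: Sx => -[].
  by move=> q _ [].
- move=> j [x t] [_ t01] Ux; have [[_ _ ll _] _] := okf _ (carrier_simplex x).
  by apply: ll => //; split=> //; exact: carrier_closed.
- move=> [x t] [_ t01]; have [[_ _ _ cov] _] := okf _ (carrier_simplex x).
  by apply: cov; split=> //; exact: carrier_closed.
Qed.

End complex_filling.

(** * Sections of the path fibration as functions of two variables *)

Section path_sections.
Context {R : realType} (X : topologicalType).
Local Notation I := (unit_interval R).

Lemma clampI_subproof (t : R) : clamp 0 1 t \in (`[0, 1]%classic : set R).
Proof. by apply/mem_set; rewrite /= in_itv /=; exact: clamp_itv. Qed.

Definition clampI (t : R) : I := exist _ (clamp 0 1 t) (clampI_subproof t).

Lemma val_unitP (u : I) : 0 <= \val u <= 1.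
Proof. by case: u => u /= /set_mem /=; rewrite in_itv. Qed.

Lemma clampI0 : clampI 0 = I0 R.
Proof. by apply: val_inj => /=; rewrite clamp_id// lexx ler01. Qed.

Lemma clampI1 : clampI 1 = I1 R.
Proof. by apply: val_inj => /=; rewrite clamp_id// lexx ler01. Qed.

Lemma continuous_clampI : continuous clampI.
Proof.
apply: continuous_comp_initial; apply: cts_on_setT.
by apply: (cts_on_eq (f := clamp 0 1)) => //; cts.
Qed.

(** Evaluation is continuous for the compact-open topology because each
    parameter has a compact neighborhood that the path keeps in a given open
    set. *)
Lemma uncurry_section (U : set (X * X)) (s : X * X -> pathSpace R X) :
  {within U, continuous s} ->
  cts_on (cyl U) (fun q : (X * X) * R => s q.1 (clampI q.2)).
Proof.
move=> /cts_on_within cs; apply: cts_on_open => G oG.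
apply: relopen_local => -[p t] [/= Up t01] Gpt.
have cf : continuous (fun t' : R => s p (clampI t')).
  by move=> t'; apply: continuous_comp; [exact: continuous_clampI|exact: cts_fun].
have [e /= e0 He] : exists2 e : R, 0 < e & forall t' : R, `|t - t'| < e -> G (s p (clampI t')).
  have : nbhs (t : R) [set t' : R | G (s p (clampI t'))].
    by apply: cf; exact: open_nbhs_nbhs.
  by move=> /nbhs_normP[e /= e0 eG]; exists e => // t' tt'; exact: eG.
pose J : set R := `[t - e / 2, t + e / 2]%classic.
pose KK : set I := clampI @` J.
have cK : compact KK.
  apply: continuous_compact; last exact: segment_compact.
  by apply: continuous_subspaceT; exact: continuous_clampI.
pose Om : set (pathSpace R X) := [set g | (g : I -> X) @` KK `<=` G].
have oOm : open Om.
  by exists [set g : {compact-open, I -> X} | g @` KK `<=` G] => //; exact: compact_open_open.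
exists ([set q : (X * X) * R | Om (s q.1)] `&` [set q | `|t - q.2| < e / 2]); split.
- apply: relopenI; last first.
    by apply: (@relopen_lt R _ _ (fun q => `|t - q.2|) (fun=> e / 2)); cts.
  apply: (relopen_preimage (f := fst)) (cts_on_preimage oOm cs); first by cts.
  by move=> q [].
- split => /=; last by rewrite subrr normr0; exact: divr_gt0.
  move=> _ [_ [t' Jt' <-] <-]; apply: He; move: Jt'; rewrite /J /= in_itv /=.
  by rewrite ltr_norml; lra.
- move=> [p' t'] [/= Up' t'01] [/= Op' tt']; apply: Op'.
  exists (clampI t') => //; exists t' => //; rewrite /J /= in_itv /=.
  by move: tt'; rewrite ltr_norml; lra.
Qed.

(** A path space neighborhood tests a path on compact sets of parameters, over
    which continuity in both variables is uniform. *)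
Lemma curry_section (V : set (X * X)) (L : X * X * R -> X) :
  cts_on (cyl V) L -> exists s : X * X -> pathSpace R X,
    {within V, continuous s} /\ forall p u, V p -> s p u = L (p, \val u).
Proof.
move=> cL; have cval : continuous (\val : I -> R) by exact: initial_continuous.
have H (p : X * X) : exists g : pathSpace R X, V p -> forall u, g u = L (p, \val u).
  have [Vp|nVp] := pselect (V p); last first.
    have cc : continuous (fun _ : I => p.1).
      by apply: cts_on_setT; exact: cts_on_cst.
    by exists (Continuous.Pack (Continuous.Class (isContinuous.Build _ _ _ cc))).
  have cf : continuous (fun u : I => L (p, \val u)).
    apply: cts_on_setT; apply: (cts_on_comp (f := fun u : I => (p, \val u)) _ cL).
      by apply: cts_on_pair; [exact: cts_on_cst|exact: continuous_cts_on].
    by move=> u _; split=> //=; exact: val_unitP.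
  by exists (Continuous.Pack (Continuous.Class (isContinuous.Build _ _ _ cf))).
have [s Hs] := choice H; exists s; split; last by move=> p u Vp; exact: Hs.
apply/cts_on_within; apply: cts_on_open => B [C oC <-] p Vp Cp.
have FF : Filter (within V (nbhs p)) by typeclasses eauto.
have cvgs : (fun y => s y : {compact-open, I -> X}) y @[y --> within V (nbhs p)] -->
    (s p : {compact-open, I -> X}).
  apply/compact_open_cvgP => K G cK oG sKG.
  have near_K : nbhs p [set y | K `<=` [set u | V y -> G (s y u)]].
    apply: (proj1 (compact_near_coveringP K) cK _ (nbhs p)) => u Ku.
    have : relopen [set q : I * (X * X) | V q.2]
        ((fun q => (q.2, \val q.1)) @^-1` (L @^-1` G)).
      apply: (relopen_preimage (f := fun q : I * (X * X) => (q.2, \val q.1)) _ _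
        (cts_on_preimage oG cL)).
        apply: cts_on_pair; first by cts.
        by apply: (cts_on_comp (B := setT) (f := fst) _ (continuous_cts_on cval)) => //; cts.
      by move=> [u' y] Vy; split=> //=; exact: val_unitP.
    move=> /(_ (u, p) Vp) Hup.
    have /Hup : ((fun q => (q.2, \val q.1)) @^-1` (L @^-1` G)) (u, p).
      rewrite /preimage /= -Hs//; apply: sKG; by exists u.
    move=> [[B1 B2] [/= B1u B2p] BV]; exists (B1, B2) => //= -[u' y] /= [B1u' B2y] Vy.
    by rewrite Hs//; exact: (BV (u', y)).
  rewrite /= !nbhs_simpl /within /=; apply: filterS near_K => y Hy Vy.
  by move=> _ [u Ku <-]; exact: Hy.
have := cvgs C; rewrite /= !nbhs_simpl /within /=; apply.
by apply: open_nbhs_nbhs.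
Qed.

End path_sections.

(** * From loops over the cylinder to reserved sections *)

Section diagonal_collar.
Context {R : realType} (X : topologicalType) (N : nat).
Variables (i : X -> 'rV[R]_N) (O : set 'rV[R]_N) (r : 'rV[R]_N -> 'rV[R]_N).
Hypothesis embed_i : topological_embedding i.
Hypothesis open_O : open O.
Hypothesis i_O : range i `<=` O.
Hypothesis cts_r : {within O, continuous r}.
Hypothesis r_O : r @` O `<=` range i.
Hypothesis ri : forall x, r (i x) = i x.

Let inj_i : injective i. Proof. by case: embed_i. Qed.

Let O_i x : O (i x). Proof. by apply: i_O; exists x. Qed.

Let cts_i (A : set X) : cts_on A i.
Proof.
apply: cts_on_open => G oG; apply: open_relopen.
by have [_ H] := embed_i; apply/H; exists G.
Qed.

Let seg (q : X * X * R) : 'rV[R]_N := i q.1.1 + q.2 *: (i q.1.2 - i q.1.1).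

Let gam_ex q : exists x, O (seg q) -> i x = r (seg q).
Proof.
have [Oq|nOq] := pselect (O (seg q)); last by exists q.1.1.
by have [x _ xE] : range i (r (seg q)); [apply: r_O; exists (seg q)|exists x].
Qed.

(** The straight segment from [x] to [y], retracted into the neighborhood
    retract: short segments stay in the domain of the retraction. *)
Let gam (q : X * X * R) : X := sval (cid (gam_ex q)).

Let gamE q : O (seg q) -> i (gam q) = r (seg q).
Proof. by rewrite /gam; case: cid => x /=. Qed.

Let cts_i2 (T : topologicalType) (A : set T) (f : T -> X) :
  cts_on A f -> cts_on A (fun q => i (f q)).
Proof. by move=> cf; apply: (cts_on_comp cf (@cts_i setT)). Qed.

Let cts_seg A : cts_on A seg.
Proof.
have c1 : cts_on A (fun q => i q.1.1) by apply: cts_i2; cts.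
have c2 : cts_on A (fun q => i q.1.2) by apply: cts_i2; cts.
by rewrite /seg; cts.
Qed.

Let cts_gam : cts_on [set q | O (seg q)] gam.
Proof.
apply: cts_on_open => G oG; have [_ H] := embed_i.
have [B oB GE] := (H G).1 oG.
have cr : cts_on [set q | O (seg q)] (fun q => r (seg q)).
  by apply: (cts_on_comp (@cts_seg _) ((cts_on_within _ _).2 cts_r)).
move=> q Oq Gq; have Bq : B (r (seg q)).
  by rewrite -gamE//; move: Gq; rewrite GE.
apply: filterS (cts_on_preimage oB cr Oq Bq) => q' Bq' Oq'.
by rewrite GE /preimage /= gamE//; exact: Bq'.
Qed.

Let seg0 p : seg (p, 0) = i p.1.
Proof. by rewrite /seg /= scale0r addr0. Qed.

Let seg1 p : seg (p, 1) = i p.2.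
Proof. by rewrite /seg /= scale1r addrCA subrr addr0. Qed.

Let gam0 p : gam (p, 0) = p.1.
Proof. by apply: inj_i; rewrite gamE seg0 ?ri. Qed.

Let gam1 p : gam (p, 1) = p.2.
Proof. by apply: inj_i; rewrite gamE seg1 ?ri. Qed.

Let gam_diag x t : gam ((x, x), t) = x.
Proof.
have E : seg ((x, x), t) = i x by rewrite /seg /= subrr scaler0 addr0.
by apply: inj_i; rewrite gamE E ?ri.
Qed.

(* Segments from [i x] shorter than [room x] stay in [O], so [gap p < 1] makes the
   segment between the two points of [p] available. *)
Let room x : R := cdist (~` O) (i x).

Let room_gt0 x : 0 < room x.
Proof.
apply: (@cdist_relopen_gt0 _ _ setT) => //; last by move=> /(_ (O_i x)).
by rewrite setCK; exact: open_relopen.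
Qed.

Let gap (p : X * X) : R := `|i p.1 - i p.2| / room p.1.

Let cts_gap (A : set (X * X)) : cts_on A gap.
Proof.
have c1 : cts_on A (fun p => i p.1) by apply: cts_i2; cts.
have c2 : cts_on A (fun p => i p.2) by apply: cts_i2; cts.
apply: cts_onM; first by cts.
apply: cts_onV; last by move=> p _; rewrite gt_eqF.
exact: (cts_on_comp c1 (@cts_on_cdist _ _ setT (~` O))).
Qed.

Let gap_diag x : gap (x, x) = 0.
Proof. by rewrite /gap subrr normr0 mul0r. Qed.

(* While [gap] decreases from 1 to [2 / 3], the second point moves along the
   segment until it meets the first one; from [2 / 3] to [1 / 3] the height in the
   cylinder grows from 0 to 1. *)
Let th p := clamp 0 1 (3 * gap p - 2).
Let tau p := clamp 0 1 (2 - 3 * gap p).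

Let th_itv p : 0 <= th p <= 1. Proof. exact: clamp_itv. Qed.
Let tau_itv p : 0 <= tau p <= 1. Proof. exact: clamp_itv. Qed.

Let seg_O p t : th p <= t -> t <= 1 -> O (seg (p, t)).
Proof.
move=> t0 t1; have [g1|g1] := leP 1 (gap p).
  have -> : t = 1.
    by apply/le_anti; rewrite t1 -(@clamp_hi R 0 1 (3 * gap p - 2))//; lra.
  by rewrite seg1.
have t0' : 0 <= t by apply: le_trans t0; have /andP[] := th_itv p.
apply: contrapT => nO.
have := @cdist_le _ _ (~` O) (i p.1) _ nO; rewrite leNgt => /negP; apply.
rewrite /seg /= opprD addrA subrr add0r normrN normrZ ger0_norm//.
move: g1; rewrite /gap ltr_pdivrMr// mul1r distrC => g1.
apply: le_lt_trans g1; exact: ler_piMl.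
Qed.

Let cts_th A : cts_on A th.
Proof. by have := @cts_gap A => ?; rewrite /th; cts. Qed.

Let cts_tau A : cts_on A tau.
Proof. by have := @cts_gap A => ?; rewrite /tau; cts. Qed.

Let in_cyl p : cyl [set: X] (p.1, tau p).
Proof. by split=> //; exact: tau_itv. Qed.

Let near_pt p : X := gam (p, th p).

Let cts_near (A : set (X * X)) : cts_on A near_pt.
Proof.
have ct := @cts_th A.
apply: (cts_on_comp (f := fun p => (p, th p)) _ cts_gam); first by cts.
by move=> p _; apply: seg_O => //; have /andP[] := th_itv p.
Qed.

Variables (n : nat) (U : 'I_n -> set (X * X)) (S : 'I_n -> X * X * R -> X).
Hypothesis open_U : forall j, open (U j).
Hypothesis cover_U : forall p, exists j, U j p.
Hypothesis cts_S : forall j, cts_on (cyl (U j)) (S j).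
Hypothesis S0 : forall j p, U j p -> S j (p, 0) = p.1.
Hypothesis S1 : forall j p, U j p -> S j (p, 1) = p.2.

Variables (W : 'I_n -> set (X * R)%type) (l : 'I_n -> X * R * R -> X).
Hypothesis cover_W : loop_cover fst (cyl [set: X]) W l.
Hypothesis W0 : forall j x, W j (x, 0) <-> U j (x, x).
Hypothesis l0 : forall j x t, U j (x, x) -> 0 <= t <= 1 ->
  l j ((x, 0), t) = S j ((x, x), t).
Hypothesis l1 : forall j x t, 0 <= t <= 1 -> l j ((x, 1), t) = x.

Let V j : set (X * X) :=
  [set p | if 2 / 3 <= gap p then U j (p.1, near_pt p) else W j (p.1, tau p)].

Let first_leg j (q : X * X * R) : X :=
  if 2 / 3 <= gap q.1 then S j ((q.1.1, near_pt q.1), q.2)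
  else l j ((q.1.1, tau q.1), q.2).

Let L j (q : X * X * R) : X :=
  if q.2 <= 2^-1 then first_leg j (q.1, 2 * q.2)
  else gam (q.1, th q.1 + (2 * q.2 - 1) * (1 - th q.1)).

Let tau0 p : gap p = 2 / 3 -> tau p = 0.
Proof. by rewrite /tau => ->; rewrite clamp_lo//; lra. Qed.

Let near_x p : gap p <= 2 / 3 -> near_pt p = p.1.
Proof. by move=> g; rewrite /near_pt /th clamp_lo ?gam0//; lra. Qed.

Let V_far j p : V j p -> 2 / 3 <= gap p -> U j (p.1, near_pt p).
Proof. by rewrite /V /= => + g; rewrite g. Qed.

Let V_close j p : V j p -> gap p <= 2 / 3 -> W j (p.1, tau p).
Proof.
rewrite /V /=; case: leP => // g Up g'.
have gE : gap p = 2 / 3 by apply/le_anti/andP.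
by rewrite tau0// W0; move: Up; rewrite near_x.
Qed.

Let open_V j : relopen setT (V j).
Proof.
have cg := @cts_gap setT.
pose A b : set (X * X) := if b then [set p | 2 / 3 <= gap p] else [set p | gap p <= 2 / 3].
apply: (@relopen_finite_paste _ bool setT A).
- by move=> p _; have [g|/ltW g] := leP (2 / 3) (gap p); [exists true|exists false].
- by case; apply: relopen_le_setC => //; exact: cts_on_cst.
- case.
  + apply: relopen_local => p [_ /= g] Vp.
    exists ((fun p => (p.1, near_pt p)) @^-1` U j); split.
    * apply: (cts_on_preimage (@open_U j)); apply: cts_on_pair; first by cts.
      exact: cts_near.
    * exact: V_far.
    * by move=> y [_ /= gy] Uy; rewrite /V /= gy.
  + have [oW _ _ _] := cover_W.
    apply: relopen_local => p [_ /= g] Vp.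
    exists ((fun p => (p.1, tau p)) @^-1` W j); split.
    * have ct := @cts_tau (setT `&` A false).
      apply: (relopen_preimage (f := fun p => (p.1, tau p)) _ _ (oW j)); first by cts.
      by move=> y _; exact: in_cyl.
    * exact: V_close.
    * move=> y [_ /= gy] Wy; rewrite /V /=; case: leP => // g'.
      have gE : gap y = 2 / 3 by apply/le_anti/andP.
      by rewrite near_x//; apply/W0; rewrite -(tau0 gE).
Qed.

Let leg0 j p : V j p -> first_leg j (p, 0) = p.1.
Proof.
move=> Vp; rewrite /first_leg /=; case: leP => g; first by rewrite S0//; exact: V_far.
have [_ _ ll _] := cover_W.
by apply: (ll j (p.1, tau p) _ _).1; [exact: in_cyl|apply: V_close => //; exact: ltW].
Qed.

Let leg1 j p : V j p -> first_leg j (p, 1) = near_pt p.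
Proof.
move=> Vp; rewrite /first_leg /=; case: leP => g; first by rewrite S1//; exact: V_far.
have [_ _ ll _] := cover_W; rewrite near_x ?ltW//.
by apply: (ll j (p.1, tau p) _ _).2; [exact: in_cyl|apply: V_close => //; exact: ltW].
Qed.

Let cts_leg j : cts_on (cyl (V j)) (first_leg j).
Proof.
have cg (A : set (X * X * R)) : cts_on A (fun q => gap q.1).
  by apply: (cts_on_comp _ (@cts_gap setT)) => //; cts.
have [_ cl _ _] := cover_W.
apply: cts_on_if => //; first exact: cts_on_cst.
- set A := (X in cts_on X _).
  apply: (cts_on_comp (f := fun q => ((q.1.1, near_pt q.1), q.2)) _ (@cts_S j)).
    have cn : cts_on A (fun q => near_pt q.1).
      by apply: (cts_on_comp _ (@cts_near setT)) => //; cts.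
    by cts.
  by move=> [p t] [[Vp t01] /= g]; split=> //; exact: V_far.
- set A := (X in cts_on X _).
  apply: (cts_on_comp (f := fun q => ((q.1.1, tau q.1), q.2)) _ (cl j)).
    have ct : cts_on A (fun q => tau q.1).
      by apply: (cts_on_comp _ (@cts_tau setT)) => //; cts.
    by cts.
  by move=> [p t] [[Vp t01] /= g]; split=> //; split; [exact: in_cyl|exact: V_close].
- move=> [p t] [Vp t01] /= /esym g.
  by rewrite tau0// near_x ?g// l0//; have := V_far Vp; rewrite g near_x ?g//; apply.
Qed.

Let cts_L j : cts_on (cyl (V j)) (L j).
Proof.
apply: cts_on_if.
- by cts.
- exact: cts_on_cst.
- apply: (cts_on_comp (f := fun q : X * X * R => (q.1, 2 * q.2)) _ (@cts_leg j)).
    by cts.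
  by move=> [p t] [[Vp /= t01] /= t2]; split=> //=; lra.
- set A := (X in cts_on X _).
  apply: (cts_on_comp (f := fun q : X * X * R =>
    (q.1, th q.1 + (2 * q.2 - 1) * (1 - th q.1))) _ cts_gam).
    have ct : cts_on A (fun q => th q.1).
      by apply: (cts_on_comp _ (@cts_th setT)) => //; cts.
    by cts.
  move=> [p t] [[Vp /= t01] /= t2]; have /andP[a0 a1] := th_itv p.
  have m0 : 0 <= (2 * t - 1) * (1 - th p) by apply: mulr_ge0; lra.
  have m1 : (2 * t - 1) * (1 - th p) <= 1 * (1 - th p) by apply: ler_wpM2r; lra.
  by apply: seg_O; lra.
- move=> [p t] [Vp t01] /= ->.
  have -> : 2 * 2^-1 = 1 :> R by rewrite mulfV.
  by rewrite leg1// subrr mul0r addr0.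
Qed.

(** Every new path ends with the part of the segment that leads from the near
    point to the second point. Before it comes the given path to the near point,
    or, once the near point is the first point, the loop at the height [tau] of
    the cylinder, which is constant close to the diagonal. *)
Lemma reserved_paths : exists (V' : 'I_n -> set (X * X)) (L' : 'I_n -> X * X * R -> X),
  [/\ forall j, open (V' j), forall p, exists j, V' j p,
      forall j, cts_on (cyl (V' j)) (L' j),
      forall j p, V' j p -> L' j (p, 0) = p.1 /\ L' j (p, 1) = p.2 &
      forall j x t, 0 <= t <= 1 -> L' j ((x, x), t) = x].
Proof.
exists V, L; split.
- by move=> j; apply: relopen_setT; exact: open_V.
- move=> p; rewrite /V /=; case: leP => g; first exact: cover_U.
  by have [_ _ _ cov] := cover_W; apply: cov; exact: in_cyl.
- exact: cts_L.
- move=> j p Vp; rewrite /L /=.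
  have -> : (0 <= 2^-1 :> R) by rewrite invr_ge0.
  have -> : (1 <= 2^-1 :> R) = false by lra.
  rewrite mulr0 leg0//; split=> //.
  by rewrite mulr1 addrK mul1r addrC subrK gam1.
- move=> j x t t01; rewrite /L /=; case: leP => t2; last exact: gam_diag.
  rewrite /first_leg /= gap_diag.
  have -> : (2 / 3 <= 0 :> R) = false by lra.
  by rewrite /tau gap_diag clamp_hi ?l1//; lra.
Qed.

End diagonal_collar.

(** * Topological complexity and its monoidal version *)

(** Over the diagonal the given sections are loops; [complex_filling] contracts
    them along the cylinder and [reserved_paths] spreads the contraction over a
    neighborhood of the diagonal. *)
Lemma TCM_cover_of_TC_cover (R : realType) (V : choiceType)
    (K : simplicialComplex V) (k n : nat) :
  k_connected R (realization R K) k -> ENR R (realization R K) ->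
  (forall s, simplex K s -> (#|` s| < n * k.+1)%N) ->
  TC_cover R (realization R K) n -> TCM_cover R (realization R K) n.
Proof.
move=> Xk [N [i [G [r [emb oO iO cr [rO ri]]]]]] small [U [oU covU secU]].
have [s Hs] := choice secU.
pose S (j : 'I_n) q := s j q.1 (clampI q.2).
have cS j : cts_on (cyl (U j)) (S j).
  by apply: uncurry_section; have [] := Hs j.
have S0 j p : U j p -> S j (p, 0) = p.1.
  by move=> Up; have [_ e] := Hs j; rewrite /S /= clampI0 -[in RHS](e p Up).
have S1 j p : U j p -> S j (p, 1) = p.2.
  by move=> Up; have [_ e] := Hs j; rewrite /S /= clampI1 -[in RHS](e p Up).
have coverU p : exists j, U j p.
  by have : setT p by []; rewrite -covU => -[j _ Uj]; exists j.
pose dg (x : realization R K) := (x, x).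
have cdg (A : set (realization R K)) : cts_on A dg by rewrite /dg; cts.
have cover0 : loop_cover id setT (fun j => dg @^-1` U j)
    (fun j q => S j (dg q.1, q.2)).
  split.
  - by move=> j; exact: cts_on_preimage (oU j) (@cdg _).
  - move=> j; apply: (cts_on_comp (f := fun q => (dg q.1, q.2)) _ (cS j)).
      by rewrite /dg; cts.
    by move=> [x t] [[_ Ux] t01].
  - by move=> j x _ Ux; rewrite S0 ?S1.
  - by move=> x _; exact: coverU.
have [W [l [covW eW]]] := complex_filling Xk small cover0.
have W0 j x : W j (x, 0) <-> U j (x, x) by have [] := eW x j.
have l0 j x t : U j (x, x) -> 0 <= t <= 1 -> l j ((x, 0), t) = S j ((x, x), t).
  by have [_ H _ _] := eW x j => Ux; exact: (H Ux).
have l1 j x t : 0 <= t <= 1 -> l j ((x, 1), t) = x.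
  by have [_ _ _ H] := eW x j; exact: H.
have [V' [L' [oV' covV' cL' eL' dL']]] :=
  reserved_paths emb oO iO cr rO ri oU coverU cS S0 S1 covW W0 l0 l1.
exists V'; split=> //.
  apply/seteqP; split=> // p _; have [j Vj] := covV' p; by exists j.
move=> j; have [s' [cs' es']] := curry_section (cL' j).
exists s'.
  split=> // -[x y] Vp; rewrite /endpoints !es'//=.
  by have [-> ->] := eL' j _ Vp.
by move=> x Vx t; rewrite es'// dL'//; exact: val_unitP.
Qed.

Theorem theorem2p5 (R : realType) (V : choiceType) (K : simplicialComplex V)
    (k : nat) :
  k_connected R (realization R K) k ->
  ENR R (realization R K) ->
  (complex_dim R K + 1 < k.+1%:R%:E * TC R (realization R K))%E ->
  TC R (realization R K) = TCM R (realization R K).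
Proof.
move=> Xk enr dimK; apply/le_anti/andP; split.
  apply: le_ereal_inf => _ [n [U [oU cov sec]] <-]; exists n => //.
  by exists U; split=> // j; have [s cs _] := sec j; exists s.
have [[n0 cov0]|none] := pselect (exists n, TC_cover R (realization R K) n); last first.
  suff -> : TC R (realization R K) = +oo%E by rewrite leey.
  rewrite /TC; have -> : TC_cover R (realization R K) = set0.
    by apply/seteqP; split=> // n Hn; apply: none; exists n.
  by rewrite image_set0 ereal_inf0.
have ex : exists n, `[< TC_cover R (realization R K) n >].
  by exists n0; apply/asboolP.
case: (ex_minnP ex) => n /asboolP covn minn.
have TCn : TC R (realization R K) = n%:R%:E.
  apply/le_anti/andP; split; first by apply: ereal_inf_lbound; exists n.
  apply: le_ereal_inf_tmp => _ [n' covn' <-]; rewrite lee_fin ler_nat.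
  by apply: minn; apply/asboolP.
have small s : simplex K s -> (#|` s| < n * k.+1)%N.
  move=> Ks; rewrite -(ltr_nat R) -lte_fin; move: dimK; rewrite TCn => dimK.
  have : ((#|` s|%:R - 1)%:E + 1 <= complex_dim R K + 1)%E.
    by apply: leeD2r; apply: ereal_sup_ubound; exists s.
  move=> /le_lt_trans /(_ dimK); rewrite -EFinM -EFinD subrK.
  by rewrite -natrM mulnC.
rewrite TCn; apply: ereal_inf_lbound; exists n => //.
exact: (TCM_cover_of_TC_cover Xk enr small covn).
Qed.
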